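(* Let $q_0:\mathbb{Z}\to\mathbb{D}$ be such that $\prod_{n\in\mathbb{Z}}(1-|q_0(n)|^2)\ge\eta$ for some $\eta>0$, and let $q$ be the solution of the Ablowitz–Ladik equation with initial datum $q_0$. Let $N\ge 0$ be an integer, let $q_{0,N}(n)=q_0(n)$ for $|n|\le N$ and $q_{0,N}(n)=0$ for $|n|>N$, and let $q_N$ be the solution of the Ablowitz–Ladik equation with initial datum $q_{0,N}$. Then for all $j\in\mathbb{Z}$ with $N\ge|j|$, all $t>0$ and all $r\in(0,1)$, $$|q(t,j)-q_N(t,j)|\le\frac{4e^{t/r}C(\eta,r)}{1-r}\,r^{N-|j|}.$$
   Context: $\mathbb{D}$ is the open unit disk in $\mathbb{C}$. The (defocusing) Ablowitz–Ladik equation with initial datum $q_0:\mathbb{Z}\to\mathbb{D}$ is $$\frac{\partial}{\partial t}q(t,n)=i\bigl(1-|q(t,n)|^2\bigr)\bigl(q(t,n-1)+q(t,n+1)\bigr),\qquad q(0,n)=q_0(n),\qquad n\in\mathbb{Z},\ t\in\mathbb{R}.$$ For every $q_0:\mathbb{Z}\to\mathbb{D}$ it has a unique global classical solution $q:\mathbb{R}\times\mathbb{Z}\to\mathbb{C}$, and $|q(t,n)|<1$ for all $t,n$. The constant is $$C(\eta,r)=\exp\left(\log\eta^{-1}\cdot\left(2+\frac{1}{1-\sqrt{1-\eta}}\right)\left(\frac{4}{(1-r)^2}+1\right)\right).$$ *)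

(* Defs.v *)
From Stdlib Require Import Reals ZArith.
From Coquelicot Require Import Coquelicot.
Open Scope R_scope.

Definition AL_rhs (u : Z -> C) (n : Z) : C :=
  (Ci * RtoC (1 - Cmod (u n) ^ 2) * (u (n - 1)%Z + u (n + 1)%Z))%C.

(* The bound |q t n| < 1 is not required here: it follows from the equation
   when the initial datum takes values in the open unit disk. *)
Definition AL_solution (q0 : Z -> C) (q : R -> Z -> C) : Prop :=
  (forall n : Z, q 0 n = q0 n) /\
  (forall (t : R) (n : Z),
     @is_derive R_AbsRing C_R_NormedModule
       (fun s : R => q s n) t (AL_rhs (q t) n)).

(* [prod_f_R0 g m] is the product of g 0, ..., g m (m + 1 factors), so this is
   the product of f n over - N <= n <= N. *)
Definition partial_prodZ (f : Z -> R) (N : nat) : R :=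
  prod_f_R0 (fun k : nat => f (Z.of_nat k - Z.of_nat N)%Z) (2 * N).

(* Used only for factors in (0, 1]: the partial products are then nonincreasing
   and positive, so the limit exists, is finite, and does not depend on the
   order of the factors. *)
Definition prodZ (f : Z -> R) : Rbar := Lim_seq (partial_prodZ f).

Definition truncate (N : nat) (q0 : Z -> C) (n : Z) : C :=
  if (Z.abs n <=? Z.of_nat N)%Z then q0 n else RtoC 0.

Definition Cconst (eta r : R) : R :=
  exp (ln (/ eta) * (2 + 1 / (1 - sqrt (1 - eta))) * (4 / (1 - r) ^ 2 + 1)).

(* Main.v *)
Require Import Defs.
From Stdlib Require Import Reals ZArith.
From Coquelicot Require Import Coquelicot.
From Stdlib Require Import Lra Lia Psatz List.
Open Scope R_scope.

(** Attach to a sequence [u : Z -> C] in the disc the Schur functions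
[f_n(z) = (u_n + z f_{n+1}(z)) / (1 + conj u_n z f_{n+1}(z))], so that
[f_n(0) = u_n].  Three facts about them give the theorem.

In time: when [u] solves the lattice equation, [f_n(t, z)] satisfies a scalar
Riccati equation whose coefficients involve only [u_{n-1}] and [u_n]
([schur_iter_deriv]).  For finitely supported initial data these two entries
are super-exponentially small at the far left ([AL_tail_small]), so that there
[f_n] evolves like the free equation [f' = i (z + 1/z) f], which on [|z| = r]
grows at most like [exp (t / r)].  The difference of the Schur functions of two
solutions grows no faster, up to a small error ([schur_boundary_growth]).

At time zero: if the two data agree up to site [N], then at the far left site
[-m] their Schur functions differ on [|z| = r] by at most a constant times
[r ^ (N + 1 + m)], because each common coefficient contributes a factor [z]
([schur_diff_common]).

Back to the site [j]: the Schur algorithm recovers [f_{n+1}] from [f_n] by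
removing the constant term and dividing by [z].  In the mean square over
[|z| = r], removing the constant term is a contraction, so a step costs only
[1 / r], times a factor [1 + s_n] where [s_n] is quadratic in the sequences and
hence summable ([schur_dist2_step]).  Going from [-m] to [j] costs
[r ^ (- (j + m))], which leaves [r ^ (N + 1 - j)].

The sums of all the costs are controlled by [sum |u_n|^2], thus by
[ln (1 / eta)], because the product of the [1 - |u_n|^2] is conserved
([AL_log_mass_le]); this is where the constant comes from
([exponent_budget], [one_sided_estimate]).

For the theorem, [q_0] is cut off to [[-K, K]] and to [[-K, N]].  The
corresponding solutions exist by Picard iteration ([AL_forward_exists]).  The
solution [q] is close to the first one when [K] is large, by finite speed of
propagation ([AL_finite_speed]); the first one is compared with the second by
the estimate above, and the second with [q_N] by the same estimate after the
reflection [n -> -n]. *)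

(** * Calculus of complex-valued functions of a real variable *)

Lemma is_derive_Rconst (c t : R) : is_derive (fun _ : R => c) t 0.
Proof. exact (is_derive_const (K := R_AbsRing) (V := R_NormedModule) c t). Qed.

Lemma is_derive_Rplus (f g : R -> R) t a b :
  is_derive f t a -> is_derive g t b -> is_derive (fun s => f s + g s) t (a + b).
Proof. exact (is_derive_plus (K := R_AbsRing) (V := R_NormedModule) f g t a b). Qed.

Lemma is_derive_Rminus (f g : R -> R) t a b :
  is_derive f t a -> is_derive g t b -> is_derive (fun s => f s - g s) t (a - b).
Proof. exact (is_derive_minus (K := R_AbsRing) (V := R_NormedModule) f g t a b). Qed.

Lemma is_derive_Ropp (f : R -> R) t a :
  is_derive f t a -> is_derive (fun s => - f s) t (- a).
Proof. exact (is_derive_opp (K := R_AbsRing) (V := R_NormedModule) f t a). Qed.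

Lemma is_derive_Rmult (f g : R -> R) t a b :
  is_derive f t a -> is_derive g t b -> is_derive (fun s => f s * g s) t (a * g t + f t * b).
Proof. intros H K. apply (is_derive_mult f g t a b H K). intros; apply Rmult_comm. Qed.

Lemma is_derive_Rscal (f : R -> R) t c a :
  is_derive f t a -> is_derive (fun s => c * f s) t (c * a).
Proof. intros H. exact (is_derive_scal f t c a H). Qed.

(** Componentwise, so that the product and quotient rules reduce to those of real
functions. *)
Definition Cderiv (h : R -> C) (t : R) (l : C) : Prop :=
  is_derive (fun s => fst (h s)) t (fst l) /\ is_derive (fun s => snd (h s)) t (snd l).

Lemma Cderiv_of_is_derive (h : R -> C) t l :
  @is_derive R_AbsRing C_R_NormedModule h t l -> Cderiv h t l.
Proof.
  intros H; split.
  - apply (filterdiff_comp' h (fun c : C => fst c) t _ (fun c : C => fst c) H).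
    apply (filterdiff_linear (K := R_AbsRing) (U := C_R_NormedModule) (V := R_NormedModule) (fun c => fst c)).
    apply is_linear_fst.
  - apply (filterdiff_comp' h (fun c : C => snd c) t _ (fun c : C => snd c) H).
    apply (filterdiff_linear (K := R_AbsRing) (U := C_R_NormedModule) (V := R_NormedModule) (fun c => snd c)).
    apply is_linear_snd.
Qed.

Lemma Cderiv_unique_eq h t l l' : Cderiv h t l -> l = l' -> Cderiv h t l'.
Proof. intros H <-; exact H. Qed.

Lemma Cderiv_const c t : Cderiv (fun _ => c) t 0%C.
Proof. split; apply is_derive_Rconst. Qed.

Lemma Cderiv_plus h k t l m : Cderiv h t l -> Cderiv k t m -> Cderiv (fun s => h s + k s)%C t (l + m)%C.
Proof. intros [H1 H2] [K1 K2]; split; apply is_derive_Rplus; assumption. Qed.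

Lemma Cderiv_minus h k t l m : Cderiv h t l -> Cderiv k t m -> Cderiv (fun s => h s - k s)%C t (l - m)%C.
Proof. intros [H1 H2] [K1 K2]; split; apply is_derive_Rminus; assumption. Qed.

Lemma Cderiv_conj h t l : Cderiv h t l -> Cderiv (fun s => Cconj (h s)) t (Cconj l).
Proof. intros [H1 H2]; split; simpl; [exact H1|apply is_derive_Ropp; exact H2]. Qed.

Lemma Cderiv_mult h k t l m :
  Cderiv h t l -> Cderiv k t m -> Cderiv (fun s => h s * k s)%C t (l * k t + h t * m)%C.
Proof.
  intros [H1 H2] [K1 K2]; split.
  - replace (fst (l * k t + h t * m)%C) with
      ((fst l * fst (k t) + fst (h t) * fst m) - (snd l * snd (k t) + snd (h t) * snd m))
      by (simpl; ring).
    apply is_derive_Rminus; apply is_derive_Rmult; assumption.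
  - replace (snd (l * k t + h t * m)%C) with
      ((fst l * snd (k t) + fst (h t) * snd m) + (snd l * fst (k t) + snd (h t) * fst m))
      by (simpl; ring).
    apply is_derive_Rplus; apply is_derive_Rmult; assumption.
Qed.

Lemma Cmod_sqr (c : C) : Cmod c ^ 2 = fst c ^ 2 + snd c ^ 2.
Proof. rewrite Cmod2_alt. reflexivity. Qed.

Lemma Cderiv_sqr h t l : Cderiv h t l ->
  is_derive (fun s => Cmod (h s) ^ 2) t (2 * Re (Cconj (h t) * l)%C).
Proof.
  intros [H1 H2].
  apply (is_derive_ext (fun s => fst (h s) * fst (h s) + snd (h s) * snd (h s))).
  { intros s. rewrite Cmod_sqr. simpl; ring. }
  replace (2 * Re (Cconj (h t) * l)%C) with
   ((fst l * fst (h t) + fst (h t) * fst l) + (snd l * snd (h t) + snd (h t) * snd l))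
   by (unfold Re; simpl; ring).
  apply is_derive_Rplus; apply is_derive_Rmult; assumption.
Qed.

Lemma Cmod_sqr_pos (c : C) : c <> RtoC 0 -> 0 < fst c ^ 2 + snd c ^ 2.
Proof.
  intros H. rewrite <- Cmod_sqr. apply pow_lt. now apply Cmod_gt_0.
Qed.

Lemma Cderiv_inv (h : R -> C) t l : h t <> RtoC 0 -> Cderiv h t l ->
  Cderiv (fun s => / h s)%C t (- l / (h t * h t))%C.
Proof.
  intros Hn [H1 H2].
  pose proof (Cmod_sqr_pos _ Hn) as Hp.
  assert (Hd : is_derive (fun s => / (fst (h s) * fst (h s) + snd (h s) * snd (h s))) t
    (- ((fst l * fst (h t) + fst (h t) * fst l) + (snd l * snd (h t) + snd (h t) * snd l)) /
      (fst (h t) * fst (h t) + snd (h t) * snd (h t)) ^ 2)).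
  { apply (is_derive_inv (fun s => fst (h s) * fst (h s) + snd (h s) * snd (h s)) t).
    apply is_derive_Rplus; apply is_derive_Rmult; assumption.
    intros E; simpl in E. simpl in Hp. nra. }
  assert (N2 : fst (h t) ^ 2 + snd (h t) ^ 2 <> 0) by lra.
  split.
  - apply (is_derive_ext (fun s => fst (h s) * / (fst (h s) * fst (h s) + snd (h s) * snd (h s)))).
    { intros s. simpl. rewrite !Rmult_1_r. reflexivity. }
    evar (L : R). replace (fst (- l / (h t * h t))%C) with L; [subst L; apply is_derive_Rmult; [exact H1|exact Hd]|].
    subst L. destruct l as [a b]. destruct (h t) as [x y]. simpl in *.
    field. split.
    { intros E. apply N2. nra. }
    { intros E. simpl in *. nra. }
  - apply (is_derive_ext (fun s => (- snd (h s)) * / (fst (h s) * fst (h s) + snd (h s) * snd (h s)))).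
    { intros s. simpl. rewrite !Rmult_1_r. reflexivity. }
    evar (L : R). replace (snd (- l / (h t * h t))%C) with L; [subst L; apply is_derive_Rmult; [apply is_derive_Ropp; exact H2|exact Hd]|].
    subst L. destruct l as [a b]. destruct (h t) as [x y]. simpl in *.
    unfold opp; simpl. field. split.
    { intros E. apply N2. nra. }
    { intros E. simpl in *. nra. }
Qed.

Lemma Cderiv_div (h k : R -> C) t l m : k t <> RtoC 0 -> Cderiv h t l -> Cderiv k t m ->
  Cderiv (fun s => h s / k s)%C t ((l * k t - h t * m) / (k t * k t))%C.
Proof.
  intros Hn Hh Hk.
  eapply Cderiv_unique_eq.
  - apply (Cderiv_mult h (fun s => / k s)%C); [exact Hh|apply Cderiv_inv; [exact Hn|exact Hk]].
  - simpl. field. auto.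
Qed.

Lemma MVT_le (f g f' g' : R -> R) (a b : R) : a <= b ->
  (forall s, a <= s <= b -> is_derive f s (f' s)) ->
  (forall s, a <= s <= b -> is_derive g s (g' s)) ->
  (forall s, a <= s <= b -> f' s <= g' s) -> f b - f a <= g b - g a.
Proof.
  intros Hab Hf Hg Hl.
  destruct (Req_dec a b) as [->|Hne]; [lra|].
  destruct (MVT_cor2 (fun s => f s - g s) (fun s => f' s - g' s) a b) as [c [Hc1 Hc2]].
  - lra.
  - intros c Hc. apply is_derive_Reals. apply is_derive_Rminus; auto.
  - assert (f' c <= g' c) by (apply Hl; lra). nra.
Qed.

Lemma Re_le_Cmod c : Re c <= Cmod c.
Proof. eapply Rle_trans; [apply Rle_abs|apply re_le_Cmod]. Qed.

(** Project on the direction [w = h b - h a] and apply the real inequality to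
[Re (conj w h)]. *)
Lemma Cmod_MVT (h h' : R -> C) (g g' : R -> R) (a b : R) : a <= b ->
  (forall s, a <= s <= b -> Cderiv h s (h' s)) ->
  (forall s, a <= s <= b -> is_derive g s (g' s)) ->
  (forall s, a <= s <= b -> Cmod (h' s) <= g' s) -> Cmod (h b - h a) <= g b - g a.
Proof.
  intros Hab Hh Hg Hl.
  set (w := (h b - h a)%C).
  assert (Hw : Cmod w ^ 2 <= Cmod w * (g b - g a)).
  { replace (Cmod w ^ 2) with ((fst w * fst (h b) + snd w * snd (h b)) - (fst w * fst (h a) + snd w * snd (h a))).
    2:{ rewrite Cmod_sqr. unfold w; simpl; ring. }
    rewrite Rmult_minus_distr_l.
    apply (MVT_le (fun s => fst w * fst (h s) + snd w * snd (h s)) (fun s => Cmod w * g s)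
             (fun s => fst w * fst (h' s) + snd w * snd (h' s)) (fun s => Cmod w * g' s)); auto.
    - intros s Hs. destruct (Hh s Hs) as [H1 H2].
      apply is_derive_Rplus; apply is_derive_Rscal; assumption.
    - intros s Hs. apply is_derive_Rscal. auto.
    - intros s Hs. replace (_ + _) with (Re (Cconj w * h' s)%C) by (unfold Re; simpl; ring).
      eapply Rle_trans; [apply Re_le_Cmod|]. rewrite Cmod_mult, Cmod_conj.
      apply Rmult_le_compat_l; [apply Cmod_ge_0|auto]. }
  pose proof (Cmod_ge_0 w).
  destruct (Req_dec (Cmod w) 0) as [E|E].
  - rewrite E. 
    assert (0 <= g b - g a).
    { enough (0 - 0 <= g b - g a) by lra.
      apply (MVT_le (fun _ => 0) g (fun _ => 0) g' a b Hab); auto.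
      - intros s Hs; apply is_derive_Rconst.
      - intros s Hs. eapply Rle_trans; [apply Cmod_ge_0|auto]. }
    lra.
  - nra.
Qed.

Lemma Re_RtoC_mult (x : R) (c : C) : Re (RtoC x * c)%C = x * Re c.
Proof. unfold Re; simpl; ring. Qed.

Lemma Cmod_triangle_rev c d : Rabs (Cmod c - Cmod d) <= Cmod (c - d).
Proof.
  pose proof (Cmod_triangle (c - d) d) as T1. pose proof (Cmod_triangle (d - c) c) as T2.
  replace (c - d + d)%C with c in T1 by ring. replace (d - c + c)%C with d in T2 by ring.
  replace (d - c)%C with (- (c - d))%C in T2 by ring. rewrite Cmod_opp in T2. apply Rabs_le; lra.
Qed.

Lemma Cmod_le_Rabs_sum (c : C) : Cmod c <= Rabs (fst c) + Rabs (snd c).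
Proof.
  apply Rsqr_incr_0_var; [|pose proof (Rabs_pos (fst c)); pose proof (Rabs_pos (snd c)); lra].
  rewrite !Rsqr_pow2, Cmod_sqr.
  rewrite <- (pow2_abs (fst c)), <- (pow2_abs (snd c)).
  pose proof (Rabs_pos (fst c)). pose proof (Rabs_pos (snd c)). nra.
Qed.

Lemma exp_monotone x y : x <= y -> exp x <= exp y.
Proof. intros [H | ->]; [apply Rlt_le, exp_increasing, H|apply Rle_refl]. Qed.

Lemma ln_le_sub_1 x : 0 < x -> ln x <= x - 1.
Proof.
  intros Hx. destruct (Req_dec x 1) as [->|H]; [rewrite ln_1; lra|].
  pose proof (exp_ineq1_le (ln x)). rewrite exp_ln in H0 by exact Hx. lra.
Qed.

Lemma is_derive_Rexp (c t : R) : is_derive (fun s => exp (c * s)) t (c * exp (c * t)).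
Proof. auto_derive; [exact I|ring]. Qed.

Lemma is_derive_exp_term (c t : R) m :
  is_derive (fun s => (c * s) ^ S m / INR (fact (S m))) t (c * ((c * t) ^ m / INR (fact m))).
Proof.
  auto_derive; [exact I|].
  change (match m with O => 1 | S _ => INR m + 1 end) with (INR (S m)).
  rewrite plus_INR, mult_INR, S_INR.
  pose proof (pos_INR m). pose proof (INR_fact_neq_0 m).
  field. repeat split; try assumption; try lra.
  replace (INR (fact m) + INR m * INR (fact m)) with ((INR m + 1) * INR (fact m)) by ring.
  apply Rmult_integral_contrapositive; split; [lra|assumption].
Qed.

(** Every limit passage below (support of the data, distance of the left end)
has an error of this super-exponentially small form. *)
Lemma le_of_factorial_error (X Y A Q : R) :
  (forall p : nat, X <= Y + A * (Q ^ p / INR (fact p))) -> X <= Y.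
Proof.
  intros H. apply (is_lim_seq_le (fun _ => X) (fun p => Y + A * (Q ^ p / INR (fact p))) X Y H).
  - apply is_lim_seq_const.
  - replace (Finite Y) with (Finite (Y + A * 0)) by (f_equal; ring).
    apply is_lim_seq_plus'; [apply is_lim_seq_const|].
    apply (is_lim_seq_scal_l (fun p => Q ^ p / INR (fact p)) A 0).
    apply is_lim_seq_Reals, cv_speed_pow_fact.
Qed.

(** Differential inequality of Gronwall type: [rho ^ 2 exp (2 C0 s)] is
nondecreasing, so [rho] has no zero, and it keeps its sign. *)
Lemma stays_positive (rho rho' : R -> R) (C0 T : R) : 0 <= C0 -> 0 <= T ->
  (forall s, 0 <= s <= T -> is_derive rho s (rho' s)) ->
  (forall s, 0 <= s <= T -> Rabs (rho' s) <= C0 * Rabs (rho s)) ->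
  0 < rho 0 -> 0 < rho T.
Proof.
  intros HC HT Hd Hb H0.
  assert (Hnz : forall s, 0 <= s <= T -> rho s <> 0).
  { intros s Hs E.
    assert (Hm : 0 - 0 <= rho s * rho s * exp (2 * C0 * s) - rho 0 * rho 0 * exp (2 * C0 * 0)).
    { apply (MVT_le (fun _ => 0) (fun s => rho s * rho s * exp (2 * C0 * s)) (fun _ => 0)
       (fun s => (rho' s * rho s + rho s * rho' s) * exp (2 * C0 * s) + rho s * rho s * (2 * C0 * exp (2 * C0 * s)))).
      - lra.
      - intros x _. apply is_derive_Rconst.
      - intros x Hx. apply (is_derive_Rmult (fun s => rho s * rho s) (fun s => exp (2 * C0 * s))).
        + apply (is_derive_Rmult rho rho); apply Hd; lra.
        + apply is_derive_Rexp.
      - intros x Hx. specialize (Hb x ltac:(lra)). pose proof (exp_pos (2 * C0 * x)).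
        assert (- (rho' x * rho x) <= C0 * (rho x * rho x)).
        { apply Rle_trans with (Rabs (rho' x * rho x)); [rewrite <- Rabs_Ropp; apply Rle_abs|].
          rewrite Rabs_mult.
          replace (C0 * (rho x * rho x)) with (C0 * Rabs (rho x) * Rabs (rho x)).
          - apply Rmult_le_compat_r; [apply Rabs_pos|exact Hb].
          - rewrite Rmult_assoc, <- Rabs_mult, Rabs_pos_eq by nra. reflexivity. }
        replace (_ + _) with (2 * (rho' x * rho x + C0 * (rho x * rho x)) * exp (2 * C0 * x)) by ring.
        apply Rmult_le_pos; lra. }
    rewrite E, (Rmult_0_r (2 * C0)), exp_0 in Hm. nra. }
  destruct (Rlt_le_dec 0 (rho T)) as [H|H]; [exact H|exfalso].
  assert (rho T <> 0) by (apply Hnz; lra).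
  assert (0 < T). { destruct (Req_dec T 0) as [E|E]; [rewrite E in H; lra|lra]. }
  destruct (Ranalysis5.IVT_interv (fun s => - rho s) 0 T) as [z [Hz1 Hz2]]; try lra.
  - intros a Ha. apply continuity_pt_filterlim.
    apply (ex_derive_continuous (K := R_AbsRing) (V := R_NormedModule) (fun s => - rho s)).
    eexists. apply is_derive_Ropp. apply Hd. lra.
  - apply (Hnz z Hz1). lra.
Qed.

(** * Circle means of uniform limits of polynomials *)

Fixpoint peval (l : list C) (z : C) : C :=
  match l with nil => RtoC 0 | (c :: l')%list => (c + z * peval l' z)%C end.

Fixpoint padd (l m : list C) : list C :=
  match l, m with
  | nil, _ => m
  | _, nil => l
  | (c :: l')%list, (d :: m')%list => ((c + d)%C :: padd l' m')%list
  end.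

Lemma peval_add l m z : peval (padd l m) z = (peval l z + peval m z)%C.
Proof.
  revert m; induction l as [|c l IH]; intros [|d m]; simpl; try ring.
  rewrite IH. ring.
Qed.

Lemma peval_scal a l z : peval (map (Cmult a) l) z = (a * peval l z)%C.
Proof. induction l as [|c l IH]; simpl; [ring|rewrite IH; ring]. Qed.

Fixpoint pmul (l m : list C) : list C :=
  match l with
  | nil => nil
  | (c :: l')%list => padd (map (Cmult c) m) (RtoC 0 :: pmul l' m)%list
  end.

Lemma peval_mul l m z : peval (pmul l m) z = (peval l z * peval m z)%C.
Proof.
  induction l as [|c l IH]; simpl; [ring|].
  rewrite peval_add, peval_scal. simpl. rewrite IH. ring.
Qed.

Lemma peval_bounded l r : exists M, 0 <= M /\ forall z, Cmod z <= r -> Cmod (peval l z) <= M.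
Proof.
  induction l as [|c l [M [HM IH]]]; simpl.
  - exists 0. split; [lra|]. intros; rewrite Cmod_0; lra.
  - exists (Cmod c + Rabs r * M). split.
    { pose proof (Cmod_ge_0 c). pose proof (Rabs_pos r). nra. }
    intros z Hz. eapply Rle_trans; [apply Cmod_triangle|].
    rewrite Cmod_mult. apply Rplus_le_compat_l.
    apply Rmult_le_compat; auto using Cmod_ge_0.
    eapply Rle_trans; [exact Hz|apply Rle_abs].
Qed.

(** Uniform limits of polynomials on the closed disc of radius [r]: a class that is
closed under the Schur recursion and inherits the mean value property. *)
Definition disc_algebra (r : R) (h : C -> C) : Prop :=
  forall eps, 0 < eps -> exists l, forall z, Cmod z <= r -> Cmod (h z - peval l z) <= eps.

Section DiscAlgebra.
Variable r : R.

Lemma disc_algebra_peval l : disc_algebra r (peval l).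
Proof.
  intros eps He; exists l; intros z _. replace (_ - _)%C with (RtoC 0) by ring.
  rewrite Cmod_0; lra.
Qed.

Lemma disc_algebra_ext h k :
  (forall z, Cmod z <= r -> h z = k z) -> disc_algebra r h -> disc_algebra r k.
Proof.
  intros E H eps He. destruct (H eps He) as [l Hl]. exists l.
  intros z Hz. rewrite <- E; auto.
Qed.

Lemma disc_algebra_lim h :
  (forall eps, 0 < eps -> exists k, disc_algebra r k /\ forall z, Cmod z <= r -> Cmod (h z - k z) <= eps) ->
  disc_algebra r h.
Proof.
  intros H eps He. destruct (H (eps / 2)) as [k [Hk Hd]]; [lra|].
  destruct (Hk (eps / 2)) as [l Hl]; [lra|]. exists l. intros z Hz.
  replace (h z - peval l z)%C with ((h z - k z) + (k z - peval l z))%C by ring.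
  eapply Rle_trans; [apply Cmod_triangle|]. specialize (Hd z Hz); specialize (Hl z Hz); lra.
Qed.

Lemma disc_algebra_const c : disc_algebra r (fun _ => c).
Proof.
  apply (disc_algebra_ext (peval (c :: nil))); [|apply disc_algebra_peval].
  intros z _; simpl; ring.
Qed.

Lemma disc_algebra_id : disc_algebra r (fun z => z).
Proof.
  apply (disc_algebra_ext (peval (RtoC 0 :: RtoC 1 :: nil))); [|apply disc_algebra_peval].
  intros z _; simpl; ring.
Qed.

Lemma disc_algebra_plus h k :
  disc_algebra r h -> disc_algebra r k -> disc_algebra r (fun z => h z + k z)%C.
Proof.
  intros Hh Hk eps He. destruct (Hh (eps / 2)) as [l Hl]; [lra|].
  destruct (Hk (eps / 2)) as [m Hm]; [lra|]. exists (padd l m). intros z Hz.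
  rewrite peval_add.
  replace (_ - _)%C with ((h z - peval l z) + (k z - peval m z))%C by ring.
  eapply Rle_trans; [apply Cmod_triangle|]. specialize (Hm z Hz); specialize (Hl z Hz); lra.
Qed.

Lemma disc_algebra_bounded h : disc_algebra r h ->
  exists M, 0 < M /\ forall z, Cmod z <= r -> Cmod (h z) <= M.
Proof.
  intros Hh. destruct (Hh 1) as [l Hl]; [lra|].
  destruct (peval_bounded l r) as [M [HM HB]]. exists (M + 1). split; [lra|]. intros z Hz.
  replace (h z) with ((h z - peval l z) + peval l z)%C by ring.
  eapply Rle_trans; [apply Cmod_triangle|]. specialize (Hl z Hz); specialize (HB z Hz); lra.
Qed.

Lemma disc_algebra_mult h k :
  disc_algebra r h -> disc_algebra r k -> disc_algebra r (fun z => h z * k z)%C.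
Proof.
  intros Hh Hk eps He.
  destruct (disc_algebra_bounded k Hk) as [M [HM HB]].
  destruct (Hh (eps / (2 * M))) as [l Hl]; [apply Rdiv_lt_0_compat; lra|].
  destruct (peval_bounded l r) as [M' [HM' HB']].
  destruct (Hk (eps / (2 * (M' + 1)))) as [m Hm]; [apply Rdiv_lt_0_compat; lra|].
  exists (pmul l m). intros z Hz. rewrite peval_mul.
  replace (_ - _)%C with ((h z - peval l z) * k z + peval l z * (k z - peval m z))%C by ring.
  eapply Rle_trans; [apply Cmod_triangle|]. rewrite !Cmod_mult.
  specialize (Hl z Hz); specialize (HB z Hz); specialize (HB' z Hz); specialize (Hm z Hz).
  assert (Cmod (h z - peval l z) * Cmod (k z) <= eps / (2 * M) * M)
    by (apply Rmult_le_compat; auto using Cmod_ge_0).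
  assert (Cmod (peval l z) * Cmod (k z - peval m z) <= M' * (eps / (2 * (M' + 1))))
    by (apply Rmult_le_compat; auto using Cmod_ge_0).
  replace (eps / (2 * M) * M) with (eps / 2) in H by (field; lra).
  replace (M' * (eps / (2 * (M' + 1)))) with (eps / 2 * (M' / (M' + 1))) in H0 by (field; lra).
  assert (M' / (M' + 1) <= 1) by (apply Rle_div_l; lra).
  assert (eps / 2 * (M' / (M' + 1)) <= eps / 2 * 1) by (apply Rmult_le_compat_l; lra).
  lra.
Qed.

Lemma disc_algebra_pow h n : disc_algebra r h -> disc_algebra r (fun z => h z ^ n)%C.
Proof.
  intros Hh; induction n as [|n IH]; simpl.
  - apply disc_algebra_const.
  - apply disc_algebra_mult; assumption.
Qed.

(** The partial sums of the Neumann series, in the closed form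
[(1 - u ^ n) / (1 - u)], converge uniformly. *)
Lemma disc_algebra_inv u rho : rho < 1 -> disc_algebra r u ->
  (forall z, Cmod z <= r -> Cmod (u z) <= rho) -> disc_algebra r (fun z => / (1 - u z))%C.
Proof.
  intros Hrho Hu Hb. 
  destruct (Rlt_le_dec rho 0) as [Hneg|Hpos].
  { apply (disc_algebra_ext (fun _ => RtoC 0)); [|apply disc_algebra_const].
    intros z Hz. specialize (Hb z Hz). pose proof (Cmod_ge_0 (u z)). lra. }
  apply disc_algebra_lim. intros eps He.
  assert (Hlim : is_lim_seq (fun n => rho ^ n) 0).
  { apply is_lim_seq_geom. rewrite Rabs_pos_eq; assumption. }
  apply is_lim_seq_spec in Hlim.
  assert (Hp : 0 < eps * (1 - rho)) by nra.
  destruct (Hlim (mkposreal _ Hp)) as [n Hn]. specialize (Hn n (le_n n)). simpl in Hn.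
  rewrite Rminus_0_r, Rabs_pos_eq in Hn by (apply pow_le; assumption).
  exists (fun z => (1 - u z ^ n) * / (1 - u z))%C. 
  assert (Hnz : forall z, Cmod z <= r -> 1 - rho <= Cmod (1 - u z)).
  { intros z Hz. specialize (Hb z Hz).
    pose proof (Cmod_triangle (1 - u z) (u z)).
    replace (1 - u z + u z)%C with (RtoC 1) in H by ring. rewrite Cmod_1 in H. lra. }
  assert (Hnz0 : forall z, Cmod z <= r -> (1 - u z)%C <> RtoC 0).
  { intros z Hz E. specialize (Hnz z Hz). rewrite E, Cmod_0 in Hnz. lra. }
  split.
  - clear Hn. induction n as [|n IH].
    + apply (disc_algebra_ext (fun _ => RtoC 0)); [|apply disc_algebra_const].
      intros z Hz; simpl; ring.
    + apply (disc_algebra_ext (fun z => (1 - u z ^ n) * / (1 - u z) + u z ^ n)%C).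
      * intros z Hz; simpl. field. auto.
      * apply disc_algebra_plus; [exact IH|apply disc_algebra_pow; exact Hu].
  - intros z Hz.
    replace (_ - _)%C with (u z ^ n / (1 - u z))%C by (field; auto).
    rewrite Cmod_div, Cmod_pow by auto.
    apply Rle_div_l. { specialize (Hnz z Hz); lra. }
    apply Rle_trans with (rho ^ n).
    + apply pow_incr. split; [apply Cmod_ge_0|auto].
    + specialize (Hnz z Hz). nra.
Qed.

End DiscAlgebra.

Definition circle (r theta : R) : C := (r * cos theta, r * sin theta).

Lemma Cmod_circle r theta : 0 <= r -> Cmod (circle r theta) = r.
Proof.
  intros Hr. unfold Cmod, circle; simpl.
  replace (_ + _) with (Rsqr r * (Rsqr (sin theta) + Rsqr (cos theta))) by (unfold Rsqr; ring).
  rewrite sin2_cos2, Rmult_1_r. apply sqrt_Rsqr; exact Hr.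
Qed.

Lemma Cderiv_circle r theta : Cderiv (circle r) theta (Ci * circle r theta)%C.
Proof.
  split; unfold circle; simpl.
  - replace (0 * (r * cos theta) - 1 * (r * sin theta)) with (r * (- sin theta)) by ring.
    apply is_derive_Rscal. apply is_derive_cos.
  - replace (0 * (r * sin theta) + 1 * (r * cos theta)) with (r * cos theta) by ring.
    apply is_derive_Rscal. apply is_derive_sin.
Qed.

Lemma Cderiv_circle_pow r k theta :
  Cderiv (fun s => circle r s ^ k)%C theta (RtoC (INR k) * Ci * circle r theta ^ k)%C.
Proof.
  induction k as [|k IH].
  - simpl. eapply Cderiv_unique_eq; [apply Cderiv_const|ring].
  - rewrite S_INR, RtoC_plus. simpl. eapply Cderiv_unique_eq.
    + apply (Cderiv_mult (circle r) (fun s => circle r s ^ k)%C); [apply Cderiv_circle|exact IH].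
    + simpl; ring.
Qed.

Lemma Cderiv_continuous_Re h t l : Cderiv h t l -> continuous (fun s => Re (h s)) t.
Proof.
  intros [H _].
  apply (ex_derive_continuous (K := R_AbsRing) (V := R_NormedModule) (fun s => Re (h s))).
  eexists; exact H.
Qed.

Lemma is_RInt_circle_pow r c k :
  is_RInt (fun s => Re (c * circle r s ^ k)%C) 0 (2 * PI)
    (match k with O => 2 * PI * Re c | S _ => 0 end).
Proof.
  destruct k as [|k].
  - apply (is_RInt_ext (fun _ => Re c)).
    { intros x _. simpl. unfold Re; simpl. ring. }
    replace (2 * PI * Re c) with (scal (2 * PI - 0) (Re c)); [apply (is_RInt_const (V := R_NormedModule))|].
    unfold scal; simpl; unfold mult; simpl. ring.
  - set (n := S k). set (d := (c / (RtoC (INR n) * Ci))%C).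
    assert (Hn : RtoC (INR n) <> RtoC 0).
    { intros E. apply RtoC_inj in E. unfold n in E. rewrite S_INR in E. pose proof (pos_INR k); lra. }
    assert (Hi : Ci <> RtoC 0) by apply Ci_nz.
    assert (HD : forall s, Cderiv (fun s => d * circle r s ^ n)%C s (c * circle r s ^ n)%C).
    { intros s. eapply Cderiv_unique_eq.
      - apply (Cderiv_mult (fun _ => d)); [apply Cderiv_const|apply Cderiv_circle_pow].
      - cbv beta. unfold d. generalize (circle r s ^ n)%C; intros w. field. split; assumption. }
    replace 0 with (minus ((fun s => Re (d * circle r s ^ n)%C) (2 * PI)) ((fun s => Re (d * circle r s ^ n)%C) 0)) at 2.
    + apply (is_RInt_derive (V := R_CompleteNormedModule) (fun s => Re (d * circle r s ^ n)%C)).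
      * intros s _. apply HD.
      * intros s _. 
        apply (Cderiv_continuous_Re _ _ (RtoC 0 * circle r s ^ n + c * (RtoC (INR n) * Ci * circle r s ^ n))%C).
        apply (Cderiv_mult (fun _ => c)); [apply Cderiv_const|apply Cderiv_circle_pow].
    + replace (circle r (2 * PI)) with (circle r 0).
      * unfold minus, plus, opp; simpl. ring.
      * unfold circle. rewrite cos_2PI, sin_2PI, cos_0, sin_0. reflexivity.
Qed.

(** The power [circle r s ^ k] is carried along so that the induction on the
coefficients goes through. *)
Lemma is_RInt_peval_pow r l : forall k,
  is_RInt (fun s => Re (circle r s ^ k * peval l (circle r s))%C) 0 (2 * PI)
    (match k with O => 2 * PI * Re (peval l 0) | S _ => 0 end).
Proof.
  induction l as [|c l IH]; intros k; simpl.
  - replace (match k with O => _ | S _ => _ end) with (scal (2 * PI - 0) 0).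
    + apply (is_RInt_ext (fun _ => 0)).
      { intros x _. unfold Re; simpl; ring. }
      apply (is_RInt_const (V := R_NormedModule)).
    + unfold scal; simpl; unfold mult; simpl. destruct k; simpl; ring.
  - apply (is_RInt_ext (fun s => Re (c * circle r s ^ k)%C + Re (circle r s ^ (S k) * peval l (circle r s))%C)).
    { intros x _. simpl Cpow.
      set (u := (circle r x ^ k)%C). set (v := peval l (circle r x)). clearbody u v.
      unfold Re; simpl; ring. }
    replace (match k with O => _ | S _ => _ end) with
      (plus (match k with O => 2 * PI * Re c | S _ => 0 end) 0).
    + apply (is_RInt_plus (V := R_NormedModule)); [apply is_RInt_circle_pow|apply (IH (S k))].
    + unfold plus; simpl. destruct k; rewrite Rplus_0_r; [|reflexivity].
      unfold Re; simpl; ring.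
Qed.

Lemma Cderiv_peval l (h : R -> C) t d : Cderiv h t d -> exists d', Cderiv (fun s => peval l (h s)) t d'.
Proof.
  intros H. induction l as [|c l [d' IH]]; simpl.
  - eexists; apply Cderiv_const.
  - eexists. apply Cderiv_plus; [apply Cderiv_const|]. apply Cderiv_mult; eassumption.
Qed.

Lemma Re_minus_le c d eps : Cmod (c - d) <= eps -> Rabs (Re c - Re d) <= eps.
Proof.
  intros H. eapply Rle_trans; [|exact H]. eapply Rle_trans; [|apply re_le_Cmod].
  apply Req_le. reflexivity.
Qed.

Lemma continuous_disc_algebra r h theta : 0 <= r -> disc_algebra r h ->
  continuous (fun s => Re (h (circle r s))) theta.
Proof.
  intros Hr Hh. apply (proj2 (filterlim_locally (U := R_UniformSpace) _ _)). intros eps.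
  destruct (Hh (eps / 3)) as [l Hl]. { destruct eps; simpl; lra. }
  assert (Hc : continuous (fun s => Re (peval l (circle r s))) theta).
  { destruct (Cderiv_peval l (circle r) theta _ (Cderiv_circle r theta)) as [d Hd].
    exact (Cderiv_continuous_Re _ _ _ Hd). }
  assert (He : 0 < eps / 3) by (destruct eps; simpl; lra).
  pose proof (proj1 (filterlim_locally (U := R_UniformSpace) _ _) Hc (mkposreal _ He)) as Hloc.
  revert Hloc. apply filter_imp. intros s Hs.
  assert (E1 := Re_minus_le _ _ _ (Hl (circle r s) ltac:(rewrite Cmod_circle; lra))).
  assert (E2 := Re_minus_le _ _ _ (Hl (circle r theta) ltac:(rewrite Cmod_circle; lra))).
  change (Rabs (Re (peval l (circle r s)) - Re (peval l (circle r theta))) < eps / 3) in Hs.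
  change (Rabs (Re (h (circle r s)) - Re (h (circle r theta))) < eps).
  apply Rabs_def2 in Hs. apply Rabs_le_between in E1. apply Rabs_le_between in E2.
  apply Rabs_def1; lra.
Qed.

(** Mean value property, passed to the uniform limit from polynomials. *)
Lemma is_RInt_disc_algebra r h : 0 <= r -> disc_algebra r h ->
  is_RInt (fun s => Re (h (circle r s))) 0 (2 * PI) (2 * PI * Re (h (RtoC 0))).
Proof.
  intros Hr Hh.
  assert (Hex : ex_RInt (fun s => Re (h (circle r s))) 0 (2 * PI)).
  { apply (ex_RInt_continuous (V := R_CompleteNormedModule)). intros s _.
    apply continuous_disc_algebra; assumption. }
  pose proof PI_RGT_0 as HPI.
  replace (2 * PI * Re (h (RtoC 0))) with (RInt (fun s => Re (h (circle r s))) 0 (2 * PI));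
    [apply (RInt_correct (V := R_CompleteNormedModule)); exact Hex|].
  set (I := RInt _ _ _).
  apply Rminus_diag_uniq. apply Rabs_eq_0. apply Rle_antisym; [|apply Rabs_pos].
  apply le_epsilon. intros eps He. rewrite Rplus_0_l.
  destruct (Hh (eps / (4 * PI))) as [l Hl]; [apply Rdiv_lt_0_compat; lra|].
  set (e := eps / (4 * PI)) in *.
  pose proof (is_RInt_peval_pow r l 0) as HP. simpl in HP.
  assert (HD : is_RInt (fun s => Re (h (circle r s)) - Re (1 * peval l (circle r s))%C) 0 (2 * PI)
     (I - 2 * PI * Re (peval l 0))).
  { apply (is_RInt_minus (V := R_NormedModule)); [|exact HP].
    apply (RInt_correct (V := R_CompleteNormedModule)); exact Hex. }
  assert (HB : Rabs (I - 2 * PI * Re (peval l 0)) <= (2 * PI - 0) * e).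
  { refine (norm_RInt_le_const (V := R_NormedModule) _ _ _ _ e _ _ HD); [lra|].
    intros s _. apply (Re_minus_le (h (circle r s)) (1 * peval l (circle r s))%C).
    rewrite Cmult_1_l. apply Hl. rewrite Cmod_circle; lra. }
  assert (E2 := Re_minus_le _ _ _ (Hl (RtoC 0) ltac:(rewrite Cmod_0; lra))).
  replace (I - 2 * PI * Re (h (RtoC 0))) with
    ((I - 2 * PI * Re (peval l 0)) + - (2 * PI) * (Re (h (RtoC 0)) - Re (peval l 0))) by ring.
  eapply Rle_trans; [apply Rabs_triang|]. rewrite Rabs_mult, Rabs_Ropp, (Rabs_pos_eq (2 * PI)) by lra.
  replace eps with ((2 * PI - 0) * e + 2 * PI * e) by (unfold e; field; lra).
  apply Rplus_le_compat; [exact HB|]. apply Rmult_le_compat_l; lra.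
Qed.

Definition circle_mean (phi : R -> R) : R := RInt phi 0 (2 * PI) / (2 * PI).

Lemma continuous_sqr_disc_algebra r h theta : 0 <= r -> disc_algebra r h ->
  continuous (fun s => Cmod (h (circle r s)) ^ 2) theta.
Proof.
  intros Hr Hh.
  assert (H1 : continuous (fun s => Re (h (circle r s))) theta) by (apply continuous_disc_algebra; auto).
  assert (H2 : continuous (fun s => Re (Ci * h (circle r s))%C) theta).
  { apply (continuous_disc_algebra r (fun z => Ci * h z)%C); auto.
    apply disc_algebra_mult; [apply disc_algebra_const|exact Hh]. }
  apply (continuous_ext (fun s => Re (h (circle r s)) * Re (h (circle r s)) +
     Re (Ci * h (circle r s))%C * Re (Ci * h (circle r s))%C)).
  { intros s. rewrite Cmod_sqr. unfold Re; simpl. ring. }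
  apply (continuous_plus (V := R_NormedModule)); apply (continuous_mult (K := R_AbsRing)); assumption.
Qed.

(** Constants are orthogonal to functions that vanish at the centre: removing the
value at 0 decreases the mean square by exactly that value squared. *)
Lemma circle_mean_dist_value r h : 0 <= r -> disc_algebra r h ->
  circle_mean (fun s => Cmod (h (circle r s) - h (RtoC 0)) ^ 2) =
  circle_mean (fun s => Cmod (h (circle r s)) ^ 2) - Cmod (h (RtoC 0)) ^ 2.
Proof.
  intros Hr Hh. pose proof PI_RGT_0 as HPI. unfold circle_mean.
  set (w := h (RtoC 0)).
  enough (E : RInt (fun s => Cmod (h (circle r s) - w) ^ 2) 0 (2 * PI) =
     RInt (fun s => Cmod (h (circle r s)) ^ 2) 0 (2 * PI) - 2 * PI * Cmod w ^ 2).
  { rewrite E. field. lra. }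
  apply (is_RInt_unique (V := R_CompleteNormedModule)).
  assert (HA := is_RInt_disc_algebra r (fun z => Cconj w * h z)%C Hr
    (disc_algebra_mult r _ _ (disc_algebra_const r _) Hh)).
  apply (is_RInt_ext (fun s => (Cmod (h (circle r s)) ^ 2 - 2 * Re (Cconj w * h (circle r s))%C) + Cmod w ^ 2)).
  { intros s _. rewrite !Cmod_sqr. unfold Re; simpl. ring. }
  replace (RInt (fun s => Cmod (h (circle r s)) ^ 2) 0 (2 * PI) - 2 * PI * Cmod w ^ 2) with
   ((RInt (fun s => Cmod (h (circle r s)) ^ 2) 0 (2 * PI) - 2 * (2 * PI * Re (Cconj w * w)%C))
     + (2 * PI - 0) * Cmod w ^ 2).
  2:{ rewrite (Cmod_sqr w). unfold Re; simpl; ring. }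
  apply (is_RInt_plus (V := R_NormedModule)).
  - apply (is_RInt_minus (V := R_NormedModule)).
    + apply (RInt_correct (V := R_CompleteNormedModule)).
      apply (ex_RInt_continuous (V := R_CompleteNormedModule)). intros s _.
      apply continuous_sqr_disc_algebra; assumption.
    + apply (is_RInt_scal (V := R_NormedModule)). exact HA.
  - apply (is_RInt_const (V := R_NormedModule)).
Qed.

Lemma circle_mean_le (phi psi : R -> R) :
  (forall s, continuous phi s) -> (forall s, continuous psi s) ->
  (forall s, phi s <= psi s) -> circle_mean phi <= circle_mean psi.
Proof.
  intros H1 H2 Hle. pose proof PI_RGT_0 as HPI. unfold circle_mean.
  apply Rmult_le_compat_r. { apply Rlt_le, Rinv_0_lt_compat; lra. }
  apply RInt_le; [lra| | |auto];
    apply (ex_RInt_continuous (V := R_CompleteNormedModule)); auto.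
Qed.

Lemma circle_mean_lin a b (phi psi : R -> R) :
  (forall s, continuous phi s) -> (forall s, continuous psi s) ->
  circle_mean (fun s => a * phi s + b * psi s) = a * circle_mean phi + b * circle_mean psi.
Proof.
  intros H1 H2. unfold circle_mean. pose proof PI_RGT_0.
  assert (E : RInt (fun s => a * phi s + b * psi s) 0 (2 * PI) =
    a * RInt phi 0 (2 * PI) + b * RInt psi 0 (2 * PI)).
  { apply (is_RInt_unique (V := R_CompleteNormedModule)).
    apply (is_RInt_plus (V := R_NormedModule)); apply (is_RInt_scal (V := R_NormedModule));
    apply (RInt_correct (V := R_CompleteNormedModule));
    apply (ex_RInt_continuous (V := R_CompleteNormedModule)); auto. }
  rewrite E. field. lra.
Qed.

Lemma circle_mean_const c : circle_mean (fun _ => c) = c.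
Proof.
  unfold circle_mean. rewrite (RInt_const (V := R_CompleteNormedModule)).
  pose proof PI_RGT_0. unfold scal; simpl; unfold mult; simpl. field. lra.
Qed.

Lemma circle_mean_nonneg (phi : R -> R) : (forall s, continuous phi s) -> (forall s, 0 <= phi s) -> 0 <= circle_mean phi.
Proof.
  intros H1 H2. rewrite <- (circle_mean_const 0). apply circle_mean_le; auto.
  intros s. apply continuous_const.
Qed.

(** * The Schur recursion and its time evolution *)

(** Right-hand side of the evolution of the Schur function [f] at site [n], where
[a] and [b] are the entries at [n - 1] and [n].  The terms in [1 / z] cancel at
[z = 0] because [f(0) = b] there. *)
Definition AL_riccati (z a b f : C) : C :=
  (Ci * ((a - b / z) + (z + / z - Cconj b * a - Cconj a * b) * f
         + (Cconj a - Cconj b * z) * (f * f)))%C.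

(** Zero curvature: the Schur step carries the Riccati equation at site [n + 1]
to the one at site [n].  An error [e] in the former is multiplied by the
derivative of the Schur step.  Conjugates are independent variables here ([aa]
stands for the conjugate of [a], and so on), which makes this an identity of
rational functions. *)
Lemma riccati_step_identity (z a aa b bb c cc g e : C) :
  z <> RtoC 0 -> (1 + bb * (z * g))%C <> RtoC 0 ->
  let D := (1 + bb * (z * g))%C in
  let db := (Ci * (1 - b * bb) * (a + c))%C in
  let dbb := (- Ci * (1 - b * bb) * (aa + cc))%C in
  let dg := (Ci * ((b - c / z) + (z + / z - cc * b - bb * c) * g + (bb - cc * z) * (g * g)) + e)%C in
  let f := ((b + z * g) / D)%C in
  (((db + z * dg) * D - (b + z * g) * (dbb * (z * g) + bb * (z * dg))) / (D * D)
  = Ci * ((a - b / z) + (z + / z - bb * a - aa * b) * f + (aa - bb * z) * (f * f))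
    + z * (1 - b * bb) / (D * D) * e)%C.
Proof.
  intros Hz HD. cbv zeta. field. auto.
Qed.

Definition schur_map (b w : C) : C := ((b + w) / (1 + Cconj b * w))%C.

Lemma RtoC_1_sub_sqr (b : C) : RtoC (1 - Cmod b ^ 2) = (1 - b * Cconj b)%C.
Proof. rewrite RtoC_minus, Cmod2_conj. reflexivity. Qed.

Lemma Cmod_1_plus_ge (u : C) : 1 - Cmod u <= Cmod (1 + u).
Proof.
  pose proof (Cmod_triangle (1 + u) (- u)) as H.
  replace (1 + u + - u)%C with (RtoC 1) in H by ring. rewrite Cmod_1, Cmod_opp in H. lra.
Qed.

Lemma schur_den_ge (b w : C) : Cmod w <= 1 -> 1 - Cmod b <= Cmod (1 + Cconj b * w).
Proof.
  intros Hw. eapply Rle_trans; [|apply Cmod_1_plus_ge]. rewrite Cmod_mult, Cmod_conj.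
  pose proof (Cmod_ge_0 b). pose proof (Cmod_ge_0 w). nra.
Qed.

Lemma schur_den_neq0 (b w : C) : Cmod b < 1 -> Cmod w <= 1 -> (1 + Cconj b * w)%C <> RtoC 0.
Proof.
  intros Hb Hw E. pose proof (schur_den_ge b w Hw). rewrite E, Cmod_0 in H. lra.
Qed.

(** With [t = Re (conj b w)], numerator and denominator of the Schur step are
compared through an affine function of [t]. *)
Lemma schur_map_sqr (b w : C) :
  exists t, - (Cmod b * Cmod w) <= t <= Cmod b * Cmod w /\
    Cmod (b + w) ^ 2 = Cmod b ^ 2 + Cmod w ^ 2 + 2 * t /\
    Cmod (1 + Cconj b * w) ^ 2 = 1 + Cmod b ^ 2 * Cmod w ^ 2 + 2 * t.
Proof.
  exists (Re (Cconj b * w)%C). split; [|split].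
  - apply Rabs_le_between. rewrite <- (Cmod_conj b), <- Cmod_mult. apply re_le_Cmod.
  - rewrite !Cmod_sqr. unfold Re; simpl; ring.
  - rewrite !Cmod_sqr. unfold Re; simpl; ring.
Qed.

Lemma schur_map_le_1 (b w : C) : Cmod b < 1 -> Cmod w <= 1 -> Cmod (schur_map b w) <= 1.
Proof.
  intros Hb Hw. unfold schur_map. pose proof (schur_den_neq0 b w Hb Hw) as Hn.
  rewrite Cmod_div by exact Hn. apply Rle_div_l; [now apply Cmod_gt_0|]. rewrite Rmult_1_l.
  apply Rsqr_incr_0_var; [|apply Cmod_ge_0]. rewrite !Rsqr_pow2.
  destruct (schur_map_sqr b w) as [t [_ [-> ->]]].
  pose proof (Cmod_ge_0 b). pose proof (Cmod_ge_0 w).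
  assert (0 <= (1 - Cmod b ^ 2) * (1 - Cmod w ^ 2)) by (apply Rmult_le_pos; nra). nra.
Qed.

(** Hyperbolic triangle inequality.  It is linear in the [t] of [schur_map_sqr],
and the worst case is [t = |b| |w|]. *)
Lemma schur_map_le_plus (b w : C) : Cmod b < 1 -> Cmod w <= 1 ->
  Cmod (schur_map b w) <= Cmod b + Cmod w.
Proof.
  intros Hb Hw. pose proof (Cmod_ge_0 b) as H0. pose proof (Cmod_ge_0 w) as H1.
  destruct (Rle_lt_dec 1 (Cmod b + Cmod w)) as [Hbig|Hsmall].
  { eapply Rle_trans; [apply schur_map_le_1|]; assumption. }
  unfold schur_map. pose proof (schur_den_neq0 b w Hb Hw) as Hn.
  rewrite Cmod_div by exact Hn. apply Rle_div_l; [now apply Cmod_gt_0|].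
  apply Rsqr_incr_0_var; [|apply Rmult_le_pos; [lra|apply Cmod_ge_0]].
  rewrite !Rsqr_pow2, Rpow_mult_distr.
  destruct (schur_map_sqr b w) as [t [Ht [-> ->]]].
  set (B := Cmod b) in *. set (W := Cmod w) in *.
  assert (0 <= 2 * (B * W - t) * (1 - (B + W) ^ 2)).
  { apply Rmult_le_pos; [lra|nra]. }
  assert (0 <= (B + W) ^ 2 * ((1 + B * W) ^ 2 - 1)).
  { apply Rmult_le_pos; [nra|]. assert (0 <= B * W) by nra. nra. }
  nra.
Qed.

(** Schur function of the coefficients [u n, ..., u (n + k - 1)]. *)
Fixpoint schur_iter (z : C) (u : Z -> C) (n : Z) (k : nat) : C :=
  match k with
  | O => RtoC 0
  | S k' => schur_map (u n) (z * schur_iter z u (n + 1) k')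
  end.

Lemma schur_iter_le_1 z u : Cmod z <= 1 -> (forall n, Cmod (u n) < 1) ->
  forall k n, Cmod (schur_iter z u n k) <= 1.
Proof.
  intros Hz Hu. induction k as [|k IH]; intros n; simpl.
  - rewrite Cmod_0; lra.
  - apply schur_map_le_1; [apply Hu|]. rewrite Cmod_mult.
    specialize (IH (n + 1)%Z). pose proof (Cmod_ge_0 z). pose proof (Cmod_ge_0 (schur_iter z u (n + 1) k)). nra.
Qed.

Lemma Cmod_z_schur_le_1 z u : Cmod z <= 1 -> (forall n, Cmod (u n) < 1) ->
  forall k n, Cmod (z * schur_iter z u n k) <= 1.
Proof.
  intros Hz Hu k n. rewrite Cmod_mult. pose proof (schur_iter_le_1 z u Hz Hu k n).
  pose proof (Cmod_ge_0 z). pose proof (Cmod_ge_0 (schur_iter z u n k)). nra.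
Qed.

(** Majorant of the Schur function on the circle of radius [r], obtained from
[schur_map_le_plus]. *)
Fixpoint discounted (r : R) (A : Z -> R) (n : Z) (k : nat) : R :=
  match k with O => 0 | S k' => A n + r * discounted r A (n + 1) k' end.

Lemma schur_iter_le_discounted z u r : Cmod z = r -> r <= 1 -> (forall n, Cmod (u n) < 1) ->
  forall k n, Cmod (schur_iter z u n k) <= discounted r (fun i => Cmod (u i)) n k.
Proof.
  intros Hz Hr Hu. induction k as [|k IH]; intros n; simpl.
  - rewrite Cmod_0; lra.
  - eapply Rle_trans; [apply schur_map_le_plus; [apply Hu|apply Cmod_z_schur_le_1; [lra|exact Hu]]|].
    rewrite Cmod_mult, Hz. apply Rplus_le_compat_l, Rmult_le_compat_l; [rewrite <- Hz; apply Cmod_ge_0|apply IH].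
Qed.

Lemma discounted_nonneg r A : 0 <= r -> (forall n, 0 <= A n) -> forall k n, 0 <= discounted r A n k.
Proof.
  intros Hr HA. induction k as [|k IH]; intros n; simpl; [lra|].
  specialize (IH (n + 1)%Z). specialize (HA n). nra.
Qed.

(** The iteration stops at the value 0, which is not a solution of the Riccati
equation; the defect is governed by the two entries at the right end, and each
step back multiplies it by at most [1 / (1 - alpha) ^ 2]. *)
Lemma schur_iter_deriv (z : C) (u : R -> Z -> C) (t alpha : R) :
  alpha < 1 -> z <> RtoC 0 -> Cmod z <= 1 ->
  (forall n, Cmod (u t n) <= alpha) ->
  (forall n, Cderiv (fun s => u s n) t (AL_rhs (u t) n)) ->
  forall k n, exists e,
    Cderiv (fun s => schur_iter z (u s) n k) t
      (AL_riccati z (u t (n - 1)%Z) (u t n) (schur_iter z (u t) n k) + e)%C /\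
    Cmod e <= (/ (1 - alpha) ^ 2) ^ k *
       (Cmod (u t (n + Z.of_nat k - 1)%Z) + Cmod (u t (n + Z.of_nat k)%Z) / Cmod z).
Proof.
  intros Hal Hz0 Hz Hb Hd.
  assert (Hb1 : forall n, Cmod (u t n) < 1) by (intros n; specialize (Hb n); lra).
  induction k as [|k IH]; intros n.
  - exists (- (Ci * (u t (n - 1)%Z - u t n / z)))%C. split.
    + simpl. eapply Cderiv_unique_eq; [apply Cderiv_const|]. unfold AL_riccati. field. exact Hz0.
    + simpl. rewrite Cmod_opp, Cmod_mult, Cmod_Ci, !Rmult_1_l.
      rewrite Z.add_0_r. unfold Cminus. eapply Rle_trans; [apply Cmod_triangle|].
      rewrite Cmod_opp, Cmod_div by exact Hz0. lra.
  - destruct (IH (n + 1)%Z) as [e [He1 He2]]. clear IH.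
    replace (n + 1 - 1)%Z with n in He1 by lia.
    set (g := schur_iter z (u t) (n + 1) k) in *.
    set (b := u t n) in *.
    assert (Hzg : Cmod (z * g) <= 1) by (apply Cmod_z_schur_le_1; assumption).
    assert (HD : (1 + Cconj b * (z * g))%C <> RtoC 0) by (apply schur_den_neq0; [apply Hb1|exact Hzg]).
    exists (z * (1 - b * Cconj b) / ((1 + Cconj b * (z * g)) * (1 + Cconj b * (z * g))) * e)%C.
    split.
    + simpl. fold g. fold b. eapply Cderiv_unique_eq.
      * unfold schur_map. apply (Cderiv_div (fun s => u s n + z * schur_iter z (u s) (n + 1) k)%C
          (fun s => 1 + Cconj (u s n) * (z * schur_iter z (u s) (n + 1) k))%C).
        -- exact HD.
        -- apply Cderiv_plus; [apply Hd|]. apply Cderiv_mult; [apply Cderiv_const|exact He1].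
        -- apply Cderiv_plus; [apply Cderiv_const|].
           apply Cderiv_mult; [apply Cderiv_conj, Hd|].
           apply Cderiv_mult; [apply Cderiv_const|exact He1].
      * fold g. fold b. unfold schur_map, AL_riccati.
        pose proof (riccati_step_identity z (u t (n - 1)%Z) (Cconj (u t (n - 1)%Z)) b (Cconj b)
          (u t (n + 1)%Z) (Cconj (u t (n + 1)%Z)) g e Hz0 HD) as HI. cbv zeta in HI.
        unfold AL_rhs. fold b. rewrite RtoC_1_sub_sqr.
        rewrite <- HI. unfold AL_riccati.
        rewrite !Cmult_conj, Cminus_conj, Cmult_conj, Cplus_conj, Cconj_conj.
        replace (Cconj (RtoC 1)) with (RtoC 1) by (unfold Cconj, RtoC; simpl; f_equal; ring).
        replace (Cconj Ci) with (- Ci)%C by (unfold Cconj, Ci, Copp; simpl; f_equal; ring).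
        change (schur_iter z (u t) (n + 1) k) with g.
        field. split; assumption.
    + rewrite Cmod_mult, Cmod_div, !Cmod_mult by (apply Cmult_neq_0; exact HD).
      rewrite <- RtoC_1_sub_sqr, Cmod_R.
      pose proof (schur_den_ge b (z * g) Hzg) as HDl. specialize (Hb n) as Hbn. fold b in Hbn.
      pose proof (Cmod_ge_0 b) as Hb0. pose proof (Cmod_ge_0 z) as Hz00.
      rewrite Rabs_pos_eq by nra.
      assert (HC : Cmod z * (1 - Cmod b ^ 2) / (Cmod (1 + Cconj b * (z * g)) * Cmod (1 + Cconj b * (z * g)))
         <= / (1 - alpha) ^ 2).
      { set (D := Cmod (1 + Cconj b * (z * g))) in *.
        apply Rle_trans with (/ (D * D)).
        - unfold Rdiv. rewrite <- (Rmult_1_l (/ (D * D))) at 2. apply Rmult_le_compat_r; [|nra].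
          apply Rlt_le, Rinv_0_lt_compat. nra.
        - apply Rinv_le_contravar; [|nra]. apply pow_lt; lra. }
      replace (n + 1 + Z.of_nat k)%Z with (n + Z.of_nat (S k))%Z in He2 by lia.
      change ((/ (1 - alpha) ^ 2) ^ S k) with (/ (1 - alpha) ^ 2 * (/ (1 - alpha) ^ 2) ^ k).
      rewrite (Rmult_assoc (/ (1 - alpha) ^ 2)).
      apply Rmult_le_compat; [|apply Cmod_ge_0|exact HC|exact He2].
      apply Rmult_le_pos; [apply Rmult_le_pos; [exact Hz00|nra]|]. apply Rlt_le, Rinv_0_lt_compat. nra.
Qed.

(** * Size of the tails and one perturbed step *)

Fixpoint sumZ (f : Z -> R) (n : Z) (k : nat) : R :=
  match k with O => 0 | S k' => f n + sumZ f (n + 1) k' end.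

Lemma sumZ_S f n k : sumZ f n (S k) = f n + sumZ f (n + 1) k.
Proof. reflexivity. Qed.

Lemma sumZ_le f g n k : (forall i, f i <= g i) -> sumZ f n k <= sumZ g n k.
Proof. intros H; revert n; induction k as [|k IH]; intros n; simpl; [lra|]. specialize (IH (n + 1)%Z). specialize (H n). lra. Qed.

Lemma sumZ_plus f g n k : sumZ (fun i => f i + g i) n k = sumZ f n k + sumZ g n k.
Proof. revert n; induction k as [|k IH]; intros n; simpl; [lra|]. rewrite IH. lra. Qed.

Lemma sumZ_scal c f n k : sumZ (fun i => c * f i) n k = c * sumZ f n k.
Proof. revert n; induction k as [|k IH]; intros n; simpl; [lra|]. rewrite IH. lra. Qed.

Lemma sumZ_shift f n k : sumZ (fun i => f (i + 1)%Z) n k = sumZ f (n + 1) k.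
Proof. revert n; induction k as [|k IH]; intros n; simpl; [lra|]. rewrite IH. lra. Qed.

Lemma sumZ_split f n k l : sumZ f n (k + l) = sumZ f n k + sumZ f (n + Z.of_nat k) l.
Proof.
  revert n; induction k as [|k IH]; intros n; simpl.
  - rewrite Z.add_0_r. lra.
  - rewrite IH. replace (n + 1 + Z.of_nat k)%Z with (n + Z.pos (Pos.of_succ_nat k))%Z by lia. lra.
Qed.

Lemma sumZ_nonneg f n k : (forall i, 0 <= f i) -> 0 <= sumZ f n k.
Proof. intros H; revert n; induction k as [|k IH]; intros n; simpl; [lra|]. specialize (IH (n + 1)%Z). specialize (H n). lra. Qed.

(** Young's inequality for the convolution with the geometric sequence; it follows
by induction on the window from a bound for [(1 - r) sum F ^ 2 + r F_n ^ 2]. *)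
Lemma sumZ_sqr_discounted (r L : R) (A F : Z -> R) (b : Z) : 0 <= r < 1 ->
  (forall n, 0 <= A n) -> (forall n, 0 <= F n) ->
  (forall n, F n <= A n + r * F (n + 1)%Z) -> (forall n, (b <= n)%Z -> F n = 0) ->
  (forall n k, sumZ (fun i => A i ^ 2) n k <= L) ->
  forall n k, sumZ (fun i => F i ^ 2) n k <= L / (1 - r) ^ 2.
Proof.
  intros Hr HA HF Hstep Hend HL.
  assert (Hinv : forall k n, (1 - r) * sumZ (fun i => F i ^ 2) n k + r * F n ^ 2 <=
     / (1 - r) * sumZ (fun i => A i ^ 2) n k + r * F (n + Z.of_nat k)%Z ^ 2).
  { induction k as [|k IH]; intros n.
    - simpl sumZ. change (Z.of_nat 0) with 0%Z. rewrite Z.add_0_r. lra.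
    - rewrite !sumZ_S. specialize (IH (n + 1)%Z).
      replace (n + Z.of_nat (S k))%Z with (n + 1 + Z.of_nat k)%Z by lia.
      assert (F n ^ 2 <= / (1 - r) * A n ^ 2 + r * F (n + 1)%Z ^ 2); [|lra].
      specialize (Hstep n). specialize (HA n). pose proof (HF n). pose proof (HF (n + 1)%Z).
      apply Rle_trans with ((A n + r * F (n + 1)%Z) ^ 2).
      { apply pow_incr; lra. }
      set (a := A n) in *. set (f := F (n + 1)%Z) in *.
      assert (0 <= r / (1 - r) * (a - (1 - r) * f) ^ 2).
      { apply Rmult_le_pos; [|apply pow2_ge_0]. apply Rdiv_le_0_compat; lra. }
      replace (/ (1 - r) * a ^ 2 + r * f ^ 2) with
        ((a + r * f) ^ 2 + r / (1 - r) * (a - (1 - r) * f) ^ 2) by (field; lra).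
      lra. }
  intros n k. set (l := Z.to_nat (b - n)).
  specialize (Hinv (k + l)%nat n). rewrite (Hend (n + Z.of_nat (k + l))%Z) in Hinv by lia.
  rewrite sumZ_split in Hinv at 1.
  specialize (HL n (k + l)%nat).
  pose proof (sumZ_nonneg (fun i => F i ^ 2) (n + Z.of_nat k) l (fun i => pow2_ge_0 _)).
  pose proof (pow2_ge_0 (F n)).
  apply Rle_div_r; [apply pow_lt; lra|].
  assert (/ (1 - r) * sumZ (fun i => A i ^ 2) n (k + l) <= / (1 - r) * L).
  { apply Rmult_le_compat_l; [|exact HL]. apply Rlt_le, Rinv_0_lt_compat; lra. }
  assert ((1 - r) * sumZ (fun i => F i ^ 2) n k <= / (1 - r) * L) by nra.
  apply Rmult_le_compat_l with (r := 1 - r) in H2; [|lra].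
  replace ((1 - r) * (/ (1 - r) * L)) with L in H2 by (field; lra). lra.
Qed.

(** The right end [b] is kept fixed, so that the recursion runs over the site
only. *)
Definition schur_fn (b : Z) (z : C) (u : Z -> C) (n : Z) : C := schur_iter z u n (Z.to_nat (b - n)).
Definition tail_bound (b : Z) (r : R) (u : Z -> C) (n : Z) : R :=
  discounted r (fun i => Cmod (u i)) n (Z.to_nat (b - n)).

Lemma schur_fn_step b z u n : (n < b)%Z ->
  schur_fn b z u n = schur_map (u n) (z * schur_fn b z u (n + 1)).
Proof.
  intros H. unfold schur_fn. replace (Z.to_nat (b - n)) with (S (Z.to_nat (b - (n + 1)))) by lia.
  reflexivity.
Qed.

Lemma tail_bound_le b r u n : 0 <= r -> tail_bound b r u n <= Cmod (u n) + r * tail_bound b r u (n + 1).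
Proof.
  intros Hr. unfold tail_bound. destruct (Z_lt_le_dec n b) as [H|H].
  - replace (Z.to_nat (b - n)) with (S (Z.to_nat (b - (n + 1)))) by lia. simpl. lra.
  - replace (Z.to_nat (b - n)) with O by lia. replace (Z.to_nat (b - (n + 1))) with O by lia.
    simpl. pose proof (Cmod_ge_0 (u n)). lra.
Qed.

Lemma tail_bound_nonneg b r u n : 0 <= r -> 0 <= tail_bound b r u n.
Proof. intros Hr. apply discounted_nonneg; [exact Hr|intros; apply Cmod_ge_0]. Qed.

Lemma tail_bound_end b r u n : (b <= n)%Z -> tail_bound b r u n = 0.
Proof. intros H. unfold tail_bound. replace (Z.to_nat (b - n)) with O by lia. reflexivity. Qed.

Lemma sumZ_sqr_tail_bound b r u L : 0 <= r < 1 ->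
  (forall n k, sumZ (fun i => Cmod (u i) ^ 2) n k <= L) ->
  forall n k, sumZ (fun i => tail_bound b r u i ^ 2) n k <= L / (1 - r) ^ 2.
Proof.
  intros Hr HL. apply (sumZ_sqr_discounted r L (fun i => Cmod (u i)) (tail_bound b r u) b Hr).
  - intros; apply Cmod_ge_0.
  - intros; apply tail_bound_nonneg; lra.
  - intros; apply tail_bound_le; lra.
  - apply tail_bound_end.
  - exact HL.
Qed.

Lemma schur_fn_at_0 b u n : (n < b)%Z -> schur_fn b 0 u n = u n.
Proof.
  intros H. rewrite schur_fn_step by exact H. unfold schur_map.
  rewrite Cmult_0_l, Cmult_0_r, !Cplus_0_r. field.
Qed.

(** The denominators are [1 - u] with [|u| <= r < 1]. *)
Lemma disc_algebra_schur_iter u r : 0 <= r < 1 -> (forall n, Cmod (u n) < 1) ->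
  forall k n, disc_algebra r (fun z => schur_iter z u n k).
Proof.
  intros Hr Hu. induction k as [|k IH]; intros n; simpl.
  - apply disc_algebra_const.
  - assert (Hw : disc_algebra r (fun z => z * schur_iter z u (n + 1) k)%C).
    { apply (disc_algebra_mult r (fun z => z)); [apply disc_algebra_id|apply IH]. }
    apply (disc_algebra_ext r (fun z => (u n + z * schur_iter z u (n + 1) k) *
      / (1 - (- Cconj (u n) * (z * schur_iter z u (n + 1) k))))%C).
    { intros z Hz. unfold schur_map, Cdiv. do 2 f_equal. ring. }
    apply (disc_algebra_mult r (fun z => u n + z * schur_iter z u (n + 1) k)%C).
    + apply (disc_algebra_plus r (fun _ => u n)); [apply disc_algebra_const|exact Hw].
    + apply (disc_algebra_inv r (fun z => - Cconj (u n) * (z * schur_iter z u (n + 1) k))%C r); [lra| |].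
      * apply (disc_algebra_mult r (fun _ => - Cconj (u n))%C); [apply disc_algebra_const|exact Hw].
      * intros z Hz. rewrite Cmod_mult, Cmod_opp, Cmod_conj, Cmod_mult.
        pose proof (schur_iter_le_1 z u ltac:(lra) Hu k (n + 1)%Z) as H1.
        specialize (Hu n). pose proof (Cmod_ge_0 (u n)). pose proof (Cmod_ge_0 z).
        pose proof (Cmod_ge_0 (schur_iter z u (n + 1) k)).
        assert (Cmod z * Cmod (schur_iter z u (n + 1) k) <= r * 1) by (apply Rmult_le_compat; auto).
        assert (0 <= Cmod z * Cmod (schur_iter z u (n + 1) k)) by (apply Rmult_le_pos; auto).
        nra.
Qed.

(** The inverse Schur step applied to two functions: up to terms that are
quadratically small, [w - y] is [f - g] with its constant term [a - b] removed.
As above, [aa] and [bb] stand for conjugates. *)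
Lemma schur_difference_identity (a aa b bb w y : C) :
  (1 + aa * w)%C <> RtoC 0 -> (1 + bb * y)%C <> RtoC 0 -> (1 - bb * b)%C <> RtoC 0 ->
  let f := ((a + w) / (1 + aa * w))%C in
  let g := ((b + y) / (1 + bb * y))%C in
  let iD := ((1 + bb * y) / (1 - bb * b))%C in
  (w - y = ((f - g) - (a - b)) +
    (((1 + aa * w) * (bb * g * iD) + aa * w) * (f - g) - (a - b) * (bb * g * iD)
     + (aa - bb) * (g * w * iD)))%C.
Proof. intros H1 H2 H3. cbv zeta. field. auto. Qed.

(** Here [|1 + conj a w|] is at most 2, and [kappa] bounds the modulus of
[(1 + conj b y) / (1 - |b|^2)], which is [1 / (1 - conj b g)]. *)
Lemma schur_difference_bound (a b w y : C) (alpha F G : R) :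
  alpha < 1 -> Cmod a <= alpha -> Cmod b <= alpha -> Cmod w <= 1 -> Cmod y <= 1 ->
  Cmod w <= F -> Cmod (schur_map b y) <= G ->
  let f := schur_map a w in let g := schur_map b y in
  let kappa := / (1 - alpha) in
  Cmod ((w - y) - ((f - g) - (a - b))) <=
    (2 * kappa * Cmod b * G + Cmod a * F) * Cmod (f - g)
    + (kappa * Cmod b * G + kappa * G * F) * Cmod (a - b).
Proof.
  intros Hal Ha Hb Hw Hy HF HG. cbv zeta.
  assert (H1 : (1 + Cconj a * w)%C <> RtoC 0) by (apply schur_den_neq0; lra).
  assert (H2 : (1 + Cconj b * y)%C <> RtoC 0) by (apply schur_den_neq0; lra).
  pose proof (Cmod_ge_0 a) as Ha0. pose proof (Cmod_ge_0 b) as Hb0.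
  assert (H3 : (1 - Cconj b * b)%C <> RtoC 0).
  { rewrite Cmult_comm, <- RtoC_1_sub_sqr. intros E; apply RtoC_inj in E. nra. }
  pose proof (schur_difference_identity a (Cconj a) b (Cconj b) w y H1 H2 H3) as E. cbv zeta in E.
  fold (schur_map a w) in E. fold (schur_map b y) in E.
  set (f := schur_map a w) in *. set (g := schur_map b y) in *.
  set (iD := ((1 + Cconj b * y) / (1 - Cconj b * b))%C) in *.
  set (kappa := / (1 - alpha)).
  assert (Hk : 0 < kappa) by (apply Rinv_0_lt_compat; lra).
  assert (HiD : Cmod iD <= kappa).
  { unfold iD. rewrite Cmod_div by exact H3.
    rewrite (Cmult_comm (Cconj b) b), <- RtoC_1_sub_sqr, Cmod_R, Rabs_pos_eq by nra.
    apply Rle_div_l; [nra|].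
    apply Rle_trans with (1 + Cmod b).
    - eapply Rle_trans; [apply Cmod_triangle|]. rewrite Cmod_1, Cmod_mult, Cmod_conj.
      pose proof (Cmod_ge_0 y). nra.
    - replace (1 - Cmod b ^ 2) with ((1 - Cmod b) * (1 + Cmod b)) by ring.
      rewrite <- Rmult_assoc. rewrite <- (Rmult_1_l (1 + Cmod b)) at 1.
      apply Rmult_le_compat_r; [lra|]. unfold kappa.
      apply Rmult_le_reg_l with (1 - alpha); [lra|]. 
      rewrite <- Rmult_assoc, Rinv_r by lra. lra. }
  rewrite E.
  replace (f - g - (a - b) +
     (((1 + Cconj a * w) * (Cconj b * g * iD) + Cconj a * w) * (f - g) -
      (a - b) * (Cconj b * g * iD) + (Cconj a - Cconj b) * (g * w * iD)) -
     (f - g - (a - b)))%C with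
   (((1 + Cconj a * w) * (Cconj b * g * iD) + Cconj a * w) * (f - g) +
      (- ((a - b) * (Cconj b * g * iD)) + (Cconj a - Cconj b) * (g * w * iD)))%C by ring.
  eapply Rle_trans; [apply Cmod_triangle|]. apply Rplus_le_compat.
  - rewrite Cmod_mult. apply Rmult_le_compat_r; [apply Cmod_ge_0|].
    eapply Rle_trans; [apply Cmod_triangle|]. apply Rplus_le_compat.
    + rewrite !Cmod_mult, Cmod_conj.
      assert (Cmod (1 + Cconj a * w) <= 2).
      { eapply Rle_trans; [apply Cmod_triangle|]. rewrite Cmod_1, Cmod_mult, Cmod_conj.
        pose proof (Cmod_ge_0 w). nra. }
      replace (2 * kappa * Cmod b * G) with (2 * (Cmod b * G * kappa)) by ring.
      assert (Cmod b * Cmod g * Cmod iD <= Cmod b * G * kappa).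
      { apply Rmult_le_compat; auto using Cmod_ge_0, Rmult_le_pos.
        apply Rmult_le_compat_l; assumption. }
      apply Rmult_le_compat; auto using Cmod_ge_0, Rmult_le_pos.
    + rewrite Cmod_mult, Cmod_conj. apply Rmult_le_compat_l; assumption.
  - eapply Rle_trans; [apply Cmod_triangle|].
    rewrite Cmod_opp, <- Cminus_conj, !Cmod_mult, !Cmod_conj.
    assert (Cmod b * Cmod g * Cmod iD <= Cmod b * G * kappa).
    { apply Rmult_le_compat; auto using Cmod_ge_0, Rmult_le_pos.
      apply Rmult_le_compat_l; assumption. }
    assert (Cmod g * Cmod w * Cmod iD <= G * F * kappa).
    { apply Rmult_le_compat; auto using Cmod_ge_0, Rmult_le_pos.
      apply Rmult_le_compat; auto using Cmod_ge_0. }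
    pose proof (Cmod_ge_0 (a - b)). nra.
Qed.

(** Minkowski's inequality with the cross terms absorbed, in a form that survives
taking means without square roots. *)
Lemma perturbed_square (x e : C) (c c' d eps : R) : 0 <= c -> 0 <= c' -> 0 <= d -> 0 <= eps ->
  Cmod e <= c * d + c' * eps ->
  Cmod (x + e) ^ 2 <= (1 + (c + c')) * (Cmod x ^ 2 + c * d ^ 2 + c' * eps ^ 2).
Proof.
  intros Hc Hc' Hd Heps He.
  pose proof (Cmod_ge_0 x) as HX. pose proof (Cmod_ge_0 e) as HE. set (X := Cmod x) in *. set (E := Cmod e) in *.
  apply Rle_trans with ((X + E) ^ 2).
  { apply pow_incr. split; [apply Cmod_ge_0|apply Cmod_triangle]. }
  assert (H1 : 2 * X * E <= c * (X ^ 2 + d ^ 2) + c' * (X ^ 2 + eps ^ 2)).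
  { apply Rle_trans with (2 * X * (c * d + c' * eps)); [nra|].
    assert (0 <= c * (X - d) ^ 2) by (apply Rmult_le_pos; [assumption|apply pow2_ge_0]).
    assert (0 <= c' * (X - eps) ^ 2) by (apply Rmult_le_pos; [assumption|apply pow2_ge_0]).
    nra. }
  assert (H2 : E ^ 2 <= (c + c') * (c * d ^ 2 + c' * eps ^ 2)).
  { apply Rle_trans with ((c * d + c' * eps) ^ 2); [apply pow_incr; lra|].
    assert (0 <= c * c' * (d - eps) ^ 2) by (apply Rmult_le_pos; [nra|apply pow2_ge_0]). nra. }
  nra.
Qed.

(** * Stability of the Schur algorithm on a circle *)

Section Stability.
Variables (u v : Z -> C) (alpha r : R) (b : Z).
Hypothesis Halpha : alpha < 1.
Hypothesis Hr : 0 < r < 1.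
Hypothesis Hu : forall n, Cmod (u n) <= alpha.
Hypothesis Hv : forall n, Cmod (v n) <= alpha.

Let Hu1 : forall n, Cmod (u n) < 1.
Proof. intros n; specialize (Hu n); lra. Qed.
Let Hv1 : forall n, Cmod (v n) < 1.
Proof. intros n; specialize (Hv n); lra. Qed.

Definition schur_diff (n : Z) (z : C) : C := (schur_fn b z u n - schur_fn b z v n)%C.

Lemma disc_algebra_schur_diff n : disc_algebra r (schur_diff n).
Proof.
  unfold schur_diff.
  apply (disc_algebra_ext r (fun z => schur_fn b z u n + - RtoC 1 * schur_fn b z v n)%C).
  { intros z _. ring. }
  apply (disc_algebra_plus r (fun z => schur_fn b z u n)).
  - apply disc_algebra_schur_iter; [lra|exact Hu1].
  - apply (disc_algebra_mult r (fun _ => - RtoC 1)%C); [apply disc_algebra_const|].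
    apply disc_algebra_schur_iter; [lra|exact Hv1].
Qed.

(** Squared distance of the Schur functions in the Hardy space of the circle of
radius [r]. *)
Definition schur_dist2 (n : Z) : R := circle_mean (fun s => Cmod (schur_diff n (circle r s)) ^ 2).

(** Both Schur functions take the value of their coefficient at the origin. *)
Lemma coefficient_dist_le n : (n < b)%Z -> Cmod (u n - v n) ^ 2 <= schur_dist2 n.
Proof.
  intros Hn. pose proof (disc_algebra_schur_diff n) as HA.
  pose proof (circle_mean_dist_value r (schur_diff n) ltac:(lra) HA) as E.
  assert (E0 : schur_diff n 0 = (u n - v n)%C) by (unfold schur_diff; rewrite !schur_fn_at_0 by exact Hn; reflexivity).
  rewrite E0 in E. fold (schur_dist2 n) in E.
  enough (0 <= circle_mean (fun s => Cmod (schur_diff n (circle r s) - (u n - v n)) ^ 2)) by lra.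
  apply circle_mean_nonneg; [|intros; apply pow2_ge_0].
  intros s. apply (continuous_sqr_disc_algebra r (fun z => schur_diff n z - (u n - v n))%C); [lra|].
  apply (disc_algebra_plus r (schur_diff n)); [exact HA|apply disc_algebra_const].
Qed.

(** The sum of the two coefficients in [schur_difference_bound]. *)
Definition step_cost (n : Z) : R :=
  / (1 - alpha) * (3 * (Cmod (v n) * tail_bound b r v n) + r * (tail_bound b r v n * tail_bound b r u (n + 1)))
  + r * (Cmod (u n) * tail_bound b r u (n + 1)).

Lemma Cmod_schur_fn_le n z (w : Z -> C) : Cmod z = r -> (forall n, Cmod (w n) < 1) ->
  Cmod (schur_fn b z w n) <= tail_bound b r w n.
Proof. intros Hz Hw. apply schur_iter_le_discounted; [exact Hz|lra|exact Hw]. Qed.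

(** The step of the Schur algorithm in mean square: multiplication by [z] costs
[r], removing the constant term costs nothing by [circle_mean_dist_value], and
the remainder is [step_cost]. *)
Lemma schur_dist2_step n : (n < b)%Z ->
  r ^ 2 * schur_dist2 (n + 1) <= (1 + step_cost n) ^ 2 * schur_dist2 n.
Proof.
  intros Hn. pose proof (coefficient_dist_le n Hn) as Hcoef.
  set (kappa := / (1 - alpha)).
  assert (Hk : 0 < kappa) by (apply Rinv_0_lt_compat; lra).
  set (G := tail_bound b r v n). set (F := r * tail_bound b r u (n + 1)).
  assert (HG : 0 <= G) by (apply tail_bound_nonneg; lra).
  assert (HF : 0 <= F) by (apply Rmult_le_pos; [lra|apply tail_bound_nonneg; lra]).
  pose proof (Cmod_ge_0 (u n)) as HA0. pose proof (Cmod_ge_0 (v n)) as HB0.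
  set (c := 2 * kappa * Cmod (v n) * G + Cmod (u n) * F).
  set (c' := kappa * Cmod (v n) * G + kappa * G * F).
  assert (Hc : 0 <= c) by (unfold c; auto 10 using Rplus_le_le_0_compat, Rmult_le_pos, Rlt_le, Rlt_0_2).
  assert (Hc' : 0 <= c') by (unfold c'; auto 10 using Rplus_le_le_0_compat, Rmult_le_pos, Rlt_le).
  assert (Hs : step_cost n = c + c').
  { unfold step_cost, c, c'. fold kappa. fold G. unfold F. ring. }
  set (eps := (u n - v n)%C) in *.
  pose proof (disc_algebra_schur_diff n) as HD.
  assert (HDe : disc_algebra r (fun z => schur_diff n z - eps)%C).
  { apply (disc_algebra_plus r (schur_diff n)); [exact HD|apply disc_algebra_const]. }
  assert (Hpt : forall s, Cmod (circle r s * schur_diff (n + 1) (circle r s)) ^ 2 <=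
     (1 + (c + c')) * (Cmod (schur_diff n (circle r s) - eps) ^ 2 +
       c * Cmod (schur_diff n (circle r s)) ^ 2 + c' * Cmod eps ^ 2)).
  { intros s. set (z := circle r s). assert (Hz : Cmod z = r) by (apply Cmod_circle; lra).
    set (w := (z * schur_fn b z u (n + 1))%C). set (y := (z * schur_fn b z v (n + 1))%C).
    assert (Hw1 : Cmod w <= 1) by (apply Cmod_z_schur_le_1; [lra|exact Hu1]).
    assert (Hy1 : Cmod y <= 1) by (apply Cmod_z_schur_le_1; [lra|exact Hv1]).
    assert (HwF : Cmod w <= F).
    { unfold w, F. rewrite Cmod_mult, Hz. apply Rmult_le_compat_l; [lra|].
      apply Cmod_schur_fn_le; [exact Hz|exact Hu1]. }
    assert (HgG : Cmod (schur_map (v n) y) <= G).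
    { unfold y. rewrite <- schur_fn_step by exact Hn. apply Cmod_schur_fn_le; [exact Hz|exact Hv1]. }
    pose proof (schur_difference_bound (u n) (v n) w y alpha F G Halpha (Hu n) (Hv n) Hw1 Hy1 HwF HgG) as HB.
    cbv zeta in HB. unfold w, y in HB. rewrite <- !schur_fn_step in HB by exact Hn.
    fold w y in HB. fold (schur_diff n z) in HB. fold eps kappa in HB. fold c c' in HB.
    replace (z * schur_diff (n + 1) z)%C with
      ((schur_diff n z - eps) + ((w - y) - (schur_diff n z - eps)))%C
      by (unfold w, y, schur_diff; ring).
    apply perturbed_square; auto using Cmod_ge_0. }
  assert (Hcont : forall h, disc_algebra r h -> forall s, continuous (fun s => Cmod (h (circle r s)) ^ 2) s).
  { intros h Hh s. apply continuous_sqr_disc_algebra; [lra|exact Hh]. }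
  assert (HM : circle_mean (fun s => Cmod (circle r s * schur_diff (n + 1) (circle r s)) ^ 2) <=
     circle_mean (fun s => (1 + (c + c')) * (1 * (1 * Cmod (schur_diff n (circle r s) - eps) ^ 2 +
       c * Cmod (schur_diff n (circle r s)) ^ 2) + c' * Cmod eps ^ 2) + 0 * 0)).
  { apply circle_mean_le.
    - intros s. apply (Hcont (fun z => z * schur_diff (n + 1) z)%C).
      apply (disc_algebra_mult r (fun z => z)); [apply disc_algebra_id|apply disc_algebra_schur_diff].
    - intros s. apply (continuous_plus (V := R_NormedModule)); [|apply continuous_const].
      apply (continuous_scal_r (V := R_NormedModule)).
      apply (continuous_plus (V := R_NormedModule)); [|apply continuous_const].
      apply (continuous_scal_r (V := R_NormedModule)).
      apply (continuous_plus (V := R_NormedModule));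
        apply (continuous_scal_r (V := R_NormedModule)).
      + apply (Hcont (fun z => schur_diff n z - eps)%C HDe).
      + apply (Hcont _ HD).
    - intros s. rewrite Rmult_0_l, Rplus_0_r, !Rmult_1_l. apply Hpt. }
  assert (C1 : forall s, continuous (fun s => Cmod (schur_diff n (circle r s) - eps) ^ 2) s)
    by (intros s; apply (Hcont (fun z => schur_diff n z - eps)%C HDe)).
  assert (C2 : forall s, continuous (fun s => 1 * Cmod (schur_diff n (circle r s) - eps) ^ 2 +
       c * Cmod (schur_diff n (circle r s)) ^ 2) s).
  { intros s. apply (continuous_plus (V := R_NormedModule));
        apply (continuous_scal_r (V := R_NormedModule)); [apply C1|apply (Hcont _ HD)]. }
  rewrite (circle_mean_lin (1 + (c + c')) 0) in HM; [| |intros; apply continuous_const].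
  2:{ intros s. apply (continuous_plus (V := R_NormedModule));
        apply (continuous_scal_r (V := R_NormedModule)); [apply C2|apply continuous_const]. }
  rewrite (circle_mean_lin 1 c') in HM; [|exact C2|intros; apply continuous_const].
  rewrite (circle_mean_lin 1 c) in HM; [|exact C1|apply (Hcont _ HD)].
  rewrite !circle_mean_const in HM.
  pose proof (circle_mean_dist_value r (schur_diff n) ltac:(lra) HD) as E.
  assert (E0 : schur_diff n 0 = eps) by (unfold schur_diff; rewrite !schur_fn_at_0 by exact Hn; reflexivity).
  rewrite E0 in E. rewrite E in HM. fold (schur_dist2 n) in HM.
  assert (EL : circle_mean (fun s => Cmod (circle r s * schur_diff (n + 1) (circle r s)) ^ 2) =
     r ^ 2 * schur_dist2 (n + 1)).
  { transitivity (circle_mean (fun s => r ^ 2 * Cmod (schur_diff (n + 1) (circle r s)) ^ 2 + 0 * 0)).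
    - unfold circle_mean. f_equal. apply RInt_ext. intros s _.
      rewrite Cmod_mult, Cmod_circle by lra.
      match goal with |- ?a = ?b => change (@eq R a b) end. ring.
    - rewrite (circle_mean_lin (r ^ 2) 0 (fun s => Cmod (schur_diff (n + 1) (circle r s)) ^ 2) (fun _ => 0)).
      + unfold schur_dist2. ring.
      + apply (Hcont _ (disc_algebra_schur_diff (n + 1))).
      + intros; apply continuous_const. }
  rewrite EL in HM. rewrite Hs.
  eapply Rle_trans; [exact HM|].
  set (N := schur_dist2 n) in *. set (e2 := Cmod eps ^ 2) in *.
  assert (0 <= e2) by apply pow2_ge_0.
  replace ((1 + (c + c')) ^ 2 * N) with ((1 + (c + c')) * ((1 + (c + c')) * N)) by ring.
  rewrite Rmult_0_l, Rplus_0_r. apply Rmult_le_compat_l; [lra|]. nra.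
Qed.

Lemma step_cost_nonneg n : 0 <= step_cost n.
Proof.
  unfold step_cost.
  assert (Hk : 0 < / (1 - alpha)) by (apply Rinv_0_lt_compat; lra).
  pose proof (Cmod_ge_0 (u n)). pose proof (Cmod_ge_0 (v n)).
  pose proof (tail_bound_nonneg b r v n ltac:(lra)). pose proof (tail_bound_nonneg b r u (n + 1) ltac:(lra)).
  repeat (apply Rplus_le_le_0_compat || apply Rmult_le_pos); lra.
Qed.

Lemma schur_dist2_nonneg n : 0 <= schur_dist2 n.
Proof.
  apply circle_mean_nonneg; [|intros; apply pow2_ge_0].
  intros s. apply continuous_sqr_disc_algebra; [lra|apply disc_algebra_schur_diff].
Qed.

Lemma schur_dist2_iter k : forall n, (n + Z.of_nat k <= b)%Z ->
  (r ^ k) ^ 2 * schur_dist2 (n + Z.of_nat k) <= exp (2 * sumZ step_cost n k) * schur_dist2 n.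
Proof.
  induction k as [|k IH]; intros n Hn.
  - simpl. rewrite Z.add_0_r, Rmult_0_r, exp_0. lra.
  - rewrite sumZ_S. replace (n + Z.of_nat (S k))%Z with (n + 1 + Z.of_nat k)%Z in * by lia.
    specialize (IH (n + 1)%Z ltac:(lia)). pose proof (schur_dist2_step n ltac:(lia)) as HS.
    simpl (r ^ S k). rewrite Rpow_mult_distr, Rmult_assoc.
    apply Rle_trans with (r ^ 2 * (exp (2 * sumZ step_cost (n + 1) k) * schur_dist2 (n + 1))).
    { apply Rmult_le_compat_l; [apply pow2_ge_0|exact IH]. }
    rewrite Rmult_plus_distr_l, exp_plus.
    replace (r ^ 2 * (exp (2 * sumZ step_cost (n + 1) k) * schur_dist2 (n + 1))) with
     (exp (2 * sumZ step_cost (n + 1) k) * (r ^ 2 * schur_dist2 (n + 1))) by ring.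
    replace (exp (2 * step_cost n) * exp (2 * sumZ step_cost (n + 1) k) * schur_dist2 n) with
     (exp (2 * sumZ step_cost (n + 1) k) * (exp (2 * step_cost n) * schur_dist2 n)) by ring.
    apply Rmult_le_compat_l; [apply Rlt_le, exp_pos|].
    eapply Rle_trans; [exact HS|]. apply Rmult_le_compat_r; [apply schur_dist2_nonneg|].
    replace (2 * step_cost n) with (step_cost n + step_cost n) by ring. rewrite exp_plus.
    pose proof (step_cost_nonneg n). pose proof (exp_ineq1_le (step_cost n)). simpl. nra.
Qed.

(** Logarithm of a bound for the factor
[(1 - |a|^2) / (|1 + conj a z f| |1 + conj a z g|)] of a common coefficient. *)
Definition common_cost (n : Z) : R :=
  / (1 - alpha) * (r * (Cmod (u n) * (tail_bound b r u (n + 1) + tail_bound b r v (n + 1)))).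

Lemma schur_inverse_den (a w : C) (F : R) : Cmod a <= alpha -> Cmod w <= 1 -> Cmod w <= F ->
  / Cmod (1 + Cconj a * w) <= exp (/ (1 - alpha) * (Cmod a * F)).
Proof.
  intros Ha Hw HF. pose proof (schur_den_ge a w Hw) as HD.
  pose proof (Cmod_1_plus_ge (Cconj a * w)) as HD'. rewrite Cmod_mult, Cmod_conj in HD'.
  pose proof (Cmod_ge_0 a). pose proof (Cmod_ge_0 w).
  set (y := Cmod a * Cmod w) in *.
  assert (0 <= y) by (unfold y; nra).
  assert (y <= alpha) by (unfold y; nra).
  apply Rle_trans with (/ (1 - y)). { apply Rinv_le_contravar; lra. }
  apply Rle_trans with (1 + / (1 - alpha) * y).
  - apply Rmult_le_reg_l with (1 - y); [lra|]. rewrite Rinv_r by lra.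
    assert (1 <= / (1 - alpha) * (1 - y)).
    { apply Rmult_le_reg_l with (1 - alpha); [lra|]. rewrite <- Rmult_assoc, Rinv_r by lra. lra. }
    nra.
  - eapply Rle_trans; [|apply exp_ineq1_le]. apply Rplus_le_compat_l.
    apply Rmult_le_compat_l; [apply Rlt_le, Rinv_0_lt_compat; lra|]. unfold y. nra.
Qed.

Lemma schur_diff_common_step n z : Cmod z = r -> (n < b)%Z -> u n = v n ->
  Cmod (schur_diff n z) <= r * exp (common_cost n) * Cmod (schur_diff (n + 1) z).
Proof.
  intros Hz Hn He. change (schur_diff n z) with (schur_fn b z u n - schur_fn b z v n)%C.
  rewrite (schur_fn_step b z u n Hn), (schur_fn_step b z v n Hn). rewrite <- He.
  set (a := u n) in *. set (f := schur_fn b z u (n + 1)). set (g := schur_fn b z v (n + 1)).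
  assert (Ha : Cmod a <= alpha) by apply Hu.
  assert (Hf1 : Cmod (z * f) <= 1) by (apply Cmod_z_schur_le_1; [lra|exact Hu1]).
  assert (Hg1 : Cmod (z * g) <= 1) by (apply Cmod_z_schur_le_1; [lra|exact Hv1]).
  assert (HfF : Cmod (z * f) <= r * tail_bound b r u (n + 1)).
  { rewrite Cmod_mult, Hz. apply Rmult_le_compat_l; [lra|]. apply Cmod_schur_fn_le; [exact Hz|exact Hu1]. }
  assert (HgG : Cmod (z * g) <= r * tail_bound b r v (n + 1)).
  { rewrite Cmod_mult, Hz. apply Rmult_le_compat_l; [lra|]. apply Cmod_schur_fn_le; [exact Hz|exact Hv1]. }
  assert (H1 : (1 + Cconj a * (z * f))%C <> RtoC 0) by (apply schur_den_neq0; lra).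
  assert (H2 : (1 + Cconj a * (z * g))%C <> RtoC 0) by (apply schur_den_neq0; lra).
  replace (schur_map a (z * f) - schur_map a (z * g))%C with
    (z * (1 - a * Cconj a) * (f - g) * (/ (1 + Cconj a * (z * f)) * / (1 + Cconj a * (z * g))))%C.
  2:{ unfold schur_map. field. auto. }
  rewrite !Cmod_mult, !Cmod_inv by assumption. rewrite <- RtoC_1_sub_sqr, Cmod_R, Hz.
  pose proof (schur_inverse_den a (z * f) _ Ha Hf1 HfF) as E1.
  pose proof (schur_inverse_den a (z * g) _ Ha Hg1 HgG) as E2.
  set (i1 := / Cmod (1 + Cconj a * (z * f))) in *. set (i2 := / Cmod (1 + Cconj a * (z * g))) in *.
  assert (0 < i1) by (apply Rinv_0_lt_compat; now apply Cmod_gt_0).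
  assert (0 < i2) by (apply Rinv_0_lt_compat; now apply Cmod_gt_0).
  pose proof (Cmod_ge_0 a). pose proof (Cmod_ge_0 (f - g)).
  rewrite Rabs_pos_eq by nra.
  replace (schur_diff (n + 1) z) with (f - g)%C by reflexivity.
  unfold common_cost. fold a.
  replace (/ (1 - alpha) * (r * (Cmod a * (tail_bound b r u (n + 1) + tail_bound b r v (n + 1))))) with
    (/ (1 - alpha) * (Cmod a * (r * tail_bound b r u (n + 1))) + / (1 - alpha) * (Cmod a * (r * tail_bound b r v (n + 1)))) by ring.
  rewrite exp_plus.
  assert (i1 * i2 <= exp (/ (1 - alpha) * (Cmod a * (r * tail_bound b r u (n + 1)))) *
     exp (/ (1 - alpha) * (Cmod a * (r * tail_bound b r v (n + 1))))) by (apply Rmult_le_compat; lra).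
  set (E := exp _ * exp _) in *.
  replace (r * E * Cmod (f - g)) with (r * 1 * Cmod (f - g) * E) by ring.
  apply Rmult_le_compat; [| nra| |exact H5].
  - repeat apply Rmult_le_pos; nra.
  - apply Rmult_le_compat_r; [assumption|]. apply Rmult_le_compat_l; nra.
Qed.

Lemma schur_diff_common k : forall n z, Cmod z = r -> (n + Z.of_nat k <= b)%Z ->
  (forall i, (n <= i < n + Z.of_nat k)%Z -> u i = v i) ->
  Cmod (schur_diff n z) <= r ^ k * exp (sumZ common_cost n k) * Cmod (schur_diff (n + Z.of_nat k) z).
Proof.
  induction k as [|k IH]; intros n z Hz Hn He.
  - simpl. rewrite Z.add_0_r, exp_0. lra.
  - rewrite sumZ_S. replace (n + Z.of_nat (S k))%Z with (n + 1 + Z.of_nat k)%Z in * by lia.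
    specialize (IH (n + 1)%Z z Hz ltac:(lia) ltac:(intros; apply He; lia)).
    eapply Rle_trans; [apply (schur_diff_common_step n z Hz ltac:(lia)); apply He; lia|].
    rewrite exp_plus. simpl (r ^ S k).
    eapply Rle_trans; [apply Rmult_le_compat_l; [|exact IH]|].
    + apply Rmult_le_pos; [lra|apply Rlt_le, exp_pos].
    + apply Req_le. ring.
Qed.

(** Each product in [step_cost] is split by the arithmetic-geometric mean
inequality, and the squares are summed with [sumZ_sqr_tail_bound]. *)
Lemma sumZ_step_cost L n k : 
  (forall n k, sumZ (fun i => Cmod (u i) ^ 2) n k <= L) ->
  (forall n k, sumZ (fun i => Cmod (v i) ^ 2) n k <= L) ->
  sumZ step_cost n k <= L * (/ (1 - alpha) * (3 / 2 + 3 / 2 * / (1 - r) ^ 2 + r * / (1 - r) ^ 2) + r * (/ 2 + / 2 * / (1 - r) ^ 2)).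
Proof.
  intros HLu HLv.
  pose proof (sumZ_sqr_tail_bound b r u L ltac:(lra) HLu) as HFu.
  pose proof (sumZ_sqr_tail_bound b r v L ltac:(lra) HLv) as HFv.
  set (kappa := / (1 - alpha)).
  assert (Hk : 0 < kappa) by (apply Rinv_0_lt_compat; lra).
  unfold Rdiv in HFu, HFv. set (x2 := / (1 - r) ^ 2) in *.
  apply Rle_trans with (sumZ (fun i =>
     (kappa * (3 / 2)) * Cmod (v i) ^ 2 + ((kappa * (3 / 2)) * tail_bound b r v i ^ 2 +
     ((kappa * (r * / 2)) * tail_bound b r v i ^ 2 +
     ((kappa * (r * / 2) + r * / 2) * tail_bound b r u (i + 1) ^ 2 + (r * / 2) * Cmod (u i) ^ 2)))) n k).
  - apply sumZ_le. intros i. unfold step_cost. fold kappa.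
    set (A := Cmod (u i)). set (B := Cmod (v i)). set (G := tail_bound b r v i). set (F := tail_bound b r u (i + 1)).
    assert (0 <= kappa * (3 / 2) * (B - G) ^ 2) by (apply Rmult_le_pos; [lra|apply pow2_ge_0]).
    assert (0 <= kappa * (r * / 2) * (G - F) ^ 2) by (apply Rmult_le_pos; [repeat apply Rmult_le_pos; lra|apply pow2_ge_0]).
    assert (0 <= r * / 2 * (A - F) ^ 2) by (apply Rmult_le_pos; [lra|apply pow2_ge_0]).
    nra.
  - rewrite !sumZ_plus, !sumZ_scal.
    rewrite (sumZ_shift (fun i => tail_bound b r u i ^ 2)).
    pose proof (Rmult_le_compat_l (kappa * (3 / 2)) _ _ ltac:(lra) (HLv n k)).
    pose proof (Rmult_le_compat_l (kappa * (3 / 2)) _ _ ltac:(lra) (HFv n k)).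
    assert (Hkr : 0 <= kappa * (r * / 2)) by (apply Rmult_le_pos; lra).
    pose proof (Rmult_le_compat_l (kappa * (r * / 2)) _ _ Hkr (HFv n k)).
    pose proof (Rmult_le_compat_l (kappa * (r * / 2) + r * / 2) _ _ ltac:(lra) (HFu (n + 1)%Z k)).
    pose proof (Rmult_le_compat_l (r * / 2) _ _ ltac:(lra) (HLu n k)).
    lra.
Qed.

Lemma sumZ_common_cost L n k : 
  (forall n k, sumZ (fun i => Cmod (u i) ^ 2) n k <= L) ->
  (forall n k, sumZ (fun i => Cmod (v i) ^ 2) n k <= L) ->
  sumZ common_cost n k <= L * (/ (1 - alpha) * (r + r * / (1 - r) ^ 2)).
Proof.
  intros HLu HLv.
  pose proof (sumZ_sqr_tail_bound b r u L ltac:(lra) HLu) as HFu.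
  pose proof (sumZ_sqr_tail_bound b r v L ltac:(lra) HLv) as HFv.
  set (kappa := / (1 - alpha)).
  assert (Hk : 0 < kappa) by (apply Rinv_0_lt_compat; lra).
  unfold Rdiv in HFu, HFv. set (x2 := / (1 - r) ^ 2) in *.
  assert (Hkr : 0 <= kappa * (r * / 2)) by (apply Rmult_le_pos; lra).
  apply Rle_trans with (sumZ (fun i =>
     (kappa * (r * / 2)) * (2 * Cmod (u i) ^ 2 + (tail_bound b r u (i + 1) ^ 2 + tail_bound b r v (i + 1) ^ 2))) n k).
  - apply sumZ_le. intros i. unfold common_cost. fold kappa.
    set (A := Cmod (u i)). set (G := tail_bound b r v (i + 1)). set (F := tail_bound b r u (i + 1)).
    replace (kappa * (r * (A * (F + G)))) with (kappa * (r * / 2) * (2 * A * (F + G))) by field.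
    apply Rmult_le_compat_l; [exact Hkr|].
    pose proof (pow2_ge_0 (A - F)). pose proof (pow2_ge_0 (A - G)). nra.
  - rewrite !sumZ_scal, !sumZ_plus, !sumZ_scal.
    rewrite (sumZ_shift (fun i => tail_bound b r u i ^ 2)).
    rewrite (sumZ_shift (fun i => tail_bound b r v i ^ 2)).
    replace (L * (kappa * (r + r * x2))) with (kappa * (r * / 2) * (2 * L + (L * x2 + L * x2))) by field.
    apply Rmult_le_compat_l; [exact Hkr|].
    pose proof (HLu n k). pose proof (HFu (n + 1)%Z k). pose proof (HFv (n + 1)%Z k). lra.
Qed.

End Stability.

(** * Invariance of the disc and finite speed of propagation *)

(** Solutions for nonnegative times: those built below by Picard iteration have a
frozen velocity for negative times. *)
Definition AL_forward (q0 : Z -> C) (q : R -> Z -> C) : Prop :=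
  (forall n, q 0 n = q0 n) /\
  (forall t n, 0 <= t -> Cderiv (fun s => q s n) t (AL_rhs (q t) n)).

Lemma AL_forward_of_solution q0 q : AL_solution q0 q -> AL_forward q0 q.
Proof.
  intros [H0 H]; split; [exact H0|]. intros t n _. apply Cderiv_of_is_derive, H.
Qed.

Lemma Cderiv_continuity_pt_Re h t l : Cderiv h t l -> continuity_pt (fun s => Re (h s)) t.
Proof. intros H. apply continuity_pt_filterlim. exact (Cderiv_continuous_Re _ _ _ H). Qed.

(** Minus one half of the logarithmic derivative of [1 - |w n| ^ 2] along the
flow. *)
Definition local_gain (w : Z -> C) (n : Z) : R := Re (Cconj (w n) * (Ci * (w (n - 1)%Z + w (n + 1)%Z)))%C.

Lemma Re_conj_AL_rhs w n :
  Re (Cconj (w n) * AL_rhs w n)%C = (1 - Cmod (w n) ^ 2) * local_gain w n.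
Proof.
  unfold AL_rhs, local_gain. rewrite <- Re_RtoC_mult. f_equal. ring.
Qed.

Lemma AL_forward_deriv_rho q0 q t n : AL_forward q0 q -> 0 <= t ->
  is_derive (fun s => 1 - Cmod (q s n) ^ 2) t (- 2 * local_gain (q t) n * (1 - Cmod (q t n) ^ 2)).
Proof.
  intros [_ H] Ht.
  replace (- 2 * local_gain (q t) n * (1 - Cmod (q t n) ^ 2)) with
    (0 - 2 * Re (Cconj (q t n) * AL_rhs (q t) n)%C) by (rewrite Re_conj_AL_rhs; ring).
  apply is_derive_Rminus; [apply is_derive_Rconst|]. apply Cderiv_sqr. apply H; exact Ht.
Qed.

(** [1 - |q n| ^ 2] satisfies a homogeneous linear equation whose coefficient is
continuous, hence bounded on compact time intervals. *)
Lemma AL_forward_in_disc q0 q : AL_forward q0 q -> (forall n, Cmod (q0 n) < 1) ->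
  forall t n, 0 <= t -> Cmod (q t n) < 1.
Proof.
  intros Hq H0 t n Ht. pose proof Hq as [Hi Hd].
  assert (Hc : forall s, 0 <= s <= t -> continuity_pt (fun s => Rabs (local_gain (q s) n)) s).
  { intros s Hs. apply (continuity_pt_comp (fun s => local_gain (q s) n) Rabs); [|apply Rcontinuity_abs].
    eapply (Cderiv_continuity_pt_Re (fun s => Cconj (q s n) * (Ci * (q s (n - 1)%Z + q s (n + 1)%Z)))%C).
    apply Cderiv_mult; [apply Cderiv_conj, Hd; lra|].
    apply Cderiv_mult; [apply Cderiv_const|]. apply Cderiv_plus; apply Hd; lra. }
  destruct (continuity_ab_maj _ 0 t Ht Hc) as [M [HM _]].
  assert (Hp : 0 < 1 - Cmod (q t n) ^ 2).
  { apply (stays_positive (fun s => 1 - Cmod (q s n) ^ 2)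
      (fun s => - 2 * local_gain (q s) n * (1 - Cmod (q s n) ^ 2)) (2 * Rabs (local_gain (q M) n)) t).
    - pose proof (Rabs_pos (local_gain (q M) n)). lra.
    - exact Ht.
    - intros s Hs. apply (AL_forward_deriv_rho q0); [exact Hq|lra].
    - intros s Hs. rewrite Rabs_mult. apply Rmult_le_compat_r; [apply Rabs_pos|].
      rewrite Rabs_mult, Rabs_left by lra. specialize (HM s Hs). lra.
    - rewrite Hi. specialize (H0 n). pose proof (Cmod_ge_0 (q0 n)). nra. }
  pose proof (Cmod_ge_0 (q t n)). nra.
Qed.

Lemma AL_rhs_diff_le (a b : Z -> C) n : (forall i, Cmod (a i) < 1) -> (forall i, Cmod (b i) < 1) ->
  Cmod (AL_rhs a n - AL_rhs b n) <=
   Cmod (a (n - 1)%Z - b (n - 1)%Z) + Cmod (a (n + 1)%Z - b (n + 1)%Z) + 4 * Cmod (a n - b n).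
Proof.
  intros Ha Hb. unfold AL_rhs.
  set (p := Cmod (a n)). set (p' := Cmod (b n)).
  replace (_ - _)%C with (Ci * (RtoC (1 - p ^ 2) * ((a (n - 1)%Z - b (n - 1)%Z) + (a (n + 1)%Z - b (n + 1)%Z))
    + RtoC (p' ^ 2 - p ^ 2) * (b (n - 1)%Z + b (n + 1)%Z)))%C.
  2:{ rewrite !RtoC_minus. ring. }
  rewrite Cmod_mult, Cmod_Ci, Rmult_1_l. eapply Rle_trans; [apply Cmod_triangle|].
  rewrite !Cmod_mult, !Cmod_R.
  assert (H1 : 0 <= p < 1) by (split; [apply Cmod_ge_0|apply Ha]).
  assert (H2 : 0 <= p' < 1) by (split; [apply Cmod_ge_0|apply Hb]).
  apply Rplus_le_compat.
  - rewrite Rabs_pos_eq by nra.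
    pose proof (Cmod_triangle (a (n - 1)%Z - b (n - 1)%Z) (a (n + 1)%Z - b (n + 1)%Z)).
    pose proof (Cmod_ge_0 ((a (n - 1)%Z - b (n - 1)%Z) + (a (n + 1)%Z - b (n + 1)%Z))). nra.
  - assert (Hd : Rabs (p' - p) <= Cmod (a n - b n)) by (rewrite Rabs_minus_sym; apply Cmod_triangle_rev).
    replace (p' ^ 2 - p ^ 2) with ((p' - p) * (p' + p)) by ring. rewrite Rabs_mult, (Rabs_pos_eq (p' + p)) by lra.
    assert (Cmod (b (n - 1)%Z + b (n + 1)%Z) <= 2).
    { eapply Rle_trans; [apply Cmod_triangle|]. pose proof (Hb (n - 1)%Z). pose proof (Hb (n + 1)%Z). lra. }
    replace (4 * Cmod (a n - b n)) with (Cmod (a n - b n) * 2 * 2) by ring.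
    apply Rmult_le_compat; [apply Rmult_le_pos; [apply Rabs_pos|lra]|apply Cmod_ge_0| |assumption].
    apply Rmult_le_compat; [apply Rabs_pos|lra|exact Hd|lra].
Qed.

(** Bound, after [m] iterations of Duhamel's formula, for a difference that is at
most 2 and whose derivative is at most 6 times its neighbouring values. *)
Definition light_cone (t : R) (m : nat) : R := 2 * ((6 * t) ^ m / INR (fact m)).

Lemma is_derive_light_cone t m : is_derive (fun s => light_cone s (S m)) t (6 * light_cone t m).
Proof.
  unfold light_cone.
  replace (6 * (2 * ((6 * t) ^ m / INR (fact m)))) with (2 * (6 * ((6 * t) ^ m / INR (fact m)))) by ring.
  apply is_derive_Rscal, is_derive_exp_term.
Qed.

Lemma light_cone_nonneg t m : 0 <= t -> 0 <= light_cone t m.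
Proof.
  intros Ht. unfold light_cone. apply Rmult_le_pos; [lra|]. apply Rdiv_le_0_compat; [apply pow_le; lra|].
  apply INR_fact_lt_0.
Qed.

Lemma light_cone_mono s t m : 0 <= s <= t -> light_cone s m <= light_cone t m.
Proof.
  intros H. unfold light_cone. apply Rmult_le_compat_l; [lra|]. apply Rmult_le_compat_r.
  - apply Rlt_le, Rinv_0_lt_compat, INR_fact_lt_0.
  - apply pow_incr. lra.
Qed.

(** A site of the interval needs [m] steps to see data outside it, if it lies
[m - 1] sites inside. *)
Lemma AL_finite_speed u0 v0 u v (a b : Z) :
  AL_forward u0 u -> AL_forward v0 v ->
  (forall n, Cmod (u0 n) < 1) -> (forall n, Cmod (v0 n) < 1) ->
  (forall n, (a <= n <= b)%Z -> u0 n = v0 n) ->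
  forall m t n, 0 <= t -> (a + Z.of_nat m <= n + 1)%Z -> (n - 1 <= b - Z.of_nat m)%Z ->
  Cmod (u t n - v t n) <= light_cone t m.
Proof.
  intros Hu Hv Hu0 Hv0 Hab.
  pose proof (AL_forward_in_disc _ _ Hu Hu0) as Bu. pose proof (AL_forward_in_disc _ _ Hv Hv0) as Bv.
  induction m as [|m IH]; intros t n Ht Hn1 Hn2.
  - unfold light_cone. simpl. specialize (Bu t n Ht). specialize (Bv t n Ht).
    unfold Cminus. eapply Rle_trans; [apply Cmod_triangle|]. rewrite Cmod_opp. lra.
  - pose proof Hu as [Iu Du]. pose proof Hv as [Iv Dv].
    assert (E0 : (u 0 n - v 0 n)%C = RtoC 0) by (rewrite Iu, Iv, Hab by lia; ring).
    replace (u t n - v t n)%C with ((u t n - v t n) - (u 0 n - v 0 n))%C by (rewrite E0; ring).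
    replace (light_cone t (S m)) with (light_cone t (S m) - light_cone 0 (S m))
      by (unfold light_cone; rewrite Rmult_0_r, pow_ne_zero by lia; unfold Rdiv; ring).
    apply (Cmod_MVT (fun s => u s n - v s n)%C (fun s => AL_rhs (u s) n - AL_rhs (v s) n)%C
       (fun s => light_cone s (S m)) (fun s => 6 * light_cone s m) 0 t Ht).
    + intros s Hs. apply Cderiv_minus; [apply Du|apply Dv]; lra.
    + intros s Hs. apply is_derive_light_cone.
    + intros s Hs. eapply Rle_trans; [apply AL_rhs_diff_le; intros i; [apply Bu|apply Bv]; lra|].
      pose proof (IH s (n - 1)%Z ltac:(lra) ltac:(lia) ltac:(lia)).
      pose proof (IH s (n + 1)%Z ltac:(lra) ltac:(lia) ltac:(lia)).
      pose proof (IH s n ltac:(lra) ltac:(lia) ltac:(lia)). lra.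
Qed.

(** * Conservation law and growth at the far left *)

Lemma AL_forward_zero : AL_forward (fun _ => RtoC 0) (fun _ _ => RtoC 0).
Proof.
  split; [reflexivity|]. intros t n _. eapply Cderiv_unique_eq; [apply Cderiv_const|].
  unfold AL_rhs. ring.
Qed.

(** Finite speed of propagation in comparison with the zero solution. *)
Lemma AL_tail_small u0 u K t n p : AL_forward u0 u -> (forall n, Cmod (u0 n) < 1) ->
  (forall n, (K < Z.abs n)%Z -> u0 n = RtoC 0) -> 0 <= t -> (0 <= K)%Z ->
  (K + Z.of_nat p <= Z.abs n)%Z -> Cmod (u t n) <= light_cone t p.
Proof.
  intros Hu H1 H0 Ht HK Hn.
  replace (u t n) with (u t n - 0)%C by ring.
  assert (Hz : forall i : Z, Cmod (RtoC 0) < 1) by (intros _; rewrite Cmod_0; lra).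
  destruct (Z_le_gt_dec 0 n).
  - apply (AL_finite_speed u0 (fun _ => RtoC 0) u (fun _ _ => RtoC 0) (K + 1) (n + Z.of_nat p) Hu AL_forward_zero H1 Hz); try lia; try lra.
    intros i Hi. apply H0. lia.
  - apply (AL_finite_speed u0 (fun _ => RtoC 0) u (fun _ _ => RtoC 0) (n - Z.of_nat p) (- K - 1) Hu AL_forward_zero H1 Hz); try lia; try lra.
    intros i Hi. apply H0. lia.
Qed.

(** The current of the conserved density [log_mass], up to the factor 2. *)
Definition flux (w : Z -> C) (n : Z) : R := Im (Cconj (w n) * w (n + 1)%Z)%C.

Lemma local_gain_flux w n : local_gain w n = flux w (n - 1) - flux w n.
Proof.
  unfold local_gain, flux. replace (n - 1 + 1)%Z with n by lia. unfold Re, Im; simpl. ring.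
Qed.

Lemma flux_le w n : (forall i, Cmod (w i) < 1) -> Rabs (flux w n) <= Cmod (w n).
Proof.
  intros Hw. unfold flux.
  apply Rle_trans with (Cmod (Cconj (w n) * w (n + 1)%Z)).
  { pose proof (Rmax_Cmod (Cconj (w n) * w (n + 1)%Z)%C) as H.
    eapply Rle_trans; [|exact H]. apply Rmax_r. }
  rewrite Cmod_mult, Cmod_conj. specialize (Hw (n + 1)%Z). pose proof (Cmod_ge_0 (w n)). 
  pose proof (Cmod_ge_0 (w (n + 1)%Z)). nra.
Qed.

Lemma is_derive_sumZ (f f' : R -> Z -> R) t n k :
  (forall i, is_derive (fun s => f s i) t (f' t i)) ->
  is_derive (fun s => sumZ (f s) n k) t (sumZ (f' t) n k).
Proof.
  intros H; revert n; induction k as [|k IH]; intros n; simpl.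
  - apply is_derive_Rconst.
  - apply is_derive_Rplus; [apply H|apply IH].
Qed.

Lemma sumZ_telescope (g : Z -> R) n k :
  sumZ (fun i => 2 * (g (i - 1)%Z - g i)) n k = 2 * (g (n - 1)%Z - g (n + Z.of_nat k - 1)%Z).
Proof.
  revert n; induction k as [|k IH]; intros n.
  - simpl. rewrite Z.add_0_r. ring.
  - rewrite sumZ_S, IH. replace (n + 1 - 1)%Z with n by lia.
    replace (n + 1 + Z.of_nat k - 1)%Z with (n + Z.of_nat (S k) - 1)%Z by lia. ring.
Qed.

Definition log_mass (w : Z -> C) (n : Z) : R := - ln (1 - Cmod (w n) ^ 2).

Lemma log_mass_ge w n : Cmod (w n) < 1 -> Cmod (w n) ^ 2 <= log_mass w n.
Proof.
  intros H. unfold log_mass. pose proof (Cmod_ge_0 (w n)).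
  pose proof (ln_le_sub_1 (1 - Cmod (w n) ^ 2) ltac:(nra)). lra.
Qed.

Lemma sumZ_window_le f n k a m : (forall i, 0 <= f i) -> (a <= n)%Z ->
  (n + Z.of_nat k <= a + Z.of_nat m)%Z -> sumZ f n k <= sumZ f a m.
Proof.
  intros Hf Ha Hm.
  replace m with (Z.to_nat (n - a) + (k + (m - Z.to_nat (n - a) - k)))%nat by lia.
  rewrite !sumZ_split. replace (a + Z.of_nat (Z.to_nat (n - a)))%Z with n by lia.
  pose proof (sumZ_nonneg f a (Z.to_nat (n - a)) Hf).
  pose proof (sumZ_nonneg f (n + Z.of_nat k) (m - Z.to_nat (n - a) - k) Hf). lra.
Qed.

(** Over a large window the derivative of the sum telescopes to the fluxes through
the two ends, which tend to 0 as the window grows. *)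
Lemma AL_log_mass_le u0 u K L : AL_forward u0 u -> (forall n, Cmod (u0 n) < 1) ->
  (forall n, (K < Z.abs n)%Z -> u0 n = RtoC 0) -> (0 <= K)%Z ->
  (forall n k, sumZ (log_mass u0) n k <= L) ->
  forall t n k, 0 <= t -> sumZ (log_mass (u t)) n k <= L.
Proof.
  intros Hu H1 H0 HK HL t n k Ht.
  pose proof (AL_forward_in_disc _ _ Hu H1) as HB.
  assert (Hpos : forall s i, 0 <= s -> 0 <= log_mass (u s) i).
  { intros s i Hs. eapply Rle_trans; [apply pow2_ge_0|apply log_mass_ge, HB, Hs]. }
  apply (le_of_factorial_error _ _ (8 * t) (6 * t)). intros p.
  set (m := (Z.to_nat (Z.abs n) + k + Z.to_nat K + p + 1)%nat).
  apply Rle_trans with (sumZ (log_mass (u t)) (- Z.of_nat m) (2 * m)).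
  { apply sumZ_window_le; [intros; apply Hpos; exact Ht|lia|lia]. }
  set (E := fun s => sumZ (log_mass (u s)) (- Z.of_nat m) (2 * m)).
  assert (HE : E t - E 0 <= (fun s => 4 * light_cone t p * s) t - (fun s => 4 * light_cone t p * s) 0).
  { apply (MVT_le E _ (fun s => sumZ (fun i => 2 * (flux (u s) (i - 1) - flux (u s) i)) (- Z.of_nat m) (2 * m))
      (fun s => 4 * light_cone t p) 0 t Ht).
    - intros s Hs. 
      apply (is_derive_sumZ (fun s => log_mass (u s)) (fun s i => 2 * (flux (u s) (i - 1) - flux (u s) i))).
      intros i. unfold log_mass.
      pose proof (AL_forward_deriv_rho _ _ s i Hu ltac:(lra)) as Hd.
      pose proof (HB s i ltac:(lra)) as Hb. pose proof (Cmod_ge_0 (u s i)).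
      assert (Hr : 0 < 1 - Cmod (u s i) ^ 2) by nra.
      pose proof (is_derive_comp (K := R_AbsRing) (V := R_NormedModule) ln (fun s => 1 - Cmod (u s i) ^ 2) s _ _ (is_derive_ln _ Hr) Hd) as Hc.
      apply is_derive_Ropp in Hc. 
      replace (2 * (flux (u s) (i - 1) - flux (u s) i)) with
        (- (scal (- 2 * local_gain (u s) i * (1 - Cmod (u s i) ^ 2)) (/ (1 - Cmod (u s i) ^ 2)))).
      + exact Hc.
      + unfold scal; simpl; unfold mult; simpl. rewrite local_gain_flux. field. lra.
    - intros s Hs. replace (4 * light_cone t p) with (4 * light_cone t p * 1) at 2 by ring.
      apply is_derive_Rscal. apply (is_derive_id (K := R_AbsRing)).
    - intros s Hs. rewrite (sumZ_telescope (flux (u s))).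
      pose proof (flux_le (u s) (- Z.of_nat m - 1) (fun i => HB s i ltac:(lra))) as F1.
      pose proof (flux_le (u s) (- Z.of_nat m + Z.of_nat (2 * m) - 1) (fun i => HB s i ltac:(lra))) as F2.
      pose proof (AL_tail_small u0 u K s (- Z.of_nat m - 1) p Hu H1 H0 ltac:(lra) HK ltac:(lia)) as T1.
      pose proof (AL_tail_small u0 u K s (- Z.of_nat m + Z.of_nat (2 * m) - 1) p Hu H1 H0 ltac:(lra) HK ltac:(lia)) as T2.
      pose proof (light_cone_mono s t p ltac:(lra)).
      apply Rabs_le_between in F1. apply Rabs_le_between in F2. lra. }
  fold (E t). 
  assert (HE0 : E 0 <= L).
  { unfold E. eapply Rle_trans; [|apply (HL (- Z.of_nat m)%Z (2 * m)%nat)].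
    apply sumZ_le. intros i. unfold log_mass. destruct Hu as [Hi _]. rewrite Hi. lra. }
  simpl in HE. unfold light_cone in HE. lra.
Qed.

(** The free growth rate on [|z| = r] is [Im z (1 / r ^ 2 - 1)], at most
[1 / r - r]. *)
Lemma Re_dispersion z r : Cmod z = r -> 0 < r <= 1 -> Re (Ci * (z + / z))%C <= / r.
Proof.
  intros Hz Hr. destruct z as [x y].
  assert (E : x ^ 2 + y ^ 2 = r ^ 2) by (rewrite <- Hz; symmetry; apply Cmod_sqr).
  unfold Re; simpl. replace (x * (x * 1) + y * (y * 1)) with (r * r) by lra.
  assert (Hy : - r <= y <= r) by nra.
  set (i := / r). assert (Hi : i * r = 1) by (unfold i; field; lra).
  assert (0 < i) by (apply Rinv_0_lt_compat; lra).
  replace (0 * (x + x / (r * r)) - 1 * (y + - y / (r * r))) with (y * (i * i - 1)) by (unfold i; field; lra).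
  assert (1 <= i) by nra.
  apply Rle_trans with (r * (i * i - 1)); [apply Rmult_le_compat_r; nra|]. nra.
Qed.

(** Apart from the free part, the Riccati equation contains the entries [a] and
[b] as factors. *)
Lemma riccati_remainder_le z r a b f : Cmod z = r -> 0 < r <= 1 ->
  Cmod a <= 1 -> Cmod b <= 1 -> Cmod f <= 1 ->
  Cmod (AL_riccati z a b f - Ci * (z + / z) * f) <= 4 * Cmod a + 2 * (Cmod b / r).
Proof.
  intros Hz Hr Ha Hb Hf.
  assert (Hz0 : z <> RtoC 0) by (intros E; rewrite E, Cmod_0 in Hz; lra).
  replace (AL_riccati z a b f - Ci * (z + / z) * f)%C with
   (Ci * ((a + - (b / z)) + (- (Cconj b * a) + - (Cconj a * b)) * f + (Cconj a + - (Cconj b * z)) * (f * f)))%C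
   by (unfold AL_riccati; field; exact Hz0).
  rewrite Cmod_mult, Cmod_Ci, Rmult_1_l.
  pose proof (Cmod_ge_0 a) as A0. pose proof (Cmod_ge_0 b) as B0. pose proof (Cmod_ge_0 f) as F0.
  eapply Rle_trans; [apply Cmod_triangle|]. 
  pose proof (Cmod_triangle (a + - (b / z)) ((- (Cconj b * a) + - (Cconj a * b)) * f)) as T0.
  pose proof (Cmod_triangle a (- (b / z))) as T1. rewrite Cmod_opp, Cmod_div, Hz in T1 by exact Hz0.
  assert (T2 : Cmod ((- (Cconj b * a) + - (Cconj a * b)) * f) <= 2 * Cmod a).
  { rewrite Cmod_mult. pose proof (Cmod_triangle (- (Cconj b * a)) (- (Cconj a * b))) as T.
    rewrite !Cmod_opp, !Cmod_mult, !Cmod_conj in T.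
    pose proof (Cmod_ge_0 (- (Cconj b * a) + - (Cconj a * b))). nra. }
  assert (T3 : Cmod ((Cconj a + - (Cconj b * z)) * (f * f)) <= Cmod a + Cmod b / r).
  { rewrite !Cmod_mult. pose proof (Cmod_triangle (Cconj a) (- (Cconj b * z))) as T.
    rewrite Cmod_opp, Cmod_mult, !Cmod_conj, Hz in T.
    assert (Cmod b * r <= Cmod b / r).
    { apply Rmult_le_compat_l; [exact B0|]. apply Rmult_le_reg_r with r; [lra|]. rewrite Rinv_l by lra. nra. }
    pose proof (Cmod_ge_0 (Cconj a + - (Cconj b * z))). 
    assert (Cmod f * Cmod f <= 1) by nra. nra. }
  lra.
Qed.

(** The energy [exp (- 2 s / r) |D s| ^ 2] has derivative at most [4 sigma]. *)
Lemma boundary_growth (D d : R -> C) (z : C) (r t sigma : R) :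
  Cmod z = r -> 0 < r <= 1 -> 0 <= t -> 0 <= sigma ->
  (forall s, 0 <= s <= t -> Cderiv D s (d s)) ->
  (forall s, 0 <= s <= t -> Cmod (d s - Ci * (z + / z) * D s) <= sigma) ->
  (forall s, 0 <= s <= t -> Cmod (D s) <= 2) ->
  Cmod (D t) ^ 2 <= exp (2 * (t / r)) * (Cmod (D 0) ^ 2 + 4 * sigma * t).
Proof.
  intros Hz Hr Ht Hsig Hd Hs H2.
  assert (Hir : 0 < / r) by (apply Rinv_0_lt_compat; lra).
  set (c := - (2 / r)).
  assert (HM : Cmod (D t) ^ 2 * exp (c * t) - Cmod (D 0) ^ 2 * exp (c * 0) <= 4 * sigma * t - 4 * sigma * 0).
  { apply (MVT_le (fun s => Cmod (D s) ^ 2 * exp (c * s)) (fun s => 4 * sigma * s)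
      (fun s => 2 * Re (Cconj (D s) * d s)%C * exp (c * s) + Cmod (D s) ^ 2 * (c * exp (c * s)))
      (fun s => 4 * sigma) 0 t Ht).
    - intros s Hst. apply (is_derive_Rmult (fun s => Cmod (D s) ^ 2) (fun s => exp (c * s))); [apply Cderiv_sqr; auto|apply is_derive_Rexp].
    - intros s Hst. auto_derive; [exact I|ring].
    - intros s Hst.
      assert (HR : Re (Cconj (D s) * d s)%C <= / r * Cmod (D s) ^ 2 + 2 * sigma).
      { replace (Cconj (D s) * d s)%C with
          (RtoC (Cmod (D s) ^ 2) * (Ci * (z + / z)) + Cconj (D s) * (d s - Ci * (z + / z) * D s))%C
          by (rewrite Cmod2_conj; ring).
        rewrite re_plus, Re_RtoC_mult. apply Rplus_le_compat.
        - rewrite Rmult_comm. apply Rmult_le_compat_r; [apply pow2_ge_0|]. apply Re_dispersion; assumption.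
        - eapply Rle_trans; [apply Re_le_Cmod|]. rewrite Cmod_mult, Cmod_conj.
          apply Rmult_le_compat; auto using Cmod_ge_0. }
      assert (He1 : 0 < exp (c * s)) by apply exp_pos.
      assert (He2 : exp (c * s) <= 1).
      { rewrite <- exp_0. apply exp_monotone. unfold c, Rdiv. nra. }
      replace (2 * Re (Cconj (D s) * d s)%C * exp (c * s) + Cmod (D s) ^ 2 * (c * exp (c * s))) with
        (2 * (Re (Cconj (D s) * d s)%C - / r * Cmod (D s) ^ 2) * exp (c * s)) by (unfold c; field; lra).
      apply Rle_trans with (4 * sigma * exp (c * s)).
      + apply Rmult_le_compat_r; lra.
      + rewrite <- (Rmult_1_r (4 * sigma)) at 2. apply Rmult_le_compat_l; lra. }
  rewrite (Rmult_0_r c), exp_0 in HM.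
  assert (E : exp (2 * (t / r)) * exp (c * t) = 1).
  { rewrite <- exp_plus, <- exp_0. f_equal. unfold c. field. lra. }
  replace (Cmod (D t) ^ 2) with (exp (2 * (t / r)) * (Cmod (D t) ^ 2 * exp (c * t))).
  - apply Rmult_le_compat_l; [apply Rlt_le, exp_pos|]. lra.
  - transitivity (Cmod (D t) ^ 2 * (exp (2 * (t / r)) * exp (c * t))); [ring|]. rewrite E. ring.
Qed.

(** * The estimate for data that agree on a left half-line *)

(** The window [[-m, m)] exceeds the support [[-K, K]] of the data by [p + 1] sites,
so that all four entries in the Riccati equation and in its defect are at most
[light_cone t p]; the defect is amplified along the [2 m] sites. *)
Lemma schur_boundary_growth u0 v0 u v K alpha z r p t :
  AL_forward u0 u -> AL_forward v0 v ->
  (forall n, Cmod (u0 n) < 1) -> (forall n, Cmod (v0 n) < 1) ->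
  (forall n, (K < Z.abs n)%Z -> u0 n = RtoC 0) -> (forall n, (K < Z.abs n)%Z -> v0 n = RtoC 0) ->
  (0 <= K)%Z -> 0 <= alpha < 1 ->
  (forall s n, 0 <= s -> Cmod (u s n) <= alpha) -> (forall s n, 0 <= s -> Cmod (v s n) <= alpha) ->
  Cmod z = r -> 0 < r < 1 -> 0 <= t ->
  let m := (K + 1 + Z.of_nat p)%Z in
  Cmod (schur_diff (u t) (v t) m (- m) z) ^ 2 <=
    exp (2 * (t / r)) * (Cmod (schur_diff u0 v0 m (- m) z) ^ 2
      + 4 * (16 / r * (/ (1 - alpha) ^ 2) ^ (2 * Z.to_nat m) * light_cone t p) * t).
Proof.
  intros Hu Hv Hu0 Hv0 Ku Kv HK Hal Bu Bv Hz Hr Ht m.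
  assert (Hz0 : z <> RtoC 0) by (intros E; rewrite E, Cmod_0 in Hz; lra).
  set (k := Z.to_nat (m - (- m))).
  assert (Hk : k = (2 * Z.to_nat m)%nat) by (unfold k, m; lia).
  set (g := / (1 - alpha) ^ 2).
  set (tau := light_cone t p).
  assert (Htau : 0 <= tau) by (apply light_cone_nonneg; lra).
  assert (Hg : 1 <= g).
  { unfold g. rewrite <- Rinv_1 at 1. apply Rinv_le_contravar; [apply pow_lt; lra|nra]. }
  assert (Hgk : 1 <= g ^ k) by (apply pow_R1_Rle; exact Hg).
  assert (Hir : 1 <= / r).
  { rewrite <- Rinv_1 at 1. apply Rinv_le_contravar; lra. }
  set (sigma := 16 / r * g ^ (2 * Z.to_nat m) * tau).
  assert (Hgt : 0 <= g ^ k * tau) by (apply Rmult_le_pos; lra).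
  (* Four small entries enter: those at [-m - 1] and [-m] through the Riccati
     coefficients, and the two at the right end through the defect. *)
  assert (Hone : forall w0 w, AL_forward w0 w -> (forall n, Cmod (w0 n) < 1) ->
     (forall n, (K < Z.abs n)%Z -> w0 n = RtoC 0) ->
     (forall s n, 0 <= s -> Cmod (w s n) <= alpha) ->
     forall s, 0 <= s <= t -> exists d, Cderiv (fun s => schur_fn m z (w s) (- m)) s d /\
       Cmod (d - Ci * (z + / z) * schur_fn m z (w s) (- m)) <= 8 * / r * (g ^ k * tau)).
  { intros w0 w Hw Hw0 Kw Bw s Hs.
    destruct (schur_iter_deriv z w s alpha ltac:(lra) Hz0 ltac:(lra) (fun n => Bw s n ltac:(lra))
       (fun n => proj2 Hw s n ltac:(lra)) k (- m)%Z) as [e [He1 He2]].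
    exists (AL_riccati z (w s (- m - 1)%Z) (w s (- m)%Z) (schur_iter z (w s) (- m) k) + e)%C.
    split; [exact He1|].
    assert (Hsm : forall n, (K + Z.of_nat p <= Z.abs n)%Z -> Cmod (w s n) <= tau).
    { intros n Hn. eapply Rle_trans; [apply (AL_tail_small w0 w K s n p Hw Hw0 Kw); [lra|exact HK|exact Hn]|].
      apply light_cone_mono; lra. }
    assert (Hf : Cmod (schur_iter z (w s) (- m) k) <= 1).
    { apply schur_iter_le_1; [lra|]. intros n. specialize (Bw s n ltac:(lra)). lra. }
    pose proof (riccati_remainder_le z r (w s (- m - 1)%Z) (w s (- m)%Z) _ Hz ltac:(lra)
      ltac:(specialize (Bw s (- m - 1)%Z ltac:(lra)); lra) ltac:(specialize (Bw s (- m)%Z ltac:(lra)); lra) Hf) as HR.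
    unfold schur_fn. fold k.
    replace (_ - _)%C with ((AL_riccati z (w s (- m - 1)%Z) (w s (- m)%Z) (schur_iter z (w s) (- m) k)
       - Ci * (z + / z) * schur_iter z (w s) (- m) k) + e)%C by ring.
    eapply Rle_trans; [apply Cmod_triangle|].
    rewrite Hz in He2. fold g in He2.
    pose proof (Hsm (- m - 1)%Z ltac:(unfold m; lia)) as S1. pose proof (Hsm (- m)%Z ltac:(unfold m; lia)) as S2.
    pose proof (Hsm (- m + Z.of_nat k - 1)%Z ltac:(rewrite Hk; unfold m; lia)) as S3.
    pose proof (Hsm (- m + Z.of_nat k)%Z ltac:(rewrite Hk; unfold m; lia)) as S4.
    assert (E1 : Cmod (w s (- m)%Z) / r <= tau * / r) by (apply Rmult_le_compat_r; lra).
    assert (E2 : Cmod (w s (- m + Z.of_nat k)%Z) / r <= tau * / r) by (apply Rmult_le_compat_r; lra).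
    assert (E3 : tau <= tau * / r) by nra.
    assert (E4 : g ^ k * (Cmod (w s (- m + Z.of_nat k - 1)%Z) + Cmod (w s (- m + Z.of_nat k)%Z) / r) <= g ^ k * (2 * (tau * / r))).
    { apply Rmult_le_compat_l; lra. }
    assert (E5 : 1 * (tau * / r) <= g ^ k * (tau * / r)) by (apply Rmult_le_compat_r; nra).
    replace (8 * / r * (g ^ k * tau)) with (8 * (g ^ k * (tau * / r))) by ring. lra. }
  assert (Hdiff : forall s, exists d, 0 <= s <= t -> Cderiv (fun s => schur_diff (u s) (v s) m (- m) z) s d /\
     Cmod (d - Ci * (z + / z) * schur_diff (u s) (v s) m (- m) z) <= sigma).
  { intros s. destruct (Rle_dec 0 s) as [H1|H1]; [|exists (RtoC 0); lra].
    destruct (Rle_dec s t) as [H2|H2]; [|exists (RtoC 0); lra].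
    destruct (Hone u0 u Hu Hu0 Ku Bu s (conj H1 H2)) as [du [Du1 Du2]].
    destruct (Hone v0 v Hv Hv0 Kv Bv s (conj H1 H2)) as [dv [Dv1 Dv2]].
    exists (du - dv)%C. intros _. split; [apply Cderiv_minus; assumption|].
    unfold schur_diff.
    replace (_ - _)%C with ((du - Ci * (z + / z) * schur_fn m z (u s) (- m))
      + - (dv - Ci * (z + / z) * schur_fn m z (v s) (- m)))%C by ring.
    eapply Rle_trans; [apply Cmod_triangle|]. rewrite Cmod_opp.
    unfold sigma. rewrite <- Hk. replace (16 / r * g ^ k * tau) with (8 * / r * (g ^ k * tau) + 8 * / r * (g ^ k * tau)) by (field; lra).
    lra. }
  assert (Hchoice : exists d : R -> C, forall s, 0 <= s <= t -> Cderiv (fun s => schur_diff (u s) (v s) m (- m) z) s (d s) /\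
     Cmod (d s - Ci * (z + / z) * schur_diff (u s) (v s) m (- m) z) <= sigma).
  { exists (fun s => (Derive (fun s => fst (schur_diff (u s) (v s) m (- m) z)) s,
                      Derive (fun s => snd (schur_diff (u s) (v s) m (- m) z)) s)).
    intros s Hs. destruct (Hdiff s) as [ds Hds]. destruct (Hds Hs) as [[D1 D2] D3].
    assert (E : (Derive (fun s => fst (schur_diff (u s) (v s) m (- m) z)) s,
                 Derive (fun s => snd (schur_diff (u s) (v s) m (- m) z)) s) = ds).
    { rewrite (surjective_pairing ds). f_equal; apply is_derive_unique; assumption. }
    rewrite E.
    split; [split; assumption|exact D3]. }
  destruct Hchoice as [d Hd].
  assert (E0 : schur_diff u0 v0 m (- m) z = schur_diff (u 0) (v 0) m (- m) z).
  { assert (Hext : forall w w' : Z -> C, (forall n, w n = w' n) -> forall k n, schur_iter z w n k = schur_iter z w' n k).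
    { intros w w' Hww. induction k0 as [|k0 IH]; intros n; simpl; [reflexivity|]. rewrite IH, Hww. reflexivity. }
    unfold schur_diff, schur_fn.
    rewrite (Hext u0 (u 0)), (Hext v0 (v 0)); [reflexivity| |]; intros n; symmetry; [apply Hv|apply Hu]. }
  rewrite E0.
  apply (boundary_growth (fun s => schur_diff (u s) (v s) m (- m) z) d z r t sigma Hz ltac:(lra) Ht).
  - unfold sigma. rewrite <- Hk. replace (16 / r * g ^ k * tau) with (16 * / r * (g ^ k * tau)) by (field; lra).
    apply Rmult_le_pos; lra.
  - intros s Hs. apply Hd; exact Hs.
  - intros s Hs. apply Hd; exact Hs.
  - intros s Hs. unfold schur_diff, Cminus. eapply Rle_trans; [apply Cmod_triangle|]. rewrite Cmod_opp.
    assert (Cmod (schur_fn m z (u s) (- m)) <= 1).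
    { apply schur_iter_le_1; [lra|]. intros n. specialize (Bu s n ltac:(lra)). lra. }
    assert (Cmod (schur_fn m z (v s) (- m)) <= 1).
    { apply schur_iter_le_1; [lra|]. intros n. specialize (Bv s n ltac:(lra)). lra. }
    lra.
Qed.

(** With [y = 1 / (1 - r) ^ 2], the claim about the coefficient of [kappa] is
[5/2 + 7/2 y - 2 y (1 - r) - (1 - r) <= 4 y + 1]; the other term is far from
sharp. *)
Lemma exponent_budget (L kappa r : R) : 0 <= L -> 0 <= kappa -> 0 < r < 1 ->
  L * (kappa * (3 / 2 + 3 / 2 * / (1 - r) ^ 2 + r * / (1 - r) ^ 2) + r * (/ 2 + / 2 * / (1 - r) ^ 2))
  + L * (kappa * (r + r * / (1 - r) ^ 2)) <= L * (2 + kappa) * (4 / (1 - r) ^ 2 + 1).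
Proof.
  intros HL Hk Hr. set (y := / (1 - r) ^ 2).
  assert (Hy : y * (1 - r) ^ 2 = 1) by (unfold y; field; lra).
  assert (Hy0 : 0 < y) by (apply Rinv_0_lt_compat, pow_lt; lra).
  assert (Hy1 : 1 <= y) by nra.
  replace (4 / (1 - r) ^ 2) with (4 * y) by (unfold y; field; lra).
  assert (H1 : 3 / 2 + 3 / 2 * y + r * y + r + r * y <= 4 * y + 1).
  { assert (0 <= y * (2 - 2 * r + 3 / 2 * r ^ 2 - r ^ 3)) by (apply Rmult_le_pos; nra).
    assert (E : (1 / 2 + r) = (1 / 2 + r) * (y * (1 - r) ^ 2)) by (rewrite Hy; ring).
    nra. }
  assert (H2 : r * (/ 2 + / 2 * y) <= 2 * (4 * y + 1)) by nra.
  assert (H3 : kappa * (3 / 2 + 3 / 2 * y + r * y + r + r * y) <= kappa * (4 * y + 1)) by (apply Rmult_le_compat_l; lra).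
  rewrite <- Rmult_plus_distr_l, Rmult_assoc. apply Rmult_le_compat_l; [exact HL|]. lra.
Qed.

(** The three facts of the introduction are combined at the left end [-m], with
[m = K + 1 + p]: evolution in time, initial difference, and the Schur algorithm
from [-m] to [j].  The error term is super-exponentially small even after
division by [r ^ (2 (j + m))], so [p] can tend to infinity. *)
Lemma one_sided_estimate u0 v0 u v K (N : Z) eta j t r :
  AL_forward u0 u -> AL_forward v0 v ->
  (forall n, Cmod (u0 n) < 1) -> (forall n, Cmod (v0 n) < 1) ->
  (forall n, (K < Z.abs n)%Z -> u0 n = RtoC 0) -> (forall n, (K < Z.abs n)%Z -> v0 n = RtoC 0) ->
  (Z.abs j <= K)%Z -> (Z.abs N <= K)%Z -> (j <= N)%Z ->
  (forall n, (n <= N)%Z -> u0 n = v0 n) ->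
  0 < eta <= 1 ->
  (forall n k, sumZ (log_mass u0) n k <= ln (/ eta)) ->
  (forall n k, sumZ (log_mass v0) n k <= ln (/ eta)) ->
  0 < t -> 0 < r < 1 ->
  Cmod (u t j - v t j) <= 2 * exp (t / r) * Cconst eta r * r ^ (Z.to_nat (N + 1 - j)).
Proof.
  intros Hu Hv Hu0 Hv0 Ku Kv HjK HNK HjN Heq Heta Lu0 Lv0 Ht Hr.
  set (L := ln (/ eta)) in *.
  assert (HL : 0 <= L). { unfold L. rewrite ln_Rinv by lra. pose proof (ln_le_sub_1 eta ltac:(lra)). lra. }
  set (alpha := sqrt (1 - eta)).
  assert (Hal : 0 <= alpha < 1).
  { split; [apply sqrt_pos|]. unfold alpha. apply Rlt_le_trans with (sqrt 1); [apply sqrt_lt_1; lra|rewrite sqrt_1; lra]. }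
  pose proof (AL_forward_in_disc _ _ Hu Hu0) as Bu1. pose proof (AL_forward_in_disc _ _ Hv Hv0) as Bv1.
  assert (HK0 : (0 <= K)%Z) by lia.
  pose proof (AL_log_mass_le u0 u K L Hu Hu0 Ku HK0 Lu0) as Lu.
  pose proof (AL_log_mass_le v0 v K L Hv Hv0 Kv HK0 Lv0) as Lv.
  assert (Hpt : forall w : R -> Z -> C, (forall s n, 0 <= s -> Cmod (w s n) < 1) ->
     (forall s n k, 0 <= s -> sumZ (log_mass (w s)) n k <= L) ->
     forall s n, 0 <= s -> Cmod (w s n) <= alpha).
  { intros w Bw Lw s n Hs. pose proof (Lw s n 1%nat Hs) as H. simpl in H. unfold log_mass in H.
    specialize (Bw s n Hs). pose proof (Cmod_ge_0 (w s n)).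
    assert (Hp : 0 < 1 - Cmod (w s n) ^ 2) by nra.
    assert (He : eta <= 1 - Cmod (w s n) ^ 2).
    { apply Rnot_lt_le. intros Hlt. apply ln_increasing in Hlt; [|exact Hp].
      unfold L in H. rewrite ln_Rinv in H by lra. simpl in *. lra. }
    unfold alpha. rewrite <- (sqrt_pow2 (Cmod (w s n))) by assumption. apply sqrt_le_1_alt. lra. }
  assert (Hsq : forall w : R -> Z -> C, (forall s n, 0 <= s -> Cmod (w s n) < 1) ->
     (forall s n k, 0 <= s -> sumZ (log_mass (w s)) n k <= L) ->
     forall s, 0 <= s -> forall n k, sumZ (fun i => Cmod (w s i) ^ 2) n k <= L).
  { intros w Bw Lw s Hs n k. eapply Rle_trans; [|apply (Lw s n k Hs)].
    apply sumZ_le. intros i. apply log_mass_ge, Bw, Hs. }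
  pose proof (Hpt u Bu1 Lu) as Bu. pose proof (Hpt v Bv1 Lv) as Bv.
  assert (Bu0 : forall n, Cmod (u0 n) <= alpha) by (intros n; rewrite <- (proj1 Hu); apply Bu; lra).
  assert (Bv0 : forall n, Cmod (v0 n) <= alpha) by (intros n; rewrite <- (proj1 Hv); apply Bv; lra).
  assert (Qu0 : forall n k, sumZ (fun i => Cmod (u0 i) ^ 2) n k <= L).
  { intros n k. eapply Rle_trans; [|apply (Lu0 n k)]. apply sumZ_le. intros i. apply log_mass_ge, Hu0. }
  assert (Qv0 : forall n k, sumZ (fun i => Cmod (v0 i) ^ 2) n k <= L).
  { intros n k. eapply Rle_trans; [|apply (Lv0 n k)]. apply sumZ_le. intros i. apply log_mass_ge, Hv0. }
  set (kappa := / (1 - alpha)).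
  assert (Hk0 : 0 < kappa) by (apply Rinv_0_lt_compat; lra).
  set (S0 := L * (kappa * (3 / 2 + 3 / 2 * / (1 - r) ^ 2 + r * / (1 - r) ^ 2) + r * (/ 2 + / 2 * / (1 - r) ^ 2))).
  set (P0 := L * (kappa * (r + r * / (1 - r) ^ 2))).
  set (l := Z.to_nat (N + 1 - j)).
  assert (Hbudget : exp (S0 + P0) <= Cconst eta r).
  { unfold Cconst. apply exp_monotone. fold L alpha. replace (1 / (1 - alpha)) with kappa by (unfold kappa; field; lra).
    apply exponent_budget; lra. }
  enough (Hmain : Cmod (u t j - v t j) ^ 2 <= (2 * exp (t / r) * exp (S0 + P0) * r ^ l) ^ 2).
  { apply Rle_trans with (2 * exp (t / r) * exp (S0 + P0) * r ^ l).
    - apply Rsqr_incr_0_var; [rewrite !Rsqr_pow2; exact Hmain|].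
      pose proof (exp_pos (t / r)). pose proof (exp_pos (S0 + P0)). pose proof (pow_lt r l ltac:(lra)).
      repeat apply Rmult_le_pos; lra.
    - apply Rmult_le_compat_r; [apply pow_le; lra|]. apply Rmult_le_compat_l; [|exact Hbudget].
      pose proof (exp_pos (t / r)). lra. }
  (* There are [J + p] sites from [-m] to [j], and [l] from [j] to [N + 1]. *)
  set (J := Z.to_nat (j + K + 1)).
  set (g := / (1 - alpha) ^ 2).
  set (A := exp (2 * S0) * exp (2 * (t / r)) * (4 * t * (32 / r * g ^ (2 * Z.to_nat (K + 1)) / (r ^ J) ^ 2))).
  apply (le_of_factorial_error _ _ A (g ^ 2 * (6 * t) / r ^ 2)). intros p.
  set (m := (K + 1 + Z.of_nat p)%Z).
  set (k := Z.to_nat (j + m)).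
  assert (Ek : k = (J + p)%nat) by (unfold k, J, m; lia).
  assert (Hrk : 0 < r ^ k) by (apply pow_lt; lra).
  set (D0 := 2 * (r ^ k * r ^ l) * exp P0).
  set (sigma := 16 / r * g ^ (2 * Z.to_nat m) * light_cone t p).
  assert (Hz : forall z, Cmod z = r -> Cmod (schur_diff (u t) (v t) m (- m) z) ^ 2 <=
     exp (2 * (t / r)) * (D0 ^ 2 + 4 * sigma * t)).
  { intros z Hz. eapply Rle_trans.
    - apply (schur_boundary_growth u0 v0 u v K alpha z r p t); auto; lra.
    - apply Rmult_le_compat_l; [apply Rlt_le, exp_pos|]. apply Rplus_le_compat_r. fold m.
      apply pow_incr. split; [apply Cmod_ge_0|].
      pose proof (schur_diff_common u0 v0 alpha r m ltac:(lra) Hr Bu0 Bv0 (k + l) (- m) z Hz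
        ltac:(unfold k, l, m; lia) ltac:(intros i Hi; apply Heq; unfold k, l, m in Hi; lia)) as HC.
      eapply Rle_trans; [exact HC|]. unfold D0.
      (* At the site [N + 1] only the bound 1 of each function is available. *)
      assert (H2 : Cmod (schur_diff u0 v0 m (- m + Z.of_nat (k + l)) z) <= 2).
      { unfold schur_diff, Cminus. eapply Rle_trans; [apply Cmod_triangle|]. rewrite Cmod_opp.
        pose proof (schur_iter_le_1 z u0 ltac:(lra) Hu0 (Z.to_nat (m - (- m + Z.of_nat (k + l)))) (- m + Z.of_nat (k + l))%Z).
        pose proof (schur_iter_le_1 z v0 ltac:(lra) Hv0 (Z.to_nat (m - (- m + Z.of_nat (k + l)))) (- m + Z.of_nat (k + l))%Z).
        unfold schur_fn. lra. }
      pose proof (exp_monotone _ _ (sumZ_common_cost u0 v0 alpha r m ltac:(lra) Hr L (- m) (k + l) Qu0 Qv0)) as HP.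
      fold kappa in HP. fold P0 in HP. rewrite pow_add.
      pose proof (exp_pos (sumZ (common_cost u0 v0 alpha r m) (- m) (k + l))).
      assert (0 <= r ^ k * r ^ l) by (apply Rmult_le_pos; apply pow_le; lra).
      replace (2 * (r ^ k * r ^ l) * exp P0) with (r ^ k * r ^ l * exp P0 * 2) by ring.
      apply Rmult_le_compat; [apply Rmult_le_pos; lra|apply Cmod_ge_0| |exact H2].
      apply Rmult_le_compat_l; [assumption|exact HP]. }
  assert (Hd2 : schur_dist2 (u t) (v t) r m (- m) <= exp (2 * (t / r)) * (D0 ^ 2 + 4 * sigma * t)).
  { rewrite <- (circle_mean_const (exp (2 * (t / r)) * (D0 ^ 2 + 4 * sigma * t))).
    apply circle_mean_le.
    - intros s. apply continuous_sqr_disc_algebra; [lra|].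
      apply (disc_algebra_schur_diff (u t) (v t) alpha r m ltac:(lra) Hr); intros n; [apply Bu|apply Bv]; lra.
    - intros s. apply continuous_const.
    - intros s. apply Hz. apply Cmod_circle; lra. }
  pose proof (schur_dist2_iter (u t) (v t) alpha r m ltac:(lra) Hr (fun n => Bu t n ltac:(lra)) (fun n => Bv t n ltac:(lra))
    k (- m) ltac:(unfold k, m; lia)) as Hiter.
  replace (- m + Z.of_nat k)%Z with j in Hiter by (unfold k, m; lia).
  pose proof (coefficient_dist_le (u t) (v t) alpha r m ltac:(lra) Hr (fun n => Bu t n ltac:(lra)) (fun n => Bv t n ltac:(lra))
    j ltac:(unfold m; lia)) as Hcoef.
  pose proof (sumZ_step_cost (u t) (v t) alpha r m ltac:(lra) Hr L (- m) k (Hsq u Bu1 Lu t ltac:(lra)) (Hsq v Bv1 Lv t ltac:(lra))) as HS.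
  fold kappa in HS. fold S0 in HS.
  set (X := Cmod (u t j - v t j) ^ 2) in *.
  assert (Hfin : (r ^ k) ^ 2 * X <= exp (2 * S0) * (exp (2 * (t / r)) * (D0 ^ 2 + 4 * sigma * t))).
  { eapply Rle_trans; [apply Rmult_le_compat_l; [apply pow2_ge_0|exact Hcoef]|].
    eapply Rle_trans; [exact Hiter|].
    apply Rmult_le_compat; [apply Rlt_le, exp_pos| |apply exp_monotone; lra|exact Hd2].
    apply (schur_dist2_nonneg (u t) (v t) alpha r m ltac:(lra) Hr); intros n; [apply Bu|apply Bv]; lra. }
  apply Rmult_le_reg_l with ((r ^ k) ^ 2); [apply pow_lt; exact Hrk|].
  eapply Rle_trans; [exact Hfin|]. apply Req_le.
  unfold D0, sigma, A, light_cone.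
  replace (2 * Z.to_nat m)%nat with (2 * Z.to_nat (K + 1) + 2 * p)%nat by (unfold m; lia).
  rewrite Ek, !pow_add, exp_plus.
  replace (2 * S0) with (S0 + S0) by ring. replace (2 * (t / r)) with (t / r + t / r) by ring.
  rewrite !exp_plus.
  replace ((g ^ 2 * (6 * t) / r ^ 2) ^ p) with (g ^ (2 * p) * (6 * t) ^ p / (r ^ p) ^ 2).
  - assert (N1 : r ^ J <> 0) by (apply pow_nonzero; lra).
    assert (N2 : r ^ p <> 0) by (apply pow_nonzero; lra).
    pose proof (INR_fact_neq_0 p) as N3.
    generalize dependent (r ^ J). generalize dependent (r ^ p). generalize dependent (INR (fact p)).
    generalize (r ^ l) (exp (t / r)) (exp S0) (exp P0) ((6 * t) ^ p) (g ^ (2 * Z.to_nat (K + 1))) (g ^ (2 * p)).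
    intros. field. repeat split; try assumption; lra.
  - unfold Rdiv. rewrite !Rpow_mult_distr, pow_inv.
    rewrite <- !pow_mult. rewrite (Nat.mul_comm 2 p). reflexivity.
Qed.

(** * Existence of solutions *)

Definition clamp (x : R) : R := Rmax (-1) (Rmin 1 x).
Definition clip (c : C) : C := (clamp (fst c), clamp (snd c)).
Definition damping (c : C) : R := 1 - Rmin 1 (Cmod c) ^ 2.
(** The equation with a globally Lipschitz and bounded right-hand side.  It agrees
with the original one as long as the sequence stays in the disc, and [damping]
vanishes outside, so that the disc remains invariant. *)
Definition cutoff_rhs (u : Z -> C) (n : Z) : C :=
  (Ci * RtoC (damping (u n)) * (clip (u (n - 1)%Z) + clip (u (n + 1)%Z)))%C.

Lemma clamp_bound x : Rabs (clamp x) <= 1.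
Proof. unfold clamp. apply Rabs_le. unfold Rmax, Rmin. destruct (Rle_dec 1 x), (Rle_dec (-1) _); lra. Qed.

Lemma clamp_lipschitz x y : Rabs (clamp x - clamp y) <= Rabs (x - y).
Proof.
  unfold clamp, Rmax, Rmin.
  destruct (Rle_dec 1 x), (Rle_dec 1 y); repeat destruct (Rle_dec (-1) _);
  unfold Rabs; repeat destruct (Rcase_abs _); lra.
Qed.

Lemma clip_bound c : Cmod (clip c) <= 2.
Proof.
  eapply Rle_trans; [apply Cmod_le_Rabs_sum|]. simpl.
  pose proof (clamp_bound (fst c)). pose proof (clamp_bound (snd c)). lra.
Qed.

Lemma clip_lipschitz c d : Cmod (clip c - clip d) <= 2 * Cmod (c - d).
Proof.
  eapply Rle_trans; [apply Cmod_le_Rabs_sum|]. simpl.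
  pose proof (clamp_lipschitz (fst c) (fst d)). pose proof (clamp_lipschitz (snd c) (snd d)).
  pose proof (Rmax_Cmod (c - d)%C) as H1.
  pose proof (Rmax_l (Rabs (fst (c - d)%C)) (Rabs (snd (c - d)%C))).
  pose proof (Rmax_r (Rabs (fst (c - d)%C)) (Rabs (snd (c - d)%C))).
  unfold Rminus in *. simpl in *. lra.
Qed.

Lemma clip_in_disc c : Cmod c < 1 -> clip c = c.
Proof.
  intros Hc. pose proof (Rmax_Cmod c) as H1.
  pose proof (Rmax_l (Rabs (fst c)) (Rabs (snd c))). pose proof (Rmax_r (Rabs (fst c)) (Rabs (snd c))).
  unfold clip. rewrite (surjective_pairing c) at 3.
  assert (Hx : forall x, Rabs x < 1 -> clamp x = x).
  { intros x Hx. apply Rabs_def2 in Hx. unfold clamp. rewrite Rmin_right, Rmax_right; lra. }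
  f_equal; apply Hx; lra.
Qed.

Lemma damping_bound c : 0 <= damping c <= 1.
Proof.
  unfold damping. pose proof (Cmod_ge_0 c). 
  assert (0 <= Rmin 1 (Cmod c) <= 1) by (split; [apply Rmin_glb; lra|apply Rmin_l]). nra.
Qed.

Lemma damping_lipschitz c d : Rabs (damping c - damping d) <= 2 * Cmod (c - d).
Proof.
  eapply Rle_trans; [|apply Rmult_le_compat_l; [lra|apply Cmod_triangle_rev]].
  unfold damping. pose proof (Cmod_ge_0 c). pose proof (Cmod_ge_0 d).
  set (x := Cmod c) in *. set (y := Cmod d) in *.
  unfold Rmin. destruct (Rle_dec 1 x), (Rle_dec 1 y);
  unfold Rabs; repeat destruct (Rcase_abs _); nra.
Qed.

Lemma cutoff_rhs_le_damping u n : Cmod (cutoff_rhs u n) <= 4 * damping (u n).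
Proof.
  unfold cutoff_rhs. pose proof (damping_bound (u n)).
  rewrite !Cmod_mult, Cmod_Ci, Cmod_R, Rabs_pos_eq by lra.
  pose proof (Cmod_triangle (clip (u (n - 1)%Z)) (clip (u (n + 1)%Z))).
  pose proof (clip_bound (u (n - 1)%Z)). pose proof (clip_bound (u (n + 1)%Z)).
  pose proof (Cmod_ge_0 (clip (u (n - 1)%Z) + clip (u (n + 1)%Z))). nra.
Qed.

Lemma cutoff_rhs_bound u n : Cmod (cutoff_rhs u n) <= 4.
Proof. pose proof (cutoff_rhs_le_damping u n). pose proof (damping_bound (u n)). lra. Qed.

Lemma cutoff_rhs_lipschitz u v n D :
  (forall i, (n - 1 <= i <= n + 1)%Z -> Cmod (u i - v i) <= D) ->
  Cmod (cutoff_rhs u n - cutoff_rhs v n) <= 12 * D.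
Proof.
  intros H. unfold cutoff_rhs.
  replace (_ - _)%C with (Ci * (RtoC (damping (u n)) *
      ((clip (u (n - 1)%Z) - clip (v (n - 1)%Z)) + (clip (u (n + 1)%Z) - clip (v (n + 1)%Z)))
      + RtoC (damping (u n) - damping (v n)) * (clip (v (n - 1)%Z) + clip (v (n + 1)%Z))))%C
    by (rewrite RtoC_minus; ring).
  rewrite Cmod_mult, Cmod_Ci, Rmult_1_l. eapply Rle_trans; [apply Cmod_triangle|].
  rewrite !Cmod_mult, !Cmod_R. pose proof (damping_bound (u n)). rewrite Rabs_pos_eq by lra.
  pose proof (Cmod_triangle (clip (u (n - 1)%Z) - clip (v (n - 1)%Z)) (clip (u (n + 1)%Z) - clip (v (n + 1)%Z))).
  pose proof (clip_lipschitz (u (n - 1)%Z) (v (n - 1)%Z)). pose proof (clip_lipschitz (u (n + 1)%Z) (v (n + 1)%Z)).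
  pose proof (damping_lipschitz (u n) (v n)).
  pose proof (Cmod_triangle (clip (v (n - 1)%Z)) (clip (v (n + 1)%Z))).
  pose proof (clip_bound (v (n - 1)%Z)). pose proof (clip_bound (v (n + 1)%Z)).
  pose proof (H (n - 1)%Z ltac:(lia)). pose proof (H (n + 1)%Z ltac:(lia)). pose proof (H n ltac:(lia)).
  set (a := Cmod (clip (u (n - 1)%Z) - clip (v (n - 1)%Z) + _)) in *.
  assert (0 <= a) by apply Cmod_ge_0.
  assert (damping (u n) * a <= 1 * (4 * D)) by (apply Rmult_le_compat; lra).
  assert (Rabs (damping (u n) - damping (v n)) * Cmod (clip (v (n - 1)%Z) + clip (v (n + 1)%Z)) <= 2 * D * 4).
  { apply Rmult_le_compat; [apply Rabs_pos|apply Cmod_ge_0|lra|lra]. }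
  lra.
Qed.

Definition lipschitz (M : R) (f : R -> C) : Prop := forall s t, Cmod (f t - f s) <= M * Rabs (t - s).

Lemma lipschitz_of_deriv M (f f' : R -> C) :
  (forall t, Cderiv f t (f' t)) -> (forall t, Cmod (f' t) <= M) -> lipschitz M f.
Proof.
  intros Hd HM.
  assert (Hle : forall s t, s <= t -> Cmod (f t - f s) <= M * (t - s)).
  { intros s t Hst. rewrite Rmult_minus_distr_l.
    apply (Cmod_MVT f f' (fun x => M * x) (fun _ => M) s t Hst); auto.
    intros x _. auto_derive; [exact I|ring]. }
  intros s t. destruct (Rle_dec s t) as [H|H].
  - rewrite Rabs_pos_eq by lra. apply Hle; exact H.
  - rewrite Rabs_left by lra. replace (f t - f s)%C with (- (f s - f t))%C by ring.
    rewrite Cmod_opp. specialize (Hle t s ltac:(lra)). lra.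
Qed.

Lemma lipschitz_continuous M (f : R -> R) t : 0 < M -> (forall s, Rabs (f s - f t) <= M * Rabs (s - t)) -> continuous f t.
Proof.
  intros HM Hf. apply (proj2 (filterlim_locally (U := R_UniformSpace) _ _)). intros eps.
  assert (He : 0 < eps / M) by (apply Rdiv_lt_0_compat; [apply cond_pos|exact HM]).
  exists (mkposreal _ He). intros s Hs. change (Rabs (s - t) < eps / M) in Hs.
  change (Rabs (f s - f t) < eps). eapply Rle_lt_trans; [apply Hf|].
  apply (Rmult_lt_compat_l M) in Hs; [|exact HM]. replace (M * (eps / M)) with (pos eps) in Hs by (field; lra). exact Hs.
Qed.

Definition Cprimitive (f : R -> C) (t : R) : C := (RInt (fun s => fst (f s)) 0 t, RInt (fun s => snd (f s)) 0 t).

Lemma Cderiv_primitive M f t : 0 < M -> lipschitz M f -> Cderiv (Cprimitive f) t (f t).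
Proof.
  intros HM Hf.
  assert (HR : forall g : R -> R, (forall s x, Rabs (g x - g s) <= M * Rabs (x - s)) -> is_derive (fun t => RInt g 0 t) t (g t)).
  { intros g Hg. assert (Hc : forall s, continuous g s) by (intros s; apply (lipschitz_continuous M); auto).
    apply (is_derive_RInt (V := R_NormedModule) g (fun t => RInt g 0 t) 0 t); [|apply Hc].
    apply filter_forall. intros x. apply (RInt_correct (V := R_CompleteNormedModule)).
    apply (ex_RInt_continuous (V := R_CompleteNormedModule)). auto. }
  split; apply HR; intros s x; (eapply Rle_trans; [|apply Hf]);
    pose proof (Rmax_Cmod (f x - f s)%C) as H1; (eapply Rle_trans; [|exact H1]).
  - apply (Rmax_l (Rabs (fst (f x - f s)%C))).
  - apply (Rmax_r (Rabs (fst (f x - f s)%C))).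
Qed.

(** The velocity is frozen at its initial value for negative times.  The equation
at time 0 then holds with a two-sided derivative, while estimates are needed for
nonnegative times only. *)
Fixpoint picard (q0 : Z -> C) (k : nat) (t : R) (n : Z) : C :=
  match k with
  | O => q0 n
  | S k' => (q0 n + Cprimitive (fun s => cutoff_rhs (picard q0 k' (Rmax 0 s)) n) t)%C
  end.

Lemma Rmax_0_lipschitz s t : Rabs (Rmax 0 t - Rmax 0 s) <= Rabs (t - s).
Proof.
  unfold Rmax. destruct (Rle_dec 0 s), (Rle_dec 0 t); unfold Rabs; repeat destruct (Rcase_abs _); lra.
Qed.

Lemma cutoff_velocity_lipschitz (w : R -> Z -> C) n :
  (forall i, lipschitz 4 (fun t => w t i)) -> lipschitz 48 (fun s => cutoff_rhs (w (Rmax 0 s)) n).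
Proof.
  intros Hw s x. replace (48 * Rabs (x - s)) with (12 * (4 * Rabs (x - s))) by ring.
  apply cutoff_rhs_lipschitz. intros i _. eapply Rle_trans; [apply Hw|].
  apply Rmult_le_compat_l; [lra|apply Rmax_0_lipschitz].
Qed.

Section Picard.
Variable q0 : Z -> C.

Lemma picard_lipschitz k : forall n, lipschitz 4 (fun t => picard q0 k t n).
Proof.
  induction k as [|k IH]; intros n.
  - intros s t. simpl. replace (q0 n - q0 n)%C with (RtoC 0) by ring. rewrite Cmod_0.
    pose proof (Rabs_pos (t - s)). lra.
  - apply (lipschitz_of_deriv 4 _ (fun t => cutoff_rhs (picard q0 k (Rmax 0 t)) n)); [|intros; apply cutoff_rhs_bound].
    intros t. simpl. eapply Cderiv_unique_eq.
    + apply Cderiv_plus; [apply Cderiv_const|].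
      apply (Cderiv_primitive 48 (fun s => cutoff_rhs (picard q0 k (Rmax 0 s)) n)); [lra|].
      apply cutoff_velocity_lipschitz, IH.
    + cbv beta. ring.
Qed.

Lemma picard_velocity_lipschitz k n : lipschitz 48 (fun s => cutoff_rhs (picard q0 k (Rmax 0 s)) n).
Proof. apply cutoff_velocity_lipschitz, picard_lipschitz. Qed.

Lemma Cderiv_picard k n t : Cderiv (fun s => picard q0 (S k) s n) t (cutoff_rhs (picard q0 k (Rmax 0 t)) n).
Proof.
  simpl. eapply Cderiv_unique_eq.
  - apply Cderiv_plus; [apply Cderiv_const|].
    apply (Cderiv_primitive 48 (fun s => cutoff_rhs (picard q0 k (Rmax 0 s)) n)); [lra|apply picard_velocity_lipschitz].
  - cbv beta. ring.
Qed.

Lemma picard_at_0 k n : picard q0 k 0 n = q0 n.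
Proof.
  destruct k as [|k]; simpl; [reflexivity|]. unfold Cprimitive. rewrite !RInt_point.
  change (q0 n + RtoC 0 = q0 n)%C. ring.
Qed.

Lemma picard_increment k : forall t n, 0 <= t ->
  Cmod (picard q0 (S k) t n - picard q0 k t n) <= (12 * t) ^ S k / INR (fact (S k)).
Proof.
  induction k as [|k IH]; intros t n Ht.
  - pose proof (picard_lipschitz 1 n 0 t) as H. cbv beta in H. rewrite picard_at_0, Rminus_0_r, Rabs_pos_eq in H by lra.
    change (picard q0 0 t n) with (q0 n). simpl (_ / _). lra.
  - replace (picard q0 (S (S k)) t n - picard q0 (S k) t n)%C with
      ((picard q0 (S (S k)) t n - picard q0 (S k) t n) - (picard q0 (S (S k)) 0 n - picard q0 (S k) 0 n))%C
      by (rewrite !picard_at_0; ring).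
    replace ((12 * t) ^ S (S k) / INR (fact (S (S k)))) with
      ((12 * t) ^ S (S k) / INR (fact (S (S k))) - (12 * 0) ^ S (S k) / INR (fact (S (S k)))).
    2:{ rewrite Rmult_0_r, (pow_ne_zero (S (S k))) by lia. unfold Rdiv. ring. }
    apply (Cmod_MVT (fun s => picard q0 (S (S k)) s n - picard q0 (S k) s n)%C
      (fun s => cutoff_rhs (picard q0 (S k) (Rmax 0 s)) n - cutoff_rhs (picard q0 k (Rmax 0 s)) n)%C
      (fun s => (12 * s) ^ S (S k) / INR (fact (S (S k))))
      (fun s => 12 * ((12 * s) ^ S k / INR (fact (S k)))) 0 t Ht).
    + intros s _. apply Cderiv_minus; apply Cderiv_picard.
    + intros s _. apply is_derive_exp_term.
    + intros s Hs. apply cutoff_rhs_lipschitz. intros i _. rewrite Rmax_right by lra. apply IH. lra.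
Qed.

Lemma picard_negative k t n : t <= 0 -> picard q0 (S k) t n = picard q0 1 t n.
Proof.
  intros Ht.
  assert (E : forall k, cutoff_rhs (picard q0 k 0) n = cutoff_rhs q0 n).
  { intros i. unfold cutoff_rhs. rewrite !picard_at_0. reflexivity. }
  change (q0 n + Cprimitive (fun s => cutoff_rhs (picard q0 k (Rmax 0 s)) n) t
    = q0 n + Cprimitive (fun s => cutoff_rhs (picard q0 0 (Rmax 0 s)) n) t)%C.
  f_equal. unfold Cprimitive. f_equal; apply RInt_ext; intros x Hx;
  rewrite Rmin_right, Rmax_left in Hx by lra; rewrite (Rmax_left 0 x) by lra; rewrite !E; reflexivity.
Qed.

Lemma real_picard_cv (x : nat -> R) (t : R) : 0 <= t ->
  (forall k, Rabs (x (S k) - x k) <= (12 * t) ^ S k / INR (fact (S k))) -> ex_finite_lim_seq x.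
Proof.
  intros Ht Hx.
  assert (Hs : ex_series (fun k => x (S k) - x k)).
  { apply (ex_series_le (K := R_AbsRing) (V := R_CompleteNormedModule) _ (fun k => (12 * t) ^ S k / INR (fact (S k)))).
    - exact Hx.
    - apply (ex_series_incr_1 (K := R_AbsRing) (V := R_NormedModule) (fun k => (12 * t) ^ k / INR (fact k))).
      exists (exp (12 * t)). pose proof (is_exp_Reals (12 * t)) as He.
      eapply is_series_ext; [|exact He]. intros k. cbv beta.
      unfold scal; simpl; unfold mult; simpl. rewrite pow_n_pow. reflexivity. }
  destruct Hs as [l Hl]. exists (l + x O).
  apply is_lim_seq_incr_1.
  apply (is_lim_seq_ext (fun k => sum_n (fun k => x (S k) - x k) k + x O)).
  - intros k. induction k as [|k IH].
    + rewrite sum_O. ring.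
    + rewrite sum_Sn. unfold plus; simpl. lra.
  - apply is_lim_seq_plus'; [exact Hl|apply is_lim_seq_const].
Qed.

Definition picard_lim (t : R) (n : Z) : C :=
  (real (Lim_seq (fun k => fst (picard q0 k t n))), real (Lim_seq (fun k => snd (picard q0 k t n)))).

Lemma picard_cv t n eps : 0 < eps ->
  exists k0, forall k, (k0 <= k)%nat -> Cmod (picard q0 k t n - picard_lim t n) <= eps.
Proof.
  intros He.
  assert (Hex : ex_finite_lim_seq (fun k => fst (picard q0 k t n)) /\ ex_finite_lim_seq (fun k => snd (picard q0 k t n))).
  { destruct (Rle_dec 0 t) as [Ht|Ht].
    - assert (Hb : forall k, Rmax (Rabs (fst (picard q0 (S k) t n - picard q0 k t n)%C)) (Rabs (snd (picard q0 (S k) t n - picard q0 k t n)%C))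
          <= (12 * t) ^ S k / INR (fact (S k))).
      { intros k. eapply Rle_trans; [apply Rmax_Cmod|apply picard_increment; exact Ht]. }
      split; apply (real_picard_cv _ t Ht); intros k; (eapply Rle_trans; [|apply Hb]).
      + apply (Rmax_l (Rabs (fst (picard q0 (S k) t n - picard q0 k t n)%C))).
      + apply (Rmax_r (Rabs (fst (picard q0 (S k) t n - picard q0 k t n)%C))).
    - split; [exists (fst (picard q0 1 t n))|exists (snd (picard q0 1 t n))];
      apply is_lim_seq_incr_1;
      (eapply is_lim_seq_ext; [intros k; rewrite picard_negative by lra; reflexivity|apply is_lim_seq_const]). }
  destruct Hex as [H1 H2].
  apply Lim_seq_correct' in H1. apply Lim_seq_correct' in H2.
  apply is_lim_seq_spec in H1. apply is_lim_seq_spec in H2.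
  assert (He2 : 0 < eps / 2) by lra.
  destruct (H1 (mkposreal _ He2)) as [k1 K1]. destruct (H2 (mkposreal _ He2)) as [k2 K2].
  exists (max k1 k2). intros k Hk. specialize (K1 k ltac:(lia)). specialize (K2 k ltac:(lia)). simpl in K1, K2.
  eapply Rle_trans; [apply Cmod_le_Rabs_sum|].
  change (Rabs (fst (picard q0 k t n) - fst (picard_lim t n)) + Rabs (snd (picard q0 k t n) - snd (picard_lim t n)) <= eps).
  unfold picard_lim; simpl. lra.
Qed.

(** The iterates have uniformly Lipschitz velocities, so this bound holds for each
of them; it passes to pointwise limits and yields differentiability without any
uniform convergence. *)
Lemma picard_lim_quadratic t t0 n :
  Cmod (picard_lim t n - picard_lim t0 n - RtoC (t - t0) * cutoff_rhs (picard_lim (Rmax 0 t0)) n)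
   <= 48 * (t - t0) ^ 2.
Proof.
  apply le_epsilon. intros eps He.
  set (w := Rabs (t - t0)).
  assert (Hw : 0 <= w) by apply Rabs_pos.
  set (e := eps / (2 + 12 * w)).
  assert (Hep : 0 < e) by (apply Rdiv_lt_0_compat; lra).
  destruct (picard_cv t n e Hep) as [k1 K1]. destruct (picard_cv t0 n e Hep) as [k2 K2].
  destruct (picard_cv (Rmax 0 t0) (n - 1)%Z e Hep) as [k3 K3].
  destruct (picard_cv (Rmax 0 t0) n e Hep) as [k4 K4].
  destruct (picard_cv (Rmax 0 t0) (n + 1)%Z e Hep) as [k5 K5].
  set (k := (k1 + k2 + k3 + k4 + k5)%nat).
  specialize (K1 (S k) ltac:(unfold k; lia)). specialize (K2 (S k) ltac:(unfold k; lia)).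
  specialize (K3 k ltac:(unfold k; lia)). specialize (K4 k ltac:(unfold k; lia)). specialize (K5 k ltac:(unfold k; lia)).
  assert (HF : Cmod (cutoff_rhs (picard q0 k (Rmax 0 t0)) n - cutoff_rhs (picard_lim (Rmax 0 t0)) n) <= 12 * e).
  { apply cutoff_rhs_lipschitz. intros i Hi.
    assert (Hc : (i = n - 1 \/ i = n \/ i = n + 1)%Z) by lia.
    destruct Hc as [-> | [-> | ->]]; assumption. }
  set (V := cutoff_rhs (picard q0 k (Rmax 0 t0)) n) in *.
  assert (Hq : Cmod (picard q0 (S k) t n - picard q0 (S k) t0 n - RtoC (t - t0) * V) <= 48 * (t - t0) ^ 2).
  { assert (Hle : forall a b, a <= b -> (a = t0 \/ b = t0) ->
      Cmod ((picard q0 (S k) b n - RtoC b * V) - (picard q0 (S k) a n - RtoC a * V)) <= 48 * (b - a) * b - 48 * (b - a) * a).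
    { intros a b Hab Hor.
      apply (Cmod_MVT (fun s => picard q0 (S k) s n - RtoC s * V)%C
         (fun s => cutoff_rhs (picard q0 k (Rmax 0 s)) n - V)%C (fun s => 48 * (b - a) * s) (fun _ => 48 * (b - a)) a b Hab).
      - intros s _. eapply Cderiv_unique_eq.
        + apply Cderiv_minus; [apply Cderiv_picard|].
          apply (Cderiv_mult (fun s => RtoC s) (fun _ => V) s (RtoC 1) (RtoC 0)); [|apply Cderiv_const].
          split; simpl; [apply (is_derive_id (K := R_AbsRing))|apply is_derive_Rconst].
        + cbv beta. ring.
      - intros s _. auto_derive; [exact I|ring].
      - intros s Hs. eapply Rle_trans; [apply (picard_velocity_lipschitz k n t0 s)|].
        apply Rmult_le_compat_l; [lra|]. apply Rabs_le. destruct Hor as [-> | ->]; lra. }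
    destruct (Rle_dec t0 t) as [H|H].
    - replace (_ - _)%C with ((picard q0 (S k) t n - RtoC t * V) - (picard q0 (S k) t0 n - RtoC t0 * V))%C
        by (rewrite RtoC_minus; ring).
      eapply Rle_trans; [apply Hle; auto|]. apply Req_le. ring.
    - replace (_ - _)%C with (- ((picard q0 (S k) t0 n - RtoC t0 * V) - (picard q0 (S k) t n - RtoC t * V)))%C
        by (rewrite RtoC_minus; ring).
      rewrite Cmod_opp. eapply Rle_trans; [apply Hle; [lra|auto]|]. apply Req_le. ring. }
  replace (_ - _)%C with ((picard q0 (S k) t n - picard q0 (S k) t0 n - RtoC (t - t0) * V)
     + (- (picard q0 (S k) t n - picard_lim t n) + ((picard q0 (S k) t0 n - picard_lim t0 n)
     + RtoC (t - t0) * (V - cutoff_rhs (picard_lim (Rmax 0 t0)) n))))%C by ring.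
  eapply Rle_trans; [apply Cmod_triangle|]. apply Rplus_le_compat; [exact Hq|].
  eapply Rle_trans; [apply Cmod_triangle|]. rewrite Cmod_opp.
  eapply Rle_trans; [apply Rplus_le_compat_l, Cmod_triangle|]. rewrite Cmod_mult, Cmod_R. fold w.
  assert (w * Cmod (V - cutoff_rhs (picard_lim (Rmax 0 t0)) n) <= w * (12 * e)) by (apply Rmult_le_compat_l; assumption).
  replace eps with (e + (e + w * (12 * e))) by (unfold e; field; lra). lra.
Qed.

Lemma is_derive_of_quadratic (f : R -> R) x l M : 0 <= M ->
  (forall y, Rabs (f y - f x - (y - x) * l) <= M * (y - x) ^ 2) -> is_derive f x l.
Proof.
  intros HM H. apply is_derive_Reals. intros eps He.
  assert (Hd : 0 < eps / (M + 1)) by (apply Rdiv_lt_0_compat; lra).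
  exists (mkposreal _ Hd). intros h Hh Hlt. simpl in Hlt.
  specialize (H (x + h)). replace (x + h - x) with h in H by ring.
  replace ((f (x + h) - f x) / h - l) with ((f (x + h) - f x - h * l) / h) by (field; exact Hh).
  unfold Rdiv. rewrite Rabs_mult, Rabs_inv.
  assert (Hp : 0 < Rabs h) by (apply Rabs_pos_lt; exact Hh).
  apply Rmult_lt_reg_r with (Rabs h); [exact Hp|]. rewrite Rmult_assoc, Rinv_l, Rmult_1_r by lra.
  eapply Rle_lt_trans; [exact H|]. rewrite <- (pow2_abs h).
  apply (Rmult_lt_compat_l (M + 1)) in Hlt; [|lra].
  replace ((M + 1) * (eps / (M + 1))) with eps in Hlt by (field; lra). nra.
Qed.

Lemma Cderiv_picard_lim t n : Cderiv (fun s => picard_lim s n) t (cutoff_rhs (picard_lim (Rmax 0 t)) n).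
Proof.
  split; apply (is_derive_of_quadratic _ _ _ 48); try lra; intros s;
   (eapply Rle_trans; [|apply (picard_lim_quadratic s t n)]);
   (eapply Rle_trans; [|apply Rmax_Cmod]).
  - eapply Rle_trans; [|apply Rmax_l]. apply Req_le. f_equal. simpl. ring.
  - eapply Rle_trans; [|apply Rmax_r]. apply Req_le. f_equal. simpl. ring.
Qed.

Lemma picard_lim_at_0 n : picard_lim 0 n = q0 n.
Proof.
  unfold picard_lim.
  rewrite (Lim_seq_ext _ (fun _ => fst (q0 n))) by (intros k; rewrite picard_at_0; reflexivity).
  rewrite (Lim_seq_ext (fun k => snd (picard q0 k 0 n)) (fun _ => snd (q0 n))) by (intros k; rewrite picard_at_0; reflexivity).
  rewrite !Lim_seq_const. simpl. symmetry. apply surjective_pairing.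
Qed.

Hypothesis Hq0 : forall n, Cmod (q0 n) < 1.

(** [damping] bounds the velocity, so [1 - |u n| ^ 2] satisfies the hypothesis of
[stays_positive]. *)
Lemma picard_lim_in_disc t n : 0 <= t -> Cmod (picard_lim t n) < 1.
Proof.
  intros Ht.
  assert (Hp : 0 < 1 - Cmod (picard_lim t n) ^ 2).
  { apply (stays_positive (fun s => 1 - Cmod (picard_lim s n) ^ 2)
     (fun s => 0 - 2 * Re (Cconj (picard_lim s n) * cutoff_rhs (picard_lim (Rmax 0 s)) n)%C) 8 t); [lra|exact Ht| | |].
    - intros s _. apply is_derive_Rminus; [apply is_derive_Rconst|]. apply Cderiv_sqr, Cderiv_picard_lim.
    - intros s Hs. rewrite Rmax_right by lra. rewrite Rminus_0_l, Rabs_Ropp, Rabs_mult, (Rabs_pos_eq 2) by lra.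
      pose proof (re_le_Cmod (Cconj (picard_lim s n) * cutoff_rhs (picard_lim s) n)%C) as HR.
      rewrite Cmod_mult, Cmod_conj in HR.
      pose proof (cutoff_rhs_le_damping (picard_lim s) n) as HD.
      pose proof (Cmod_ge_0 (picard_lim s n)) as Hx. pose proof (Cmod_ge_0 (cutoff_rhs (picard_lim s) n)) as HF.
      unfold damping in HD. set (x := Cmod (picard_lim s n)) in *.
      set (F := Cmod (cutoff_rhs (picard_lim s) n)) in *.
      assert (x * F <= 4 * Rabs (1 - x ^ 2)).
      { unfold Rmin in HD. destruct (Rle_dec 1 x) as [H1|H1].
        - replace F with 0 by lra. pose proof (Rabs_pos (1 - x ^ 2)). lra.
        - pose proof (Rle_abs (1 - x ^ 2)). assert (x * F <= 1 * F) by (apply Rmult_le_compat_r; lra). lra. }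
      lra.
    - rewrite picard_lim_at_0. specialize (Hq0 n). pose proof (Cmod_ge_0 (q0 n)). nra. }
  pose proof (Cmod_ge_0 (picard_lim t n)). nra.
Qed.

Lemma AL_forward_picard_lim : AL_forward q0 picard_lim.
Proof.
  split; [apply picard_lim_at_0|]. intros t n Ht.
  eapply Cderiv_unique_eq; [apply Cderiv_picard_lim|]. rewrite Rmax_right by exact Ht.
  unfold cutoff_rhs, AL_rhs, damping. rewrite !clip_in_disc by (apply picard_lim_in_disc; exact Ht).
  rewrite Rmin_right by (apply Rlt_le, picard_lim_in_disc; exact Ht). reflexivity.
Qed.
End Picard.

Lemma AL_forward_exists q0 : (forall n, Cmod (q0 n) < 1) -> exists q, AL_forward q0 q.
Proof. intros H. exists (picard_lim q0). apply AL_forward_picard_lim, H. Qed.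

(** * Truncation on both sides *)

Lemma log_mass_nonneg w i : Cmod (w i) < 1 -> 0 <= log_mass w i.
Proof. intros H. eapply Rle_trans; [apply pow2_ge_0|apply log_mass_ge, H]. Qed.

Lemma prod_f_R0_log_mass (w : Z -> C) a m : (forall n, Cmod (w n) < 1) ->
  prod_f_R0 (fun k => 1 - Cmod (w (Z.of_nat k + a)%Z) ^ 2) m = exp (- sumZ (log_mass w) a (S m)).
Proof.
  intros Hw.
  assert (Hf : forall i, 1 - Cmod (w i) ^ 2 = exp (- log_mass w i)).
  { intros i. unfold log_mass. rewrite Ropp_involutive, exp_ln; [reflexivity|].
    specialize (Hw i). pose proof (Cmod_ge_0 (w i)). nra. }
  induction m as [|m IH].
  - change (1 - Cmod (w (0 + a)%Z) ^ 2 = exp (- (log_mass w a + 0))). rewrite Hf. f_equal. simpl. ring.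
  - match goal with |- prod_f_R0 ?f _ = _ => change (prod_f_R0 f m * f (S m) = exp (- sumZ (log_mass w) a (S (S m)))) end.
    rewrite IH. cbv beta. rewrite Hf, <- exp_plus. f_equal.
    replace (S (S m)) with (S m + 1)%nat by lia. rewrite sumZ_split.
    replace (Z.of_nat (S m) + a)%Z with (a + Z.of_nat (S m))%Z by lia.
    change (sumZ (log_mass w) (a + Z.of_nat (S m)) 1) with (log_mass w (a + Z.of_nat (S m)) + 0). ring.
Qed.

Lemma partial_prodZ_log_mass (w : Z -> C) M : (forall n, Cmod (w n) < 1) ->
  partial_prodZ (fun n => 1 - Cmod (w n) ^ 2) M = exp (- sumZ (log_mass w) (- Z.of_nat M) (2 * M + 1)).
Proof.
  intros Hw. unfold partial_prodZ. rewrite Nat.add_1_r, <- (prod_f_R0_log_mass w _ _ Hw). reflexivity.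
Qed.

(** A window with a larger sum would keep all later symmetric products below a
constant smaller than [eta]. *)
Lemma window_log_mass_le (w : Z -> C) eta : (forall n, Cmod (w n) < 1) -> 0 < eta ->
  Rbar_le eta (prodZ (fun n => 1 - Cmod (w n) ^ 2)) ->
  forall n k, sumZ (log_mass w) n k <= ln (/ eta).
Proof.
  intros Hw Heta Hprod n k.
  assert (Hpos : forall i, 0 <= log_mass w i) by (intros i; apply log_mass_nonneg, Hw).
  set (M := (Z.to_nat (Z.abs n) + k)%nat).
  apply Rnot_lt_le. intros Hlt.
  set (c := exp (- sumZ (log_mass w) n k)).
  assert (Hc : c < eta).
  { unfold c. rewrite <- (exp_ln eta Heta). apply exp_increasing. rewrite ln_Rinv in Hlt by exact Heta. lra. }
  assert (HL : Rbar_le (prodZ (fun n => 1 - Cmod (w n) ^ 2)) c).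
  { unfold prodZ. rewrite <- (Lim_seq_const c). apply Lim_seq_le_loc. exists M. intros m Hm.
    rewrite partial_prodZ_log_mass by exact Hw. unfold c. apply exp_monotone.
    apply Ropp_le_contravar. apply sumZ_window_le; [exact Hpos|unfold M in Hm; lia|unfold M in Hm; lia]. }
  pose proof (Rbar_le_trans _ _ _ Hprod HL) as H. simpl in H. lra.
Qed.

Definition restrict (a b : Z) (q0 : Z -> C) (n : Z) : C :=
  if ((a <=? n) && (n <=? b))%Z%bool then q0 n else RtoC 0.

Lemma restrict_in a b q0 n : (a <= n <= b)%Z -> restrict a b q0 n = q0 n.
Proof. intros H. unfold restrict. destruct (Z.leb_spec a n), (Z.leb_spec n b); simpl; lia || reflexivity. Qed.

Lemma restrict_out a b q0 n : ~ (a <= n <= b)%Z -> restrict a b q0 n = RtoC 0.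
Proof. intros H. unfold restrict. destruct (Z.leb_spec a n), (Z.leb_spec n b); simpl; lia || reflexivity. Qed.

Lemma restrict_in_disc a b q0 n : Cmod (q0 n) < 1 -> Cmod (restrict a b q0 n) < 1.
Proof. intros H. unfold restrict. destruct (_ && _)%bool; [exact H|rewrite Cmod_0; lra]. Qed.

Lemma restrict_log_mass a b q0 L : (forall n, Cmod (q0 n) < 1) ->
  (forall n k, sumZ (log_mass q0) n k <= L) -> forall n k, sumZ (log_mass (restrict a b q0)) n k <= L.
Proof.
  intros H HL n k. eapply Rle_trans; [apply sumZ_le|apply (HL n k)]. intros i.
  unfold log_mass at 1. unfold restrict. destruct (_ && _)%bool.
  - apply Rle_refl.
  - rewrite Cmod_0. replace (1 - 0 ^ 2) with 1 by ring. rewrite ln_1, Ropp_0. apply log_mass_nonneg, H.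
Qed.

Lemma truncate_restrict N q0 n : truncate N q0 n = restrict (- Z.of_nat N) (Z.of_nat N) q0 n.
Proof.
  unfold truncate, restrict. destruct (Z.leb_spec (Z.abs n) (Z.of_nat N)), (Z.leb_spec (- Z.of_nat N) n), (Z.leb_spec n (Z.of_nat N));
  simpl; lia || reflexivity.
Qed.

(** The equation is symmetric in the two neighbours. *)
Lemma AL_forward_reflect q0 q : AL_forward q0 q -> AL_forward (fun n => q0 (- n)%Z) (fun t n => q t (- n)%Z).
Proof.
  intros [H0 Hd]. split; [intros n; apply H0|]. intros t n Ht.
  eapply Cderiv_unique_eq; [apply Hd, Ht|]. unfold AL_rhs.
  replace (- (n - 1))%Z with (- n + 1)%Z by lia. replace (- (n + 1))%Z with (- n - 1)%Z by lia.
  f_equal. ring.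
Qed.

Lemma sumZ_reflect f n k : sumZ (fun i => f (- i)%Z) n k = sumZ f (1 - n - Z.of_nat k) k.
Proof.
  revert n; induction k as [|k IH]; intros n; [reflexivity|].
  rewrite sumZ_S, IH. replace (S k) with (k + 1)%nat at 2 by lia. rewrite sumZ_split.
  replace (1 - n - Z.of_nat (S k))%Z with (1 - (n + 1) - Z.of_nat k)%Z by lia.
  replace (1 - (n + 1) - Z.of_nat k + Z.of_nat k)%Z with (- n)%Z by lia. simpl (sumZ f (- n) 1). ring.
Qed.

Theorem theorem1p4 (q0 : Z -> C) (eta : R) (q : R -> Z -> C)
    (N : nat) (qN : R -> Z -> C)
    (hq0 : forall n : Z, Cmod (q0 n) < 1)
    (heta : 0 < eta)
    (hprod : Rbar_le (Finite eta) (prodZ (fun n : Z => 1 - Cmod (q0 n) ^ 2)))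
    (hq : AL_solution q0 q)
    (hqN : AL_solution (truncate N q0) qN) :
  forall (j : Z) (t r : R),
    (Z.abs j <= Z.of_nat N)%Z -> 0 < t -> 0 < r < 1 ->
    Cmod (q t j - qN t j)%C <=
      4 * exp (t / r) * Cconst eta r / (1 - r) * r ^ (N - Z.abs_nat j).
Proof.
  intros j t r Hj Ht Hr.
  pose proof (window_log_mass_le q0 eta hq0 heta hprod) as HL.
  assert (Heta1 : eta <= 1).
  { apply Rnot_lt_le. intros H. specialize (HL 0%Z 0%nat). simpl in HL. rewrite ln_Rinv in HL by exact heta.
    pose proof (ln_increasing 1 eta Rlt_0_1 H). rewrite ln_1 in H0. lra. }
  pose proof (AL_forward_of_solution _ _ hq) as Fq.
  assert (FN : AL_forward (restrict (- Z.of_nat N) (Z.of_nat N) q0) qN).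
  { pose proof (AL_forward_of_solution _ _ hqN) as [H1 H2]. split; [|exact H2].
    intros n. rewrite H1. apply truncate_restrict. }
  set (Bd := 2 * exp (t / r) * Cconst eta r * r ^ (N - Z.abs_nat j)).
  assert (HBd : 0 <= Bd).
  { unfold Bd. unfold Cconst. pose proof (pow_le r (N - Z.abs_nat j) ltac:(lra)).
    repeat apply Rmult_le_pos; try lra; apply Rlt_le, exp_pos. }
  assert (Hone : forall l, (N - Z.abs_nat j <= l)%nat -> 2 * exp (t / r) * Cconst eta r * r ^ l <= Bd).
  { intros l Hl. unfold Bd. apply Rmult_le_compat_l.
    - unfold Cconst. repeat apply Rmult_le_pos; try lra; apply Rlt_le, exp_pos.
    - replace l with ((N - Z.abs_nat j) + (l - (N - Z.abs_nat j)))%nat by lia. rewrite pow_add.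
      rewrite <- (Rmult_1_r (r ^ (N - Z.abs_nat j))) at 2. apply Rmult_le_compat_l; [apply pow_le; lra|].
      rewrite <- (pow1 (l - (N - Z.abs_nat j))). apply pow_incr. lra. }
  (* Each of the two one-sided comparisons costs [Bd]. *)
  apply Rle_trans with (2 * Bd).
  2:{ unfold Bd. set (P := exp (t / r) * Cconst eta r * r ^ (N - Z.abs_nat j)) in *.
      replace (2 * (2 * exp (t / r) * Cconst eta r * r ^ (N - Z.abs_nat j))) with (4 * P * 1) by (unfold P; ring).
      replace (4 * exp (t / r) * Cconst eta r / (1 - r) * r ^ (N - Z.abs_nat j)) with (4 * P * / (1 - r)) by (unfold P; field; lra).
      apply Rmult_le_compat_l; [unfold Bd in HBd; unfold P; lra|].
      rewrite <- Rinv_1 at 1. apply Rinv_le_contravar; lra. }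
  apply (le_of_factorial_error _ _ 2 (6 * t)). intros p.
  set (K := (Z.of_nat N + Z.of_nat p)%Z).
  destruct (AL_forward_exists (restrict (- K) K q0)) as [u Fu].
  { intros n; apply restrict_in_disc, hq0. }
  destruct (AL_forward_exists (restrict (- K) (Z.of_nat N) q0)) as [v Fv].
  { intros n; apply restrict_in_disc, hq0. }
  assert (D1 : Cmod (q t j - u t j) <= light_cone t p).
  { apply (AL_finite_speed q0 (restrict (- K) K q0) q u (- K) K Fq Fu hq0); try (unfold K; lia); try lra.
    - intros n; apply restrict_in_disc, hq0.
    - intros n Hn. symmetry. apply restrict_in. exact Hn. }
  assert (D2 : Cmod (u t j - v t j) <= Bd).
  { eapply Rle_trans; [apply (one_sided_estimate (restrict (- K) K q0) (restrict (- K) (Z.of_nat N) q0) u v K (Z.of_nat N) eta j t r Fu Fv)|].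
    - intros n; apply restrict_in_disc, hq0.
    - intros n; apply restrict_in_disc, hq0.
    - intros n Hn. apply restrict_out. lia.
    - intros n Hn. apply restrict_out. unfold K in Hn; lia.
    - unfold K; lia.
    - unfold K; lia.
    - lia.
    - intros n Hn. destruct (Z_le_gt_dec (- K) n).
      + rewrite !restrict_in by (unfold K in *; lia). reflexivity.
      + rewrite !restrict_out by lia. reflexivity.
    - lra.
    - apply restrict_log_mass; assumption.
    - apply restrict_log_mass; assumption.
    - exact Ht.
    - exact Hr.
    - apply Hone. lia. }
  assert (D3 : Cmod (v t j - qN t j) <= Bd).
  { replace j with (- - j)%Z at 1 2 by lia.
    eapply Rle_trans; [apply (one_sided_estimate _ _ _ _ K (Z.of_nat N) eta (- j) t r (AL_forward_reflect _ _ Fv) (AL_forward_reflect _ _ FN))|].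
    - intros n; apply restrict_in_disc, hq0.
    - intros n; apply restrict_in_disc, hq0.
    - intros n Hn. apply restrict_out. unfold K in Hn; lia.
    - intros n Hn. apply restrict_out. unfold K in Hn; lia.
    - unfold K; lia.
    - unfold K; lia.
    - lia.
    - intros n Hn. destruct (Z_le_gt_dec (- Z.of_nat N) n).
      + rewrite !restrict_in by (unfold K in *; lia). reflexivity.
      + rewrite !restrict_out by lia. reflexivity.
    - lra.
    - intros n k. rewrite (sumZ_reflect (log_mass (restrict (- K) (Z.of_nat N) q0))). apply restrict_log_mass; assumption.
    - intros n k. rewrite (sumZ_reflect (log_mass (restrict (- Z.of_nat N) (Z.of_nat N) q0))). apply restrict_log_mass; assumption.
    - exact Ht.
    - exact Hr.
    - apply Hone. lia. }
  replace (q t j - qN t j)%C with ((q t j - u t j) + ((u t j - v t j) + (v t j - qN t j)))%C by ring.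
  eapply Rle_trans; [apply Cmod_triangle|].
  eapply Rle_trans; [apply Rplus_le_compat_l, Cmod_triangle|].
  unfold light_cone in D1. lra.
Qed.
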